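(* Let $\Phi=(\phi_i:X\to X)_{i\in I}$ be a finitely generated contracting $\mathcal{C}^{1+\epsilon}$ conformal iterated function system on a compact set $X\subset\mathbb{R}$, with $\phi_i'>0$ on $X$ for all $i\in I$, satisfying the open set condition. Let $\pi:I^{\mathbb{N}}\to\mathbb{R}$ be its coding map, $\Lambda=\pi(I^{\mathbb{N}})$ its attractor and $\varphi$ its geometric potential. Let $\psi:I^{\mathbb{N}}\to\mathbb{R}$ be Hölder continuous, let $\mu_\psi$ be the unique Gibbs measure for $\psi$, and let $\mu:=\mu_\psi\circ\pi^{-1}$. For $\alpha\in\mathbb{R}$ put \[ \mathcal{F}(\alpha)=\Big\{x\in\Lambda : \lim_{r\to0}\tfrac{\log\mu(B(x,r))}{\log r}=\alpha\Big\}, \] \[ R_*(\alpha)=\Big\{x\in\Lambda : \liminf_{r\to0}\tfrac{\log\mu(B(x,r))}{\log r}=\alpha\Big\},\qquad R^*(\alpha)=\Big\{x\in\Lambda : \limsup_{r\to0}\tfrac{\log\mu(B(x,r))}{\log r}=\alpha\Big\}, \] \[ \mathcal{F}^*(\alpha)=\Big\{x\in\Lambda : \text{there exists a sequence } r_k>0,\ r_k\to0,\text{ with } \lim_{k\to\infty}\tfrac{\log\mu(B(x,r_k))}{\log r_k}=\alpha\Big\}. \] Let \[ \alpha_-:=\inf_{\omega\in I^{\mathbb{N}}}\liminf_{n\to\infty}\frac{S_n\psi(\omega)}{S_n\varphi(\omega)},\qquad \alpha_+:=\sup_{\omega\in I^{\mathbb{N}}}\limsup_{n\to\infty}\frac{S_n\psi(\omega)}{S_n\varphi(\omega)}.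 \] For $\beta\in\mathbb{R}$ let $t(\beta)$ be the unique real number with $\mathcal{P}(t(\beta)\varphi+\beta\psi)=0$, and let $t^*(a):=\sup_{x\in\mathbb{R}}(ax-t(x))$ for $a\in\mathbb{R}$. Then for all $\alpha\in[\alpha_-,\alpha_+]$, \[ \dim_H R_*(\alpha)=\dim_H R^*(\alpha)=\dim_H\mathcal{F}(\alpha)=\dim_H\mathcal{F}^*(\alpha)=-t^*(-\alpha), \] and for all $\alpha\in\mathbb{R}\setminus[\alpha_-,\alpha_+]$, \[ R_*(\alpha)=R^*(\alpha)=\mathcal{F}(\alpha)=\mathcal{F}^*(\alpha)=\emptyset . \]
   Context: $\dim_H$ denotes Hausdorff dimension and $B(x,r)=\{y\in\mathbb{R}:|y-x|<r\}$. Conformal iterated function system: $I$ is a finite nonempty index set, $X\subset\mathbb{R}$ is a compact set, and $\Phi=(\phi_i)_{i\in I}$ is a family of injective uniform contractions $\phi_i:X\to X$, each of which extends to a $\mathcal{C}^{1+\epsilon}$ diffeomorphism (i.e. $\mathcal{C}^1$ with $\epsilon$-Hölder continuous derivative, for some $\epsilon>0$) from an open neighbourhood of $X$ onto its image. It is assumed throughout that $\phi_i'>0$ on $X$ for each $i\in I$. Open set condition: there is a nonempty open interval $U\subset\mathbb{R}$ with $\phi_i(U)\subset U$ for all $i\in I$ and $\phi_i(U)\cap\phi_j(U)=\emptyset$ for all $i\ne j$ in $I$. Coding map: for $\omega=(\omega_1,\omega_2,\dots)\in I^{\mathbb{N}}$, $\pi(\omega)$ is the unique point with $\bigcap_{n\ge1}\phi_{\omega_1}\circ\cdots\circ\phi_{\omega_n}(X)=\{\pi(\omega)\}$.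 The attractor is $\Lambda:=\pi(I^{\mathbb{N}})$. Symbolic setting: $\sigma:I^{\mathbb{N}}\to I^{\mathbb{N}}$ is the left shift; $I^{\mathbb{N}}$ carries the usual shift metric (e.g. $d(\omega,\tau)=2^{-\min\{n:\omega_n\neq\tau_n\}}$ for $\omega\ne\tau$). The geometric potential is $\varphi(\omega):=\log\phi_{\omega_1}'(\pi(\sigma(\omega)))$; it is Hölder continuous and $\varphi<0$. For $u:I^{\mathbb{N}}\to\mathbb{R}$, $S_nu:=\sum_{k=0}^{n-1}u\circ\sigma^k$. $\mathcal{P}(u)$ denotes the topological pressure of a continuous function $u:I^{\mathbb{N}}\to\mathbb{R}$ with respect to $\sigma$. Gibbs measure (in the sense of Bowen): for Hölder continuous $\psi$, $\mu_\psi$ is the unique $\sigma$-invariant Borel probability measure on $I^{\mathbb{N}}$ for which there is a constant $c\ge1$ with $c^{-1}\le \mu_\psi([\omega_1,\dots,\omega_n])/\exp(S_n\psi(\omega)-n\mathcal{P}(\psi))\le c$ for all $\omega\in I^{\mathbb{N}}$, $n\ge1$, where $[\omega_1,\dots,\omega_n]$ is the cylinder of sequences beginning with $\omega_1,\dots,\omega_n$.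
   Formalization: The potential is assumed normalized, P(ψ)=0, since the claim fails otherwise (x/2, x/2+1/2, ψ=0: F(0) is empty but −t*(0)=1); replace ψ by ψ−P(ψ). In the open set condition, U is taken to lie in the domains of the extended maps and to meet X. *)

(* Defs.v *)
From HB Require Import structures.
From mathcomp Require Import all_boot all_order all_algebra.
From mathcomp Require Import all_classical all_reals all_analysis.

Set Implicit Arguments.
Unset Strict Implicit.
Unset Printing Implicit Defensive.

Import Order.TTheory GRing.Theory Num.Theory.
Import numFieldNormedType.Exports.

Local Open Scope classical_set_scope.
Local Open Scope ring_scope.

Section HausdorffDimension.
Variable R : realType.
Local Open Scope ereal_scope.

(* The supremum over the empty set is -oo, so [diam set0 = -oo]. *)
Definition diam (A : set R) : \bar R :=
  ereal_sup [set `|z.1 - z.2|%:E | z in A `*` A].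

(* Empty covering sets contribute 0 also when s = 0 (library powers satisfy
   [x `^ 0 = 1]). *)
Definition diam_pow (s : R) (A : set R) : \bar R :=
  if A == set0 then 0 else poweR (diam A) s.

Definition hausdorff_content (s delta : R) (A : set R) : \bar R :=
  ereal_inf [set \sum_(0 <= n <oo) diam_pow s (C n) |
    C in [set C : nat -> set R |
      A `<=` \bigcup_n C n /\ forall n, diam (C n) <= delta%:E]].

Definition hausdorff_measure (s : R) (A : set R) : \bar R :=
  ereal_sup [set hausdorff_content s delta A | delta in [set d | (0 < d)%R]].

Definition hausdorff_dim (A : set R) : \bar R :=
  ereal_inf [set s%:E |
    s in [set s : R | (0 <= s)%R /\ hausdorff_measure s A = 0]].

End HausdorffDimension.

(* I^N, with positions numbered from 0 : [w n] is the letter usually written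
   w_(n+1).  The letter i0 only witnesses that I is nonempty; it is needed
   because measurable types of the library are pointed. *)
Definition seq_space (I : finType) (i0 : I) : Type := nat -> I.

HB.instance Definition _ (I : finType) (i0 : I) :=
  Choice.copy (seq_space i0) (nat -> I).
HB.instance Definition _ (I : finType) (i0 : I) :=
  isPointed.Build (seq_space i0) (fun _ => i0).

Section Symbolic.
Variables (R : realType) (I : finType).
Implicit Types (w v : nat -> I) (u : (nat -> I) -> R).

Definition shift w : nat -> I := fun n => w n.+1.

Definition shift_dist w v : R :=
  if pselect (exists n, w n != v n) is left e then 2 ^- (ex_minn e).+1 else 0.

Definition shift_open : set (set (nat -> I)) :=
  [set A | forall w, A w ->
    exists2 e : R, 0 < e & forall v, shift_dist w v < e -> A v].

Definition holder u : Prop :=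
  exists C a : R, 0 < a /\
    forall w v, `|u w - u v| <= C * (shift_dist w v) `^ a.

Definition cylinder n (p : n.-tuple I) : set (nat -> I) :=
  [set w | forall k : 'I_n, w k = tnth p k].

Definition prefix w n : n.-tuple I := [tuple w k | k < n].

Definition birkhoff u n w : R := \sum_(k < n) u (iter k shift w).

(* Topological pressure of the full shift, for the generating partition into
   cylinders of length one:
   lim_n (1/n) log sum_{|p| = n} sup_{[p]} exp (S_n u). *)
Definition pressure u : R :=
  limn (fun n : nat => n%:R^-1 *
    ln (\sum_(p : n.-tuple I)
          sup [set expR (birkhoff u n w) | w in cylinder p])).

End Symbolic.

(* I^N with its Borel sigma-algebra. *)
Notation borel_seq R i0 :=
  (g_sigma_algebraType (@shift_open R _ : set (set (seq_space i0)))).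

Definition is_gibbs (R : realType) (I : finType) (i0 : I)
    (psi : (nat -> I) -> R) (mu : probability (borel_seq R i0) R) : Prop :=
  (forall A : set (borel_seq R i0),
    measurable A -> mu (@shift I @^-1` A) = mu A) /\
  exists c : R, 1 <= c /\ forall (w : nat -> I) (n : nat), (1 <= n)%N ->
    c^-1 <= fine (mu (cylinder (prefix w n)))
              / expR (birkhoff psi n w - n%:R * pressure psi) <= c.

Section ConformalIFS.
Variable R : realType.

Definition C1_on (V : set R) (f : R -> R) : Prop :=
  forall x, V x -> derivable f x 1 /\ {for x, continuous (derive1 f)}.

Definition C1holder_on (e : R) (V : set R) (f : R -> R) : Prop :=
  C1_on V f /\ exists C : R, forall x y, V x -> V y ->
    `|derive1 f x - derive1 f y| <= C * `|x - y| `^ e.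

(* f is a C^(1+e) map on V having a C^1 inverse f @` V -> V. *)
Definition C1holder_diffeo_on (e : R) (V : set R) (f : R -> R) : Prop :=
  C1holder_on e V f /\
  exists g : R -> R, (forall x, V x -> g (f x) = x) /\ C1_on (f @` V) g.

(* [ifs_map i] restricted to [ifs_set] is the map phi_i : X -> X, and
   restricted to [ifs_nbhd i] it is the diffeomorphism extending phi_i; its
   values elsewhere are irrelevant.  The extension is part of the data since
   the derivative at isolated points of X depends on it. *)
Record conformal_ifs (I : finType) := ConformalIFS {
  ifs_set : set R ;
  ifs_nbhd : I -> set R ;
  ifs_map : I -> R -> R ;
  ifs_compact : compact ifs_set ;
  ifs_stable : forall i x, ifs_set x -> ifs_set (ifs_map i x) ;
  ifs_inj : forall i, set_inj ifs_set (ifs_map i) ;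
  ifs_contract : exists2 c : R, c < 1 & forall i x y,
    ifs_set x -> ifs_set y ->
    `|ifs_map i x - ifs_map i y| <= c * `|x - y| ;
  ifs_nbhd_open : forall i, open (ifs_nbhd i) ;
  ifs_nbhd_sub : forall i, ifs_set `<=` ifs_nbhd i ;
  ifs_diffeo : exists2 e : R, 0 < e &
    forall i, C1holder_diffeo_on e (ifs_nbhd i) (ifs_map i) ;
  ifs_deriv_gt0 : forall i x, ifs_set x -> 0 < derive1 (ifs_map i) x
}.

Variables (I : finType) (Phi : conformal_ifs I).

(* For phi_i(U) to make sense, U must lie in the domains of the (extended)
   maps.  U must also meet X: otherwise the condition would only concern the
   extensions away from X and say nothing about the system itself.  Both
   clauses hold in particular when U is contained in X. *)
Definition open_set_condition : Prop :=
  exists U : set R,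
    [/\ open U, is_interval U,
        U `&` ifs_set Phi !=set0 & forall i, U `<=` ifs_nbhd Phi i] /\
    (forall i, ifs_map Phi i @` U `<=` U) /\
    (forall i j, i != j -> ifs_map Phi i @` U `&` ifs_map Phi j @` U = set0).

Fixpoint ifs_comp (w : nat -> I) (n : nat) (x : R) : R :=
  if n is m.+1 then ifs_comp w m (ifs_map Phi (w m) x) else x.

Definition coding (w : nat -> I) : R :=
  get (\bigcap_(n in [set n | (1 <= n)%N]) (ifs_comp w n @` ifs_set Phi)).

Definition attractor : set R := range coding.

Definition geom_potential (w : nat -> I) : R :=
  ln (derive1 (ifs_map Phi (w 0%N)) (coding (shift w))).

End ConformalIFS.

Section Spectrum.
Variable R : realType.

Section LevelSets.
Variables (L : set R) (nu : set R -> \bar R).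

Definition local_exponent (x r : R) : R := ln (fine (nu (ball x r))) / ln r.

Definition level_lim (alpha : R) : set R :=
  [set x | L x /\ local_exponent x r @[r --> 0^'+] --> alpha].

Definition level_liminf (alpha : R) : set R :=
  [set x | L x /\
    limf_einf (fun r : R => (local_exponent x r)%:E) 0^'+ = alpha%:E].

Definition level_limsup (alpha : R) : set R :=
  [set x | L x /\
    limf_esup (fun r : R => (local_exponent x r)%:E) 0^'+ = alpha%:E].

Definition level_seq (alpha : R) : set R :=
  [set x | L x /\ exists r : nat -> R,
    [/\ forall k, 0 < r k, r @ \oo --> 0 &
        local_exponent x (r k) @[k --> \oo] --> alpha]].

End LevelSets.

Variable I : finType.
Implicit Types phi psi : (nat -> I) -> R.

Definition birkhoff_ratio phi psi (w : nat -> I) (n : nat) : \bar R :=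
  (birkhoff psi n w / birkhoff phi n w)%:E.

Definition alpha_minus phi psi : \bar R :=
  ereal_inf (range (fun w => limn_einf (birkhoff_ratio phi psi w))).

Definition alpha_plus phi psi : \bar R :=
  ereal_sup (range (fun w => limn_esup (birkhoff_ratio phi psi w))).

Definition temperature phi psi (beta : R) : R :=
  get [set t : R | pressure (fun w => t * phi w + beta * psi w) = 0].

Definition legendre (t : R -> R) (a : R) : \bar R :=
  ereal_sup (range (fun x => (a * x - t x)%:E)).

End Spectrum.

(* Main.v *)
(** Put D := inf_b (alpha b + t(b)) = - t^*(- alpha).  The hull of X cap U is an
interval whose images under the words are ordered, of length
exp (S_n varphi) and of mass exp (S_n psi) up to constants, where n is the
length of the word.

Upper bound: a point x with a sequence of exponents tending to alpha lies, for
arbitrarily long words p, in a slight enlargement of the interval of p, with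
(alpha b + t(b)) S_n varphi <= t(b) S_n varphi + b S_n psi up to a small multiple
of S_n varphi.  As the sums of exp (t(b) S_n varphi + b S_n psi) over the words of
length n are bounded, the enlarged intervals are an efficient cover.

Lower bound: D <= alpha b + t(b) for every b makes the sums of
exp (D S_n varphi + b (S_n psi - alpha S_n varphi)) decay at most like
exp (- C (1 + |b|)), with C independent of n.  Choosing b by Lagrange duality
centres S_n psi - alpha S_n varphi, and Chebyshev's inequality gives a set T of
words of one length L on which it is at most e L, with
log |T| >= - D S_L varphi - e L.  All concatenations of such blocks, with e
tending slowly to 0, code points with exponent alpha, and a converse of Kraft's
inequality bounds the dimension of the set of these points below by D.  Every
block begins with a word whose interval lies inside the hull; hence small balls
about these points do not meet the neighbouring intervals. *)
Require Import Defs.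
From HB Require Import structures.
From mathcomp Require Import all_boot all_order all_algebra.
From mathcomp Require Import all_classical all_reals all_analysis.
From mathcomp Require Import ring lra zify.
Set Implicit Arguments.
Unset Strict Implicit.
Unset Printing Implicit Defensive.
Import Order.TTheory GRing.Theory Num.Theory.
Import numFieldNormedType.Exports.
Local Open Scope classical_set_scope.
Local Open Scope ring_scope.

(** The four level sets are squeezed between the points that have exponent [alpha] and the points
    for which [alpha] is a cluster value of the exponents, so one lower and one upper bound serve
    them all. The argument has to cover the end points of the spectrum and the degenerate case of a
    single exponent; there the sums to be minimised over b need not have a minimiser. A penalty (C +
    1)|b| makes the problem coercive. It is harmless: it moves the centre of S_n psi - alpha S_n
    varphi by at most C + 1, negligible against n because C does not depend on n. Its excess over
    C|b| also pays for the unknown tilt b when typical words are counted. The geometry reaches the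
    two bounds only through [coded_intervals]; a system with one letter, whose hull may be a point,
    is given artificial intervals. *)

Lemma le_of_eq (R : realType) (x y : R) : x = y -> x <= y.
Proof. by move=> ->. Qed.

(** * Words, pressure and temperature *)

Section Words.
Variables (R : realType) (I : finType) (i0 : I).
Implicit Types (w v : nat -> I) (u : (nat -> I) -> R) (p q : seq I).

Definition agree n w v := forall k, (k < n)%N -> w k = v k.

(** Stands in for Hölder continuity below: it is stable under linear combinations and makes Birkhoff
    sums functions of finite words up to a constant. *)
Definition bounded_distortion u (C : R) := forall n w v,
  agree n w v -> `|birkhoff u n w - birkhoff u n v| <= C.

Definition word_point p : nat -> I := nth i0 p.

(** A representative value on the cylinder of [p], taken at the word continued by [i0] for ever. *)
Definition word_sum u p : R := birkhoff u (size p) (word_point p).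

Lemma iter_shiftE n w k : iter n (@Defs.shift I) w k = w (n + k)%N.
Proof. by elim: n k => [|n IH] k //=; rewrite /Defs.shift IH addnS addSn. Qed.

Lemma birkhoff0 u w : birkhoff u 0 w = 0.
Proof. by rewrite /birkhoff big_ord0. Qed.

Lemma birkhoffD u n m w :
  birkhoff u (n + m) w = birkhoff u n w + birkhoff u m (iter n (@Defs.shift I) w).
Proof.
rewrite /birkhoff big_split_ord /=; congr (_ + _).
by apply: eq_bigr => k _; rewrite addnC iterD.
Qed.

Lemma birkhoff1 u w : birkhoff u 1 w = u w.
Proof. by rewrite /birkhoff big_ord1. Qed.

Lemma birkhoffS u n w : birkhoff u n.+1 w = u w + birkhoff u n (Defs.shift w).
Proof. by rewrite -add1n birkhoffD birkhoff1. Qed.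

Lemma birkhoff_lin (a b : R) (f g : (nat -> I) -> R) n w :
  birkhoff (fun w => a * f w + b * g w) n w =
  a * birkhoff f n w + b * birkhoff g n w.
Proof. by rewrite /birkhoff big_split/= -!mulr_sumr. Qed.

Lemma bounded_distortion_lin (a b : R) f g Cf Cg :
  bounded_distortion f Cf -> bounded_distortion g Cg ->
  bounded_distortion (fun w => a * f w + b * g w) (`|a| * Cf + `|b| * Cg).
Proof.
move=> hf hg n w v wv; rewrite !birkhoff_lin.
have -> : a * birkhoff f n w + b * birkhoff g n w -
   (a * birkhoff f n v + b * birkhoff g n v) =
   a * (birkhoff f n w - birkhoff f n v) + b * (birkhoff g n w - birkhoff g n v).
  by ring.
apply: le_trans (ler_normD _ _) _; rewrite !normrM.
by apply: lerD; apply: ler_wpM2l => //; [exact: hf|exact: hg].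
Qed.

Lemma bounded_distortion_ge0 u C : bounded_distortion u C -> 0 <= C.
Proof.
move=> h; have := h 0%N (fun=> i0) (fun=> i0) (fun _ _ => erefl).
by apply: le_trans.
Qed.

Lemma agree_word n w : agree n w (word_point (mkseq w n)).
Proof. by move=> k kn; rewrite /word_point nth_mkseq. Qed.

Lemma agree_mkseq n w v : agree n w v <-> mkseq w n = mkseq v n.
Proof.
split=> [h|h k kn].
  by apply/eq_in_map => k; rewrite mem_iota add0n => /andP[_ /h].
by rewrite -(nth_mkseq i0 w kn) h nth_mkseq.
Qed.

Lemma mkseqD w n m :
  mkseq w (n + m) = mkseq w n ++ mkseq (iter n (@Defs.shift I) w) m.
Proof.
rewrite /mkseq iotaD map_cat add0n -{1}[n in iota n m]addn0 iotaDl -map_comp.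
by congr (_ ++ _); apply: eq_map => k /=; rewrite iter_shiftE.
Qed.

Definition mkseqt w n : n.-tuple I := Tuple (introT eqP (size_mkseq w n)).

Lemma mkseq_word p : mkseq (word_point p) (size p) = p.
Proof. exact: mkseq_nth. Qed.

Lemma word_sum_nil u : word_sum u [::] = 0.
Proof. exact: birkhoff0. Qed.

Lemma word_sum_mkseq u C n w : bounded_distortion u C ->
  `|birkhoff u n w - word_sum u (mkseq w n)| <= C.
Proof. by move=> h; rewrite /word_sum size_mkseq; apply/h/agree_word. Qed.

Lemma word_sum_cat u C p q : bounded_distortion u C ->
  `|word_sum u (p ++ q) - word_sum u p - word_sum u q| <= 2 * C.
Proof.
move=> h; rewrite /word_sum size_cat birkhoffD.
have h1 := h (size p) (word_point (p ++ q)) (word_point p).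
have h2 := h (size q) (iter (size p) (@Defs.shift I) (word_point (p ++ q))) (word_point q).
have /h1 {}h1 : agree (size p) (word_point (p ++ q)) (word_point p).
  by move=> k kp; rewrite /word_point nth_cat kp.
have /h2 {}h2 : agree (size q)
    (iter (size p) (@Defs.shift I) (word_point (p ++ q))) (word_point q).
  move=> k kq; rewrite iter_shiftE /word_point nth_cat ltnNge leq_addr /=.
  by rewrite addKn.
rewrite mulr_natl mulr2n.
apply: le_trans (lerD h1 h2); apply: le_trans _ (ler_normD _ _).
by apply: le_of_eq; congr (`|_|); ring.
Qed.

Lemma word_sum_lin (a b : R) f g p :
  word_sum (fun w => a * f w + b * g w) p = a * word_sum f p + b * word_sum g p.
Proof. exact: birkhoff_lin. Qed.

Lemma distortion_exp u (K rho : R) : 0 <= K -> 0 <= rho -> rho < 1 ->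
  (forall m w v, agree m w v -> (1 <= m)%N -> `|u w - u v| <= K * rho ^+ m) ->
  bounded_distortion u (K / (1 - rho)).
Proof.
move=> K0 r0 r1 h n w v; rewrite ler_pdivlMr ?subr_gt0//.
(* The induction carries a partial geometric sum with the denominator [1 - rho] cleared. *)
suff H : agree n w v -> `|birkhoff u n w - birkhoff u n v| * (1 - rho) <=
   K * (1 - rho ^+ n.+1).
  move/H => /le_trans; apply; rewrite -[leRHS]mulr1 ler_wpM2l// gerBl.
  exact: exprn_ge0.
elim: n w v => [|n IH] w v wv.
  rewrite !birkhoff0 subrr normr0 mul0r mulr_ge0// subr_ge0 expr1.
  exact: ltW.
rewrite !birkhoffS.
have -> : u w + birkhoff u n (Defs.shift w) - (u v + birkhoff u n (Defs.shift v)) =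
  (u w - u v) + (birkhoff u n (Defs.shift w) - birkhoff u n (Defs.shift v)) by ring.
apply: le_trans (_ : (`|u w - u v| +
  `|birkhoff u n (Defs.shift w) - birkhoff u n (Defs.shift v)|) * (1 - rho) <= _).
  by rewrite ler_wpM2r ?ler_normD// subr_ge0 ltW.
rewrite mulrDl.
have := IH (Defs.shift w) (Defs.shift v) _; rewrite /Defs.shift.
have wv' : agree n (fun n0 : nat => w n0.+1) (fun n0 : nat => v n0.+1).
  by move=> k kn; apply: wv.
move=> /(_ wv') {}IH.
have h' := h n.+1 w v wv isT.
have : `|u w - u v| * (1 - rho) <= K * rho ^+ n.+1 * (1 - rho).
  by rewrite ler_wpM2r// subr_ge0 ltW.
rewrite exprS in IH *; rewrite [rho ^+ n.+2]exprS.
move=> H1; apply: le_trans (lerD H1 IH) _.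
by apply: le_of_eq; rewrite exprS; ring.
Qed.

Lemma shift_dist_le m w v : agree m w v -> shift_dist R w v <= 2 ^- m.+1.
Proof.
move=> wv; rewrite /shift_dist; case: pselect => [e|_]; last first.
  by rewrite invr_ge0 exprn_ge0.
case: ex_minnP => n wvn _.
rewrite lef_pV2 ?posrE ?exprn_gt0//.
rewrite ler_eXn2l ?ltr1n// ltnS leqNgt; apply/negP => /wv /eqP.
by rewrite (negbTE wvn).
Qed.

Lemma shift_dist_ge0 w v : 0 <= shift_dist R w v.
Proof.
by rewrite /shift_dist; case: pselect => // e; rewrite invr_ge0 exprn_ge0.
Qed.

Lemma shift_dist_agree m w v : shift_dist R w v < 2 ^- m -> agree m w v.
Proof.
rewrite /shift_dist; case: pselect => [e|ne _ k _]; last first.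
  by apply/eqP; apply/negPn/negP => wvk; apply: ne; exists k.
case: ex_minnP => n wvn hmin.
rewrite ltf_pV2 ?posrE ?exprn_gt0// ltr_eXn2l ?ltr1n// ltnS => mn k km.
apply/eqP; apply/negPn/negP => /hmin; rewrite leqNgt.
by rewrite (leq_trans km).
Qed.

Lemma holder_distortion u : holder u -> exists C, bounded_distortion u C.
Proof.
move=> [C [a [a0 h]]]; exists (`|C| / (1 - 2^-1 `^ a)).
have r1 : (2^-1 : R) `^ a < 1.
  have h1 : 1 `^ a = 1 :> R by rewrite powR1.
  by rewrite -[ltRHS]h1 gt0_ltr_powR// ?nnegrE ?invr_ge0// invf_lt1 ?ltr1n.
apply: distortion_exp => //.
move=> m w v wv m0; apply: le_trans (h w v) _.
apply: le_trans (ler_norm _) _; rewrite normrM ler_wpM2l//.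
rewrite ger0_norm ?powR_ge0//.
rewrite -powR_mulrn ?powR_ge0// -powRrM mulrC powRrM powR_mulrn//.
rewrite ge0_ler_powR ?nnegrE ?shift_dist_ge0 ?exprn_ge0 ?invr_ge0//; first exact: ltW.
apply: le_trans (shift_dist_le wv) _.
by rewrite -exprVn ler_wiXn2l// ?invr_ge0// invf_le1 ?ler1n.
Qed.

(** Distortion at length one compares [w] with a constant sequence, and there are finitely many of
    these. *)
Lemma bounded_distortion_bounded u C : bounded_distortion u C ->
  exists2 B, 0 <= B & forall w, `|u w| <= B.
Proof.
move=> h; exists (C + \sum_i `|u (fun=> i)|).
  by rewrite addr_ge0 ?(bounded_distortion_ge0 h)// sumr_ge0.
move=> w.
have -> : u w = (u w - u (fun=> w 0%N)) + u (fun=> w 0%N) by ring.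
apply: le_trans (ler_normD _ _) _; apply: lerD.
  have := h 1%N w (fun=> w 0%N); rewrite !birkhoff1; apply.
  by case.
by rewrite (bigD1 (w 0%N))//= lerDl sumr_ge0.
Qed.

Lemma birkhoff_le u (B : R) n w : (forall w, `|u w| <= B) ->
  `|birkhoff u n w| <= B * n%:R.
Proof.
move=> h; apply: le_trans (ler_norm_sum _ _ _) _.
by rewrite mulr_natr -[n in leRHS]card_ord -sumr_const ler_sum.
Qed.

Lemma sum_tuple_cons n (F : seq I -> R) :
  \sum_(p : n.+1.-tuple I) F p = \sum_i \sum_(p : n.-tuple I) F (i :: p).
Proof.
rewrite pair_big /= (reindex (fun ip : I * n.-tuple I => [tuple of ip.1 :: ip.2])) //=.
exists (fun p : n.+1.-tuple I => (thead p, [tuple of behead p])) => [[i p] _|p _].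
  by congr (_, _); apply/val_inj.
by apply/val_inj; rewrite /= [in RHS](tuple_eta p).
Qed.

Lemma sum_tuple0 (F : seq I -> R) : \sum_(p : 0.-tuple I) F p = F [::].
Proof.
rewrite (bigD1 [tuple])//= big1 ?addr0// => p /eqP[].
exact: tuple0.
Qed.

Lemma sum_tuple_cat n m (F : seq I -> R) : \sum_(p : (n + m).-tuple I) F p =
  \sum_(p : n.-tuple I) \sum_(q : m.-tuple I) F (p ++ q).
Proof.
elim: n F => [|n IH] F.
  by rewrite (sum_tuple0 (fun p => \sum_(q : m.-tuple I) F (p ++ q))).
rewrite addSn sum_tuple_cons.
rewrite (sum_tuple_cons n (fun p => \sum_(q : m.-tuple I) F (p ++ q))).
by apply: eq_bigr => i _; rewrite (IH (fun p => F (i :: p))).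
Qed.

End Words.

(** * Almost additive sequences *)

Section AlmostAdditive.
Variable R : realType.

Lemma le0_archimedean (x K : R) : (forall n : nat, n%:R * x <= K) -> x <= 0.
Proof.
move=> h; rewrite leNgt; apply/negP => x0.
near \oo => n.
have := h n; apply/negP; rewrite -ltNge -ltr_pdivrMr//.
near: n; exact: nbhs_infty_gtr.
Unshelve. all: by end_near. Qed.

(** Fekete's lemma: subadditivity makes the limit the infimum of [a n / n]. The defect [K] occurs
    once per summand, so division by the number of summands leaves a bounded error at every [n], not
    just in the limit. *)
Lemma almost_additive_lim (a : nat -> R) (K : R) :
  (forall n m, a (n + m)%N <= a n + a m) ->
  (forall n m, a n + a m <= a (n + m)%N + K) ->
  forall n, n%:R * limn (fun n => n%:R^-1 * a n) <= a n <=
            n%:R * limn (fun n => n%:R^-1 * a n) + K.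
Proof.
move=> hU hL.
have a0 : 0 <= a 0%N by have := hU 0%N 0%N; rewrite addn0 lerDl.
have a0K : a 0%N <= K by have := hL 0%N 0%N; rewrite addn0 lerD2l.
have K0 := le_trans a0 a0K.
have mulU m n : a (m.+1 * n)%N <= m.+1%:R * a n.
  elim: m => [|m IH]; first by rewrite mul1n mul1r.
  rewrite mulSn; apply: le_trans (hU _ _) _.
  by rewrite -(natr1 m.+1) mulrDl mul1r addrC lerD2r.
have mulL m n : m.+1%:R * a n <= a (m.+1 * n)%N + m.+1%:R * K.
  elim: m => [|m IH]; first by rewrite mul1n !mul1r lerDl.
  have := hL n (m.+1 * n)%N; rewrite -mulSn => H.
  rewrite -(natr1 m.+1) !mulrDl !mul1r.
  lra.
(* Two estimates of [a (m * n)], cut into pieces of length [n] and of length [m]. *)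
have key n m : (0 < n)%N -> (0 < m)%N -> m%:R * a n <= n%:R * a m + m%:R * K.
  case: n m => // n [//|m] _ _; apply: le_trans (mulL m n.+1) _.
  by rewrite lerD2r mulnC; exact: mulU.
pose S := [set n%:R^-1 * a n | n in [set n | (0 < n)%N]].
have S1 : S (a 1%N) by exists 1%N => //=; rewrite invr1 mul1r.
have lbS n : (0 < n)%N -> lbound S (n%:R^-1 * (a n - K)).
  move=> n0 _ [m /= m0 <-].
  rewrite ler_pdivrMl ?ltr0n// mulrCA ler_pdivlMl ?ltr0n//.
  have := key n m n0 m0; lra.
have hS : has_inf S.
  by split; [exists (a 1%N) | exists (1%:R^-1 * (a 1%N - K)); exact: lbS].
have low n : (0 < n)%N -> n%:R * inf S <= a n.
  move=> n0; rewrite -ler_pdivlMl ?ltr0n//.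
  by apply: ge_inf; [exact: hS.2 | exists n].
have up n : (0 < n)%N -> a n <= n%:R * inf S + K.
  move=> n0; rewrite -lerBlDr -ler_pdivrMl ?ltr0n//.
  by apply: lb_le_inf; [exact: hS.1 | exact: lbS].
suff -> : limn (fun n => n%:R^-1 * a n) = inf S.
  case=> [|n]; first by rewrite !mul0r a0 add0r.
  by rewrite low// up.
apply/cvg_lim => //; apply/cvgrPdist_le => e e0; near=> n.
have n0 : (0 < n)%N by near: n; exists 1%N.
rewrite distrC ger0_norm; last first.
  by rewrite subr_ge0 ler_pdivlMl ?ltr0n// low.
rewrite lerBlDr ler_pdivrMl ?ltr0n//; apply: le_trans (up n n0) _.
rewrite mulrDr addrC lerD2r -ler_pdivrMr//.
by apply: ltW; near: n; exact: nbhs_infty_gtr.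
Unshelve. all: by end_near. Qed.

End AlmostAdditive.

Section Pressure.
Variables (R : realType) (I : finType) (i0 : I).
Implicit Types (w v : nat -> I) (u : (nat -> I) -> R) (p q : seq I).

(** The supremum in [pressure], on plain sequences so that concatenation needs no casts between
    tuple types. *)
Definition cyl_sup u p : R :=
  sup [set expR (birkhoff u (size p) w) | w in [set w | mkseq w (size p) = p]].

Lemma cylinderE n (p : n.-tuple I) : cylinder p = [set w | mkseq w n = p].
Proof.
apply/seteqP; split => w /= h.
  apply: (@eq_from_nth _ i0); first by rewrite size_mkseq size_tuple.
  move=> k; rewrite size_mkseq => kn; rewrite nth_mkseq//.
  by rewrite (h (Ordinal kn)) (tnth_nth i0).
by move=> k; rewrite (tnth_nth i0) -h nth_mkseq.
Qed.

Lemma pressureE u : pressure u =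
  limn (fun n : nat => n%:R^-1 * ln (\sum_(p : n.-tuple I) cyl_sup u p)).
Proof.
rewrite /pressure; congr (limn _); apply/funext => n; congr (_ * ln _).
apply: eq_bigr => p _; rewrite cylinderE /cyl_sup.
by have -> : size p = n by exact: size_tuple.
Qed.

Section BD.
Variables (u : (nat -> I) -> R) (C : R).
Hypothesis uC : bounded_distortion u C.

Let expR_ub w p : mkseq w (size p) = p ->
  expR (birkhoff u (size p) w) <= expR (word_sum i0 u p + C).
Proof.
move=> wp; rewrite ler_expR -lerBlDl; apply: le_trans (ler_norm _) _.
by have := word_sum_mkseq i0 (size p) w uC; rewrite wp.
Qed.

Lemma cyl_sup_ge w p : mkseq w (size p) = p ->
  expR (birkhoff u (size p) w) <= cyl_sup u p.
Proof.
move=> wp; apply: ub_le_sup; last by exists w.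
by exists (expR (word_sum i0 u p + C)) => _ [v /= vp <-]; exact: expR_ub.
Qed.

Lemma cyl_sup_le p (y : R) :
  (forall w, mkseq w (size p) = p -> expR (birkhoff u (size p) w) <= y) ->
  cyl_sup u p <= y.
Proof.
move=> h; apply: ge_sup; last by move=> _ [v /= vp <-]; exact: h.
exists (expR (birkhoff u (size p) (word_point i0 p))).
by exists (word_point i0 p) => //=; exact: mkseq_word.
Qed.

Lemma cyl_sup_word_sum p :
  expR (word_sum i0 u p) <= cyl_sup u p <= expR (word_sum i0 u p + C).
Proof.
rewrite cyl_sup_ge ?mkseq_word//=.
by apply: cyl_sup_le => w; exact: expR_ub.
Qed.

Lemma cyl_sup_gt0 p : 0 < cyl_sup u p.
Proof. by have /andP[+ _] := cyl_sup_word_sum p; apply: lt_le_trans (expR_gt0 _). Qed.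

Lemma cyl_sup_catU p q : cyl_sup u (p ++ q) <= cyl_sup u p * cyl_sup u q.
Proof.
apply: cyl_sup_le => w; rewrite size_cat mkseqD => /eqP.
rewrite eqseq_cat ?size_mkseq// => /andP[/eqP wp /eqP wq].
by rewrite birkhoffD expRD; apply: ler_pM; rewrite ?expR_ge0//; exact: cyl_sup_ge.
Qed.

(** Each of the two suprema costs one [C] and cutting the word costs [2 * C]. *)
Lemma cyl_sup_catL p q :
  cyl_sup u p * cyl_sup u q <= expR (4 * C) * cyl_sup u (p ++ q).
Proof.
have C0 := bounded_distortion_ge0 i0 uC.
have /andP[_ h1] := cyl_sup_word_sum p.
have /andP[_ h2] := cyl_sup_word_sum q.
have /andP[h3 _] := cyl_sup_word_sum (p ++ q).
have := word_sum_cat i0 p q uC; rewrite ler_norml => /andP[h4 _].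
apply: le_trans (ler_pM _ _ h1 h2) _; try exact/ltW/cyl_sup_gt0.
apply: le_trans (ler_wpM2l (expR_ge0 _) h3).
by rewrite -!expRD ler_expR; lra.
Qed.

Definition zeta n := \sum_(p : n.-tuple I) cyl_sup u p.

Lemma zeta_gt0 n : 0 < zeta n.
Proof.
rewrite /zeta (bigD1 [tuple of nseq n i0])//=.
rewrite ltr_wpDr ?cyl_sup_gt0// sumr_ge0// => p _.
exact/ltW/cyl_sup_gt0.
Qed.

Lemma zetaE n m : zeta (n + m) =
  \sum_(p : n.-tuple I) \sum_(q : m.-tuple I) cyl_sup u (p ++ q).
Proof. exact: (sum_tuple_cat n m (cyl_sup u)). Qed.

Lemma zeta_mul n m : zeta n * zeta m =
  \sum_(p : n.-tuple I) \sum_(q : m.-tuple I) cyl_sup u p * cyl_sup u q.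
Proof. by rewrite /zeta mulr_suml; under eq_bigr do rewrite mulr_sumr. Qed.

Lemma zeta_pressure n : n%:R * pressure u <= ln (zeta n) <= n%:R * pressure u + 4 * C.
Proof.
rewrite pressureE; apply: (almost_additive_lim (a := fun n => ln (zeta n))) => {}n m.
  rewrite -lnM ?posrE ?zeta_gt0// ler_ln ?posrE ?mulr_gt0 ?zeta_gt0//.
  rewrite zetaE zeta_mul; apply: ler_sum => p _; apply: ler_sum => q _.
  exact: cyl_sup_catU.
rewrite -lnM ?posrE ?zeta_gt0// -[X in _ <= _ + X]expRK -lnM ?posrE ?zeta_gt0 ?expR_gt0//.
rewrite ler_ln ?posrE ?mulr_gt0 ?zeta_gt0 ?expR_gt0//.
rewrite zetaE zeta_mul mulr_suml; apply: ler_sum => p _.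
rewrite mulr_suml; apply: ler_sum => q _.
by rewrite mulrC [leRHS]mulrC mulrC; exact: cyl_sup_catL.
Qed.

Lemma birkhoff_le_pressure n w : birkhoff u n w <= n%:R * pressure u + 4 * C.
Proof.
have /andP[_ h] := zeta_pressure n; apply: le_trans h.
rewrite -[leLHS]expRK ler_ln ?posrE ?expR_gt0 ?zeta_gt0//.
rewrite /zeta.
rewrite (bigD1 (mkseqt w n))//=.
rewrite ler_wpDr//; first by apply: sumr_ge0 => p _; exact/ltW/cyl_sup_gt0.
by have := @cyl_sup_ge w (mkseq w n); rewrite size_mkseq; exact.
Qed.

End BD.

Lemma cyl_sup_mul u u' Cu Cv p (x : R) : bounded_distortion u Cu ->
  bounded_distortion u' Cv ->
  (forall w, birkhoff u (size p) w <= birkhoff u' (size p) w + x) ->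
  cyl_sup u p <= expR x * cyl_sup u' p.
Proof.
move=> hu hv h; apply: cyl_sup_le => w wp.
apply: le_trans (_ : expR (birkhoff u' (size p) w + x) <= _).
  by rewrite ler_expR.
by rewrite addrC expRD ler_wpM2l ?expR_ge0// (cyl_sup_ge hv).
Qed.

(** The constant [K] does not grow with [n] and disappears on division by [n]. *)
Lemma pressure_le u u' Cu Cv (x K : R) : bounded_distortion u Cu ->
  bounded_distortion u' Cv ->
  (forall n w, birkhoff u n w <= birkhoff u' n w + (n%:R * x + K)) ->
  pressure u <= pressure u' + x.
Proof.
move=> hu hv h; rewrite -lerBlDl -subr_le0.
apply: (@le0_archimedean _ _ (K + 4 * Cv)) => n.
have /andP[h1 _] := zeta_pressure hu n.
have /andP[_ h2] := zeta_pressure hv n.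
have : ln (zeta u n) <= n%:R * x + K + ln (zeta u' n).
  rewrite -[X in _ <= X + _]expRK -lnM ?posrE ?expR_gt0 ?(zeta_gt0 hv)//.
  rewrite ler_ln ?posrE ?mulr_gt0 ?expR_gt0 ?(zeta_gt0 hv) ?(zeta_gt0 hu)//.
  rewrite /zeta mulr_sumr; apply: ler_sum => p _; apply: cyl_sup_mul hu hv _ => w.
  by rewrite size_tuple; exact: h.
move: (ln (zeta u n)) (ln (zeta u' n)) (pressure u) (pressure u') h1 h2.
by move=> a1 a2 a3 a4; lra.
Qed.

End Pressure.

(** * Terms of a sequence near its upper and lower limits *)

Section LimnEsup.
Variable R : realType.
Local Open Scope ereal_scope.
Implicit Types (u : nat -> \bar R) (x : \bar R).

Lemma limn_esup_gt u x : x < limn_esup u ->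
  forall N, exists2 n, (N <= n)%N & x < u n.
Proof.
move=> h N; apply: contrapT => nh; move: h; apply/negP; rewrite -leNgt.
rewrite /limn_esup limf_esupE.
apply: (@le_trans _ _ (ereal_sup (u @` [set n | (N <= n)%N]))).
  by apply: ereal_inf_lbound; exists [set n | (N <= n)%N] => //; exists N.
apply: ge_ereal_sup => _ [n /= Nn <-]; rewrite leNgt; apply/negP => xn.
by apply: nh; exists n.
Qed.

Lemma limn_esup_ge u x : (forall N, exists2 n, (N <= n)%N & x <= u n) ->
  x <= limn_esup u.
Proof.
move=> h; rewrite /limn_esup limf_esupE.
apply: le_ereal_inf_tmp => _ [V [N _ NV] <-].
have [n Nn xn] := h N; apply: le_trans xn _.
by apply: ereal_sup_ubound; exists n => //; exact: NV.
Qed.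

Lemma limn_einf_lt u x : limn_einf u < x ->
  forall N, exists2 n, (N <= n)%N & u n < x.
Proof.
rewrite /limn_einf lteNl => /limn_esup_gt h N.
by have [n Nn] := h N; rewrite lteN2 => ?; exists n.
Qed.

Lemma limn_einf_le u x : (forall N, exists2 n, (N <= n)%N & u n <= x) ->
  limn_einf u <= x.
Proof.
move=> h; rewrite /limn_einf leeNl; apply: limn_esup_ge => N.
by have [n Nn xn] := h N; exists n => //; rewrite leeN2.
Qed.

End LimnEsup.

(** * Temperature function and its relation to the exponents *)

Section Temperature.
Variables (R : realType) (I : finType) (i0 : I).
Implicit Types (w v : nat -> I) (p q : seq I).
Variables (phi psi : (nat -> I) -> R) (Cf Cp eta K0 : R).
Hypothesis phiC : bounded_distortion phi Cf.
Hypothesis psiC : bounded_distortion psi Cp.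
Hypothesis phi_lt0 : forall w, phi w < 0.
Hypothesis eta_gt0 : 0 < eta.
(** Contraction is known for lengths of intervals, which are comparable to the exponentials of the
    Birkhoff sums only up to a factor; hence [K0]. *)
Hypothesis phi_decay : forall n w, birkhoff phi n w <= K0 - eta * n%:R.

Lemma birkhoff_le0 n w : birkhoff phi n w <= 0.
Proof. by apply: sumr_le0 => k _; exact: ltW. Qed.

Lemma birkhoff_lt0 n w : (0 < n)%N -> birkhoff phi n w < 0.
Proof.
case: n => // n _; rewrite birkhoffS; have := birkhoff_le0 n (Defs.shift w).
by have := phi_lt0 w; lra.
Qed.

Let pot t b := fun w => t * phi w + b * psi w.
Let potC t b : bounded_distortion (pot t b) (`|t| * Cf + `|b| * Cp).
Proof. exact: bounded_distortion_lin. Qed.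

Lemma pressure_shift_le (t theta b : R) : 0 <= theta ->
  pressure (pot (t + theta) b) <= pressure (pot t b) - theta * eta.
Proof.
move=> th0; apply: (pressure_le i0 (K := theta * K0) (potC _ _) (potC _ _)) => n w.
rewrite !birkhoff_lin.
have := ler_wpM2l th0 (phi_decay n w); lra.
Qed.

Lemma pressure_shift_ge (B t theta b : R) : (forall w, `|phi w| <= B) -> 0 <= theta ->
  pressure (pot t b) <= pressure (pot (t + theta) b) + theta * B.
Proof.
move=> hB th0; apply: (pressure_le i0 (K := 0) (potC _ _) (potC _ _)) => n w.
rewrite !birkhoff_lin.
have := birkhoff_le n w hB; rewrite ler_norml => /andP[+ _].
move=> /(ler_wpM2l th0); lra.
Qed.

(** The pressure is Lipschitz in the coefficient of [phi] and decreases at rate at least [eta], so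
    it has a zero for [get] to choose. *)
Lemma temperatureP b : pressure (pot (temperature phi psi b) b) = 0.
Proof.
apply: (@getPex _ [set t | pressure (pot t b) = 0]).
have [B B0 hB] := bounded_distortion_bounded i0 phiC.
have [pr prE] : exists pr : R -> R, forall t, pr t = pressure (pot t b) by eexists.
have lip t s : `|pr t - pr s| <= B * `|t - s|.
  wlog ts : t s / t <= s.
    move=> H; case: (leP t s) => [|/ltW] ts; first exact: H.
    by rewrite distrC (distrC t); exact: H.
  have d0 : 0 <= s - t by rewrite subr_ge0.
  have := pressure_shift_le t b d0; have := pressure_shift_ge t b hB d0.
  rewrite [t + (s - t)](_ : _ = s); last by ring.
  rewrite -!prE => h1 h2.
  have e0 : 0 <= (s - t) * eta by rewrite mulr_ge0// ltW.
  move: (pr t) (pr s) h1 h2 => x y h1 h2.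
  rewrite ger0_norm; last by lra.
  by rewrite distrC ger0_norm//; lra.
have cont : continuous pr.
  move=> t; apply/cvgrPdist_le => e e0.
  have B1 : 0 < B + 1 by rewrite ltr_wpDl.
  apply/nbhs_ballP; exists (e / (B + 1)); first by rewrite /= divr_gt0.
  move=> s /= ts; apply: le_trans (lip t s) _.
  apply: le_trans (_ : (B + 1) * `|t - s| <= _); first by rewrite ler_wpM2r// lerDl.
  by rewrite -ler_pdivlMl// mulrC; exact: ltW.
(* At rate [eta] the value [pr 0] is used up within this distance. *)
pose T := `|pr 0| / eta.
have T0 : 0 <= T by rewrite divr_ge0// ltW.
have prT : pr T <= 0.
  have := pressure_shift_le 0 b T0; rewrite add0r -!prE.
  rewrite /T divfK ?gt_eqF//; have := ler_norm (pr 0).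
  by move: (pr 0) (pr T) => x y; lra.
have prNT : 0 <= pr (- T).
  have := pressure_shift_le (- T) b T0; rewrite addNr -!prE.
  rewrite /T divfK ?gt_eqF//; have := ler_norm (- pr 0).
  by rewrite normrN; move: (pr 0) (pr (- T)) => x y; lra.
have [|||t _ tE] := @IVT R pr (- T) T 0; last by exists t; rewrite /= -prE.
- by apply: (le_trans _ T0); rewrite oppr_le0.
- exact: continuous_subspaceT.
- by rewrite ge_min prT orbT le_max prNT.
Qed.

Lemma birkhoff_temperature_le b n w :
  temperature phi psi b * birkhoff phi n w + b * birkhoff psi n w <=
  4 * (`|temperature phi psi b| * Cf + `|b| * Cp).
Proof.
rewrite -birkhoff_lin; apply: le_trans (birkhoff_le_pressure i0 (potC _ _) n w) _.
by rewrite -/(pot _ _) temperatureP mulr0 add0r.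
Qed.

(** If the sum [s] were negative, [s] times the Birkhoff sum of [phi] would tend to infinity. Along
    a suitable point the term with [b] takes away at most half of it, against
    [birkhoff_temperature_le]. The sign of [b] decides whether [alpha_minus] or [alpha_plus]
    supplies the point. *)
Lemma temperature_ge0 (alpha b : R) :
  (alpha_minus phi psi <= alpha%:E)%E -> (alpha%:E <= alpha_plus phi psi)%E ->
  0 <= alpha * b + temperature phi psi b.
Proof.
move=> ham hap; rewrite leNgt; apply/negP.
set t := temperature phi psi b; set s := alpha * b + t => s0.
have hle n w : s * birkhoff phi n w + b * (birkhoff psi n w - alpha * birkhoff phi n w)
   <= 4 * (`|t| * Cf + `|b| * Cp).
  by have := birkhoff_temperature_le b n w; rewrite -/t /s; lra.
have key (e : R) : 0 < e -> `|b| * e <= - s / 2 ->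
  exists w, forall N, exists2 n, (N <= n)%N &
   b * (birkhoff psi n w - alpha * birkhoff phi n w) >= `|b| * e * birkhoff phi n w.
  move=> e0 be; have [b0|b0] := leP 0 b.
    have : (alpha_minus phi psi < (alpha + e)%:E)%E.
      by apply: le_lt_trans ham _; rewrite lte_fin ltrDl.
    move=> /ereal_inf_lt[_ [w _ <-]] /limn_einf_lt h; exists w => N.
    have [n Nn] := h (maxn N 1); rewrite lte_fin => hn.
    exists n; first by rewrite (leq_trans _ Nn)// leq_maxl.
    have n0 : (0 < n)%N by rewrite (leq_trans _ Nn)// leq_maxr.
    rewrite ger0_norm// -mulrA ler_wpM2l//.
    by move: hn; rewrite ltr_ndivrMr ?birkhoff_lt0//; lra.
  have : ((alpha - e)%:E < alpha_plus phi psi)%E.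
    by apply: lt_le_trans hap; rewrite lte_fin gtrBl.
  move=> /ereal_sup_gt[_ [w _ <-]] /limn_esup_gt h; exists w => N.
  have [n Nn] := h (maxn N 1); rewrite lte_fin => hn.
  exists n; first by rewrite (leq_trans _ Nn)// leq_maxl.
  have n0 : (0 < n)%N by rewrite (leq_trans _ Nn)// leq_maxr.
  rewrite ltr0_norm// -mulrA mulNr -mulrN ler_wnM2l ?ltW//.
  by move: hn; rewrite ltr_ndivlMr ?birkhoff_lt0//; lra.
have b1 : 0 < `|b| + 1 by rewrite ltr_wpDl.
(* The [+ 1] in the denominator covers [b = 0]. *)
have [|| w hw] := key (- s / 2 / (`|b| + 1)).
- by rewrite divr_gt0//; lra.
- by rewrite mulrCA ger_pMr ?ler_pdivrMr ?mul1r ?lerDl//; lra.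
set B := 4 * (`|t| * Cf + `|b| * Cp) in hle.
have [N hN] : exists N : nat, B < (s / 2) * (K0 - eta * N%:R).
  near \oo => N; exists N.
  have s2 : 0 < - s / 2 * eta by rewrite mulr_gt0//; lra.
  have : (B - s / 2 * K0) / (- s / 2 * eta) < N%:R by near: N; exact: nbhs_infty_gtr.
  rewrite ltr_pdivrMr//; lra.
have [n Nn] := hw N; set e := _ / (_ + _).
have be : `|b| * e <= - s / 2.
  by rewrite /e mulrCA ger_pMr ?ler_pdivrMr ?mul1r ?lerDl//; lra.
have hn := hle n w; have f0 := birkhoff_le0 n w.
have fd := phi_decay n w.
have nN : N%:R <= n%:R :> R by rewrite ler_nat.
have h1 := ler_wnM2r f0 be.
have : (s / 2) * (K0 - eta * N%:R) <= (s / 2) * birkhoff phi n w.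
  rewrite ler_wnM2l//; first by lra.
  by apply: le_trans fd _; rewrite lerB// ler_wpM2l// ltW.
lra.
Unshelve. all: by end_near. Qed.

(** Along multiples of the period the Birkhoff ratio of this point is constant, so bounds on limits
    of ratios become bounds for the single word [p]. *)
Let periodic p : nat -> I := fun k => nth i0 p (k %% size p).

Let birkhoff_periodic u m p :
  birkhoff u (m * size p) (periodic p) = m%:R * birkhoff (R := R) u (size p) (periodic p).
Proof.
elim: m => [|m IH]; first by rewrite mul0n birkhoff0 mul0r.
rewrite mulSn birkhoffD.
have -> : iter (size p) (@Defs.shift I) (periodic p) = periodic p.
  by apply/funext => k; rewrite iter_shiftE /periodic modnDl.
by rewrite IH -natr1 mulrDl mul1r addrC.
Qed.

Let periodic_agree p : agree (size p) (periodic p) (word_point i0 p).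
Proof. by move=> k kp; rewrite /periodic modn_small. Qed.

Let periodic_ratio p m : (0 < m)%N ->
  birkhoff_ratio phi psi (periodic p) (m * size p) =
  (birkhoff psi (size p) (periodic p) / birkhoff phi (size p) (periodic p))%:E.
Proof.
move=> m0; rewrite /birkhoff_ratio !birkhoff_periodic -mulf_div divff ?mul1r//.
by rewrite pnatr_eq0 -lt0n.
Qed.

Let ratio_error A p : 
  `|(birkhoff psi (size p) (periodic p) - A * birkhoff phi (size p) (periodic p))
  - (word_sum i0 psi p - A * word_sum i0 phi p)| <= Cp + `|A| * Cf.
Proof.
have h := bounded_distortion_lin 1 (- A) psiC phiC.
have := h _ _ _ (periodic_agree (p := p)).
rewrite !birkhoff_lin normr1 !mul1r !mulNr normrN.
by rewrite -/(word_sum _ _ _).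
Qed.

Lemma word_sum_ratio_ge (A : R) p : (A%:E <= alpha_minus phi psi)%E ->
  word_sum i0 psi p <= A * word_sum i0 phi p + (Cp + `|A| * Cf).
Proof.
move=> hA; have [p0|p0] := posnP (size p).
  rewrite (size0nil p0) !word_sum_nil mulr0 add0r addr_ge0 ?mulr_ge0//.
    exact: bounded_distortion_ge0 psiC.
  exact: bounded_distortion_ge0 phiC.
have := ratio_error A p; rewrite ler_norml => /andP[h _].
suff : birkhoff psi (size p) (periodic p) <= A * birkhoff phi (size p) (periodic p).
  lra.
rewrite -ler_ndivlMr ?birkhoff_lt0// -lee_fin.
apply: le_trans hA _; apply: le_trans (_ : limn_einf (birkhoff_ratio phi psi (periodic p)) <= _)%E.
  by apply: ereal_inf_lbound; exists (periodic p).
apply: limn_einf_le => N; exists (N.+1 * size p)%N; last by rewrite periodic_ratio.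
by rewrite (leq_trans _ (leq_pmulr _ p0)).
Qed.

Lemma word_sum_ratio_le (A : R) p : (alpha_plus phi psi <= A%:E)%E ->
  A * word_sum i0 phi p <= word_sum i0 psi p + (Cp + `|A| * Cf).
Proof.
move=> hA; have [p0|p0] := posnP (size p).
  rewrite (size0nil p0) !word_sum_nil mulr0 add0r addr_ge0 ?mulr_ge0//.
    exact: bounded_distortion_ge0 psiC.
  exact: bounded_distortion_ge0 phiC.
have := ratio_error A p; rewrite ler_norml => /andP[_ h].
suff : A * birkhoff phi (size p) (periodic p) <= birkhoff psi (size p) (periodic p).
  lra.
rewrite -ler_ndivrMr ?birkhoff_lt0// -lee_fin.
apply: le_trans hA; apply: le_trans (_ : _ <= limn_esup (birkhoff_ratio phi psi (periodic p)))%E _.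
  apply: limn_esup_ge => N; exists (N.+1 * size p)%N; last by rewrite periodic_ratio.
  by rewrite (leq_trans _ (leq_pmulr _ p0)).
by apply: ereal_sup_ubound; exists (periodic p).
Qed.

(** Zero pressure makes the partition sum for t(b) at least 1, and as Birkhoff sums of [phi] are
    nonpositive, the smaller coefficient [D - alpha * b] in place of t(b) only enlarges its terms.
    Passing from suprema to representatives costs an exponent linear in |b| and independent of
    [n]. *)
Lemma tilted_sum_ge (alpha D b : R) n :
  (forall b, D <= alpha * b + temperature phi psi b) ->
  expR (- ((`|D| * Cf + Cp + `|alpha| * Cf) * (1 + `|b|))) <=
  \sum_(p : n.-tuple I) expR (D * word_sum i0 phi p +
     b * (word_sum i0 psi p - alpha * word_sum i0 phi p)).
Proof.
move=> hD; set t := temperature phi psi b.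
have /andP[h1 _] := zeta_pressure i0 (potC t b) n.
rewrite -/(pot _ _) temperatureP mulr0 in h1.
have z1 : 1 <= zeta (pot t b) n.
  by rewrite -ler_ln ?posrE ?ltr01 ?ln1 ?(zeta_gt0 i0 (potC t b)).
have Cf0 := bounded_distortion_ge0 i0 phiC.
have Cp0 := bounded_distortion_ge0 i0 psiC.
set C := `|D| * Cf + Cp + `|alpha| * Cf.
rewrite expRN -[leLHS]mul1r ler_pdivrMr ?expR_gt0//; apply: le_trans z1 _.
rewrite /zeta mulr_suml; apply: ler_sum => p _.
apply: (cyl_sup_le i0) => w wp; rewrite -expRD ler_expR.
have e1 := word_sum_mkseq i0 (size p) w phiC.
have e2 := word_sum_mkseq i0 (size p) w psiC.
rewrite wp in e1 e2.
rewrite /pot birkhoff_lin.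
have f0 := birkhoff_le0 (size p) w.
have h2 : t * birkhoff phi (size p) w <= (D - alpha * b) * birkhoff phi (size p) w.
  by rewrite ler_wnM2r//; have := hD b; rewrite -/t; lra.
set x := birkhoff phi _ w in e1 f0 h2 *; set y := birkhoff psi _ w in e2 *.
set x' := word_sum _ phi _ in e1 *; set y' := word_sum _ psi _ in e2 *.
have b1 : (D - alpha * b) * (x - x') <= (`|D| + `|alpha| * `|b|) * Cf.
  apply: le_trans (ler_norm _) _; rewrite normrM; apply: ler_pM => //.
  by apply: le_trans (ler_normB _ _) _; rewrite normrM.
have b2 : b * (y - y') <= `|b| * Cp.
  by apply: le_trans (ler_norm _) _; rewrite normrM; apply: ler_wpM2l.
have q1 : 0 <= `|D| * Cf * `|b| by rewrite !mulr_ge0.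
have q2 : 0 <= `|alpha| * Cf by rewrite !mulr_ge0.
rewrite /C; nra.
Qed.

End Temperature.

(** * Blocks with prescribed Birkhoff sums *)

Section Duality.
Variables (R : realType) (W : finType).
Implicit Types (a b c q : W -> R).

(** With [K = C + 1], the sum to be annihilated is [expR (- (beta * K))] times the derivative of
    [\sum_p expR (c p + beta * (b p + K))]. It is nonpositive at 0, and the lower bound on the sums
    forces it to become nonnegative. *)
Let half_balance c b (C : R) : 0 <= C ->
  (forall beta, 0 <= beta ->
     expR (- (C * (1 + beta))) <= \sum_p expR (c p + beta * b p)) ->
  \sum_p (b p + (C + 1)) * expR (c p) <= 0 ->
  exists2 beta, 0 <= beta &
    \sum_p (b p + (C + 1)) * expR (c p + beta * b p) = 0.
Proof.
move=> C0 h hle; set K := C + 1.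
(* Were every [b p] at most [- K], the sums would decay at rate [K], faster than the rate [C] that
   is allowed. *)
have [p bp] : exists p, 0 < b p + K.
  apply: contrapT => /forallNP np.
  pose S := \sum_p expR (c p).
  have S0 : 0 <= S by apply: sumr_ge0 => p _; exact: expR_ge0.
  (* At this argument the upper and lower bounds combine to [expR be <= be]. *)
  pose be := expR C * S.
  have be0 : 0 <= be by rewrite mulr_ge0 ?expR_ge0.
  have : expR (- (C * (1 + be))) <= expR (- (be * K)) * S.
    apply: le_trans (h _ be0) _; rewrite /S mulr_sumr; apply: ler_sum => p _.
    rewrite -expRD ler_expR addrC lerD2r -mulrN ler_wpM2l//.
    have /negP := np p; rewrite -leNgt; lra.
  rewrite -ler_pdivrMl ?expR_gt0// -expRN -expRD opprK.
  rewrite [_ + _](_ : _ = be - C); last by rewrite /K; ring.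
  rewrite expRD expRN ler_pdivrMr ?expR_gt0// mulrC -/be.
  have := expR_ge1Dx be; lra.
pose G beta := \sum_p (b p + K) * expR (c p + beta * b p).
pose S := \sum_p `|b p + K| * expR (c p).
have S0 : 0 <= S by apply: sumr_ge0 => x _; rewrite mulr_ge0 ?expR_ge0.
have Glow beta : 0 <= beta ->
    (b p + K) * expR (c p + beta * (b p + K)) - S <= G beta * expR (beta * K).
  move=> be0; rewrite /G mulr_suml /S.
  rewrite (bigD1 p)//= [in leRHS](bigD1 p)//= -mulrA -expRD.
  rewrite -(addrA (c p)) -(mulrDr beta).
  rewrite opprD addrA; apply: lerD.
    by rewrite gerBl mulr_ge0 ?expR_ge0.
  rewrite -sumrN; apply: ler_sum => x _; rewrite -mulrA -expRD -addrA -(mulrDr beta).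
  rewrite expRD; have := expR_gt0 (c x); set e := expR (c x) => e0.
  case: (leP 0 (b x + K)) => bx.
    apply: (@le_trans _ _ 0); first by rewrite oppr_le0 mulr_ge0// ltW.
    by rewrite !mulr_ge0// ?ltW// expR_gt0.
  rewrite ltr0_norm// mulNr opprK ler_wnM2l//; first exact: ltW.
  rewrite ger_pMr// -expR0 ler_expR; apply: mulr_ge0_le0 => //; exact: ltW.
(* By [expR x >= 1 + x], here the term of [p] has outgrown [S], which bounds the negative terms. *)
pose b1 := S / ((b p + K) * expR (c p) * (b p + K)).
have den : 0 < (b p + K) * expR (c p) * (b p + K) by rewrite !mulr_gt0 ?expR_gt0.
have b10 : 0 <= b1 by rewrite divr_ge0// ltW.
have G1 : 0 <= G b1.
  rewrite -(pmulr_lge0 _ (expR_gt0 (b1 * K))); apply: le_trans (Glow _ b10).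
  rewrite subr_ge0 expRD mulrA.
  apply: le_trans (_ : (b p + K) * expR (c p) * (1 + b1 * (b p + K)) <= _).
    rewrite mulrDr mulr1 -[leLHS]add0r lerD//.
      by rewrite mulr_ge0 ?expR_ge0// ltW.
    by rewrite mulrCA /b1 divfK// gt_eqF.
  by rewrite ler_wpM2l ?expR_ge1Dx// mulr_ge0 ?expR_ge0// ltW.
have G0 : G 0 <= 0.
  rewrite /G; under eq_bigr do rewrite mul0r addr0.
  exact: hle.
have cG : continuous G.
  apply: continuous_big => [|p' _ x]; first exact: add_continuous.
  apply: cvgM; first exact: cvg_cst.
  apply: continuous_comp; last exact: continuous_expR.
  apply: cvgD; first exact: cvg_cst.
  by apply: cvgM; [exact: cvg_id | exact: cvg_cst].
have [||x] := @IVT R G 0 b1 0 b10.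
- exact: continuous_subspaceT.
- by rewrite ge_min G0 le_max G1 orbT.
- by rewrite in_itv /= => /andP[x0 _] Gx; exists x.
Qed.

(* Lagrange duality for minimising
   [ln (\sum_p expR (c p + beta * b p)) + (C + 1) * `|beta|] over [beta]; the
   multiplier [kappa] is a subgradient of the absolute value. *)
Lemma exponential_balance c b (C : R) : 0 <= C ->
  (forall beta, expR (- (C * (1 + `|beta|))) <= \sum_p expR (c p + beta * b p)) ->
  exists beta kappa, [/\ `|kappa| <= C + 1, beta * kappa = - ((C + 1) * `|beta|) &
    \sum_p (b p - kappa) * expR (c p + beta * b p) = 0].
Proof.
move=> C0 h.
(* The signs of the one-sided derivatives at 0 tell whether the minimiser lies to the right, to the
   left, or at 0; only in the last case is [kappa] strictly between the extreme slopes. *)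
have [h1|h1] := leP (\sum_p (b p + (C + 1)) * expR (c p)) 0.
  have [|x x0 xE] := half_balance C0 _ h1.
    by move=> x x0; have := h x; rewrite ger0_norm.
  exists x, (- (C + 1)); split.
  - by rewrite normrN ger0_norm//; lra.
  - by rewrite ger0_norm//; ring.
  - by rewrite -[RHS]xE; apply: eq_bigr => p _; rewrite opprK.
have [h2|h2] := leP 0 (\sum_p (b p - (C + 1)) * expR (c p)).
  have [||x x0 xE] := @half_balance c (fun p => - b p) C C0.
  - move=> x x0; have := h (- x); rewrite normrN ger0_norm//.
    by under eq_bigr do rewrite mulNr -mulrN.
  - rewrite -oppr_ge0 -sumrN; apply: le_trans h2 _; apply: ler_sum => p _.
    by apply: le_of_eq; ring.
  exists (- x), (C + 1); split.
  - by rewrite ger0_norm//; lra.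
  - by rewrite normrN ger0_norm//; ring.
  - apply/eqP; rewrite -oppr_eq0 -sumrN; apply/eqP; rewrite -[RHS]xE.
    by apply: eq_bigr => p _; rewrite -mulNr opprB addrC mulNr mulrN.
pose Z := \sum_p expR (c p).
have Z0 : 0 < Z.
  apply: lt_le_trans (expR_gt0 (- (C * (1 + `|0|)))) _.
  by apply: le_trans (h 0) _; apply: ler_sum => p _; rewrite mul0r addr0.
pose S := \sum_p b p * expR (c p).
have hS k : \sum_p (b p + k) * expR (c p) = S + k * Z.
  by under eq_bigr do rewrite mulrDl; rewrite big_split/= mulr_sumr.
exists 0, (S / Z); split.
- have := h2; have := h1; rewrite !hS => {}h1 {}h2.
  rewrite ler_norml; apply/andP; split.
    by rewrite ler_pdivlMr// mulNr -subr_ge0 opprK ltW.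
  by rewrite ler_pdivrMr//; lra.
- by rewrite normr0 mul0r mulr0 oppr0.
- under eq_bigr do rewrite mul0r addr0.
  by rewrite hS mulNr divfK ?subrr// gt_eqF.
Qed.

End Duality.

(** * Second moments under product distributions *)

Section Chebyshev.
Variables (R : realType) (W : finType) (q : W -> R).
Hypothesis q_ge0 : forall p, 0 <= q p.
Hypothesis q_sum1 : \sum_p q p = 1.
Implicit Types (X Y : W -> R).

Let qs (f : seq W) := \prod_(x <- f) q x.
Let Xs X (f : seq W) := \sum_(x <- f) X x.

Let qs_ge0 f : 0 <= qs f.
Proof. exact: prodr_ge0. Qed.

Let sum_qs M : \sum_(f : M.-tuple W) qs f = 1.
Proof.
elim: M => [|M IH]; first by rewrite (sum_tuple0 qs) /qs big_nil.
rewrite (sum_tuple_cons M qs) -[RHS]q_sum1; apply: eq_bigr => x _.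
under eq_bigr do rewrite /qs big_cons.
by rewrite -mulr_sumr IH mulr1.
Qed.

Let sum_qsX M X : \sum_p q p * X p = 0 ->
  \sum_(f : M.-tuple W) qs f * Xs X f = 0.
Proof.
move=> hX; elim: M => [|M IH].
  by rewrite (sum_tuple0 (fun f => qs f * Xs X f)) /Xs big_nil mulr0.
rewrite (sum_tuple_cons M (fun f => qs f * Xs X f)) -[RHS]hX; apply: eq_bigr => x _.
transitivity (\sum_(f : M.-tuple W) (q x * X x * qs f + q x * (qs f * Xs X f))).
  by apply: eq_bigr => f _; rewrite /qs /Xs !big_cons; ring.
by rewrite big_split/= -!mulr_sumr sum_qs IH mulr1 mulr0 addr0.
Qed.

(** Variances of independent variables add: the mixed terms vanish because [X] is centred. *)
Lemma second_moment M X : \sum_p q p * X p = 0 ->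
  \sum_(f : M.-tuple W) qs f * Xs X f ^+ 2 = M%:R * \sum_p q p * X p ^+ 2.
Proof.
move=> hX; elim: M => [|M IH].
  rewrite (sum_tuple0 (fun f => qs f * Xs X f ^+ 2)) /Xs big_nil.
  by rewrite expr0n mulr0 mul0r.
rewrite (sum_tuple_cons M (fun f => qs f * Xs X f ^+ 2)).
transitivity (\sum_x (q x * X x ^+ 2 + q x * (M%:R * \sum_p q p * X p ^+ 2))).
  apply: eq_bigr => x _.
  transitivity (\sum_(f : M.-tuple W) (q x * X x ^+ 2 * qs f +
     2 * q x * X x * (qs f * Xs X f) + q x * (qs f * Xs X f ^+ 2))).
    by apply: eq_bigr => f _; rewrite /qs /Xs !big_cons; ring.
  rewrite !big_split/= -!mulr_sumr sum_qs IH (sum_qsX _ hX).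
  by rewrite mulr1 mulr0 addr0.
rewrite big_split/= -mulr_suml q_sum1 mul1r -natr1; ring.
Qed.

(** Markov's inequality for the sum of both squares, so that one set of words controls both
    deviations. *)
Lemma chebyshev2 M X Y : (0 < M)%N ->
  \sum_p q p * X p = 0 -> \sum_p q p * Y p = 0 ->
  2 * \sum_p q p * (X p ^+ 2 + Y p ^+ 2) <= M%:R ->
  2^-1 <= \sum_(f : M.-tuple W |
     (\sum_(x <- f) X x) ^+ 2 + (\sum_(x <- f) Y x) ^+ 2 <= M%:R ^+ 2)
     \prod_(x <- f) q x.
Proof.
move=> M0 hX hY hM.
have M0' : 0 < M%:R :> R by rewrite ltr0n.
pose P (f : M.-tuple W) := Xs X f ^+ 2 + Xs Y f ^+ 2 <= M%:R ^+ 2.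
have : \sum_(f : M.-tuple W | P f) qs f + \sum_(f : M.-tuple W | ~~ P f) qs f = 1.
  by rewrite -(sum_qs M) [in RHS](bigID P).
have : M%:R ^+ 2 * (\sum_(f : M.-tuple W | ~~ P f) qs f) <=
   M%:R * \sum_p q p * (X p ^+ 2 + Y p ^+ 2).
  have -> : \sum_p q p * (X p ^+ 2 + Y p ^+ 2) =
     \sum_p q p * X p ^+ 2 + \sum_p q p * Y p ^+ 2.
    by rewrite -big_split; apply: eq_bigr => p _; rewrite mulrDr.
  rewrite mulrDr -!second_moment// -big_split/= [leRHS](bigID P)/= mulr_sumr.
  rewrite ler_wpDl//.
    by apply: sumr_ge0 => f _; rewrite addr_ge0// mulr_ge0 ?sqr_ge0.
  apply: ler_sum => f; rewrite /P -ltNge => /ltW Pf.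
  by rewrite -mulrDr mulrC ler_wpM2l.
rewrite -/(qs _) -/(Xs X _) -/(Xs Y _).
set V := \sum_p _ in hM *; set A := \sum_(f | P f) _; set B := \sum_(f | ~~ _) _.
rewrite expr2 -mulrA ler_pM2l// => h1 h2.
have B0 : 0 <= B by apply: sumr_ge0.
have h3 : M%:R * B <= M%:R / 2 by lra.
rewrite ler_pM2l// in h3.
change (2^-1 <= A); lra.
Qed.

End Chebyshev.

Section TypicalWords.
Variables (R : realType) (W : finType) (a b : W -> R) (D C : R).
Hypotheses (D0 : 0 <= D) (C0 : 0 <= C).
Hypothesis hC : forall beta,
  expR (- (C * (1 + `|beta|))) <= \sum_p expR (D * a p + beta * b p).

(** Entropy by counting: under the product of the tilted distribution [q], half of the mass lies on
    words each of mass at most a common bound, so there are at least half the inverse of that bound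
    of them. Centring [a] at its mean lets the bound be read off from any single word of [T]. *)
Lemma typical_words (M0 : nat) : exists M, (M0 <= M)%N /\ (0 < M)%N /\
  exists T : {set M.-tuple W}, (0 < #|T|)%N /\ forall f, f \in T ->
    `|\sum_(x <- f) b x| <= (C + 2) * M%:R /\
    - (D * \sum_(x <- f) a x) - M%:R * (2 * D + C) - ln 2 <= ln #|T|%:R.
Proof.
have [beta [kappa [hk bk hX]]] := exponential_balance C0 hC.
pose e p := expR (D * a p + beta * (b p - kappa)).
pose Z := \sum_p e p.
have eE p : e p = expR (- (beta * kappa)) * expR (D * a p + beta * b p).
  by rewrite -expRD; congr expR; ring.
(* The 1 in [C + 1] leaves a factor [expR] of |beta|. In [bound] it pays for [beta] times the
   deviation of [X], however large [beta] may be. *)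
have hZ : expR (`|beta| - C) <= Z.
  rewrite /Z; under eq_bigr do rewrite eE.
  rewrite -mulr_sumr bk opprK.
  apply: le_trans (ler_wpM2l (expR_ge0 _) (hC beta)).
  by rewrite -expRD ler_expR; apply: le_of_eq; ring.
have Z0 : 0 < Z := lt_le_trans (expR_gt0 _) hZ.
pose q p := e p / Z.
have q0 p : 0 <= q p by rewrite divr_ge0 ?expR_ge0// ltW.
have q1 : \sum_p q p = 1 by rewrite -mulr_suml divff// gt_eqF.
pose X p := b p - kappa.
have qX : \sum_p q p * X p = 0.
  transitivity (\sum_p (expR (- (beta * kappa)) / Z) *
     ((b p - kappa) * expR (D * a p + beta * b p))).
    by apply: eq_bigr => p _; rewrite /q eE /X; ring.
  by rewrite -mulr_sumr hX mulr0.
pose abar := \sum_p q p * a p.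
pose Y p := a p - abar.
have qY : \sum_p q p * Y p = 0.
  rewrite /Y; under eq_bigr do rewrite mulrBr.
  by rewrite sumrB -mulr_suml q1 mul1r subrr.
set V := 2 * \sum_p q p * (X p ^+ 2 + Y p ^+ 2).
have [M [hM1 hM2 hM3]] : exists M, [/\ (M0 <= M)%N, (0 < M)%N & V <= M%:R].
  near \oo => M; exists M; split; near: M.
  - by exists M0.
  - by exists 1%N.
  - exact: nbhs_infty_ger.
exists M; split => //; split => //.
pose P (f : M.-tuple W) :=
  (\sum_(x <- f) X x) ^+ 2 + (\sum_(x <- f) Y x) ^+ 2 <= M%:R ^+ 2.
have hP : 2^-1 <= \sum_(f | P f) \prod_(x <- f) q x := chebyshev2 q0 q1 hM2 qX qY hM3.
pose T := [set f | P f]%SET.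
exists T.
have TM f : f \in T -> `|\sum_(x <- f) X x| <= M%:R /\ `|\sum_(x <- f) Y x| <= M%:R.
  rewrite inE /P; set x := \sum_(x <- f) X x; set y := \sum_(x <- f) Y x => h.
  have x0 : 0 <= x ^+ 2 by exact: sqr_ge0.
  have y0 : 0 <= y ^+ 2 by exact: sqr_ge0.
  by split; rewrite -ler_sqr ?nnegrE// real_normK ?num_real//; lra.
have sumX (f : M.-tuple W) : \sum_(x <- f) X x = \sum_(x <- f) b x - M%:R * kappa.
  rewrite sumrB; congr (_ - _).
  by rewrite big_const_seq count_predT size_tuple -Monoid.iteropE /= mulr_natl.
have sumY (f : M.-tuple W) : \sum_(x <- f) Y x = \sum_(x <- f) a x - M%:R * abar.
  rewrite sumrB; congr (_ - _).
  by rewrite big_const_seq count_predT size_tuple -Monoid.iteropE /= mulr_natl.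
have qsE (f : M.-tuple W) : \prod_(x <- f) q x =
    expR (D * \sum_(x <- f) a x + beta * \sum_(x <- f) X x - M%:R * ln Z).
  have qE x : q x = expR (D * a x + beta * X x - ln Z).
    by rewrite expRB lnK.
  under eq_bigr do rewrite qE.
  rewrite -expR_sum; congr expR.
  rewrite sumrB big_split/= -!mulr_sumr; congr (_ - _).
  by rewrite big_const_seq count_predT size_tuple -Monoid.iteropE /= mulr_natl.
have lnZ : `|beta| - C <= ln Z by rewrite -[leLHS]expRK ler_ln ?posrE ?expR_gt0.
have M0' : 0 <= M%:R :> R by [].
have bound f : f \in T -> \prod_(x <- f) q x <=
    expR (D * (M%:R * abar) + M%:R * (D + C)).
  move=> /TM[h1 h2]; rewrite qsE ler_expR.
  have h3 : beta * \sum_(x <- f) X x <= `|beta| * M%:R.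
    by apply: le_trans (ler_norm _) _; rewrite normrM ler_wpM2l.
  have h4 : D * \sum_(x <- f) a x <= D * (M%:R * abar) + D * M%:R.
    rewrite -mulrDr ler_wpM2l//; rewrite sumY ler_norml in h2.
    by case/andP: h2; lra.
  have := ler_wpM2l M0' lnZ; lra.
have cardT : 2^-1 <= #|T|%:R * expR (D * (M%:R * abar) + M%:R * (D + C)).
  apply: le_trans hP _; rewrite mulr_natl -sumr_const.
  rewrite (eq_bigl (fun f => f \in T)); last by move=> f; rewrite inE.
  exact: ler_sum.
have T0 : (0 < #|T|)%N.
  rewrite lt0n; apply/eqP => T0; move: cardT.
  by rewrite T0 mul0r leNgt invr_gt0 ltr0n.
split=> // f fT; have [h1 h2] := TM _ fT; split.
  rewrite sumX in h1.
  have := ler_normD (\sum_(x <- f) b x - M%:R * kappa) (M%:R * kappa).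
  rewrite subrK normrM (ger0_norm M0').
  by have := ler_wpM2l M0' hk; lra.
have : ln (2^-1) <= ln (#|T|%:R * expR (D * (M%:R * abar) + M%:R * (D + C))).
  by rewrite ler_ln ?posrE ?invr_gt0// mulr_gt0 ?expR_gt0 ?ltr0n.
rewrite lnV ?posrE// lnM ?posrE ?ltr0n ?expR_gt0// expRK.
have : D * (M%:R * abar) <= D * (\sum_(x <- f) a x + M%:R).
  rewrite ler_wpM2l//; rewrite sumY ler_norml in h2.
  by case/andP: h2; lra.
lra.
Unshelve. all: by end_near. Qed.

End TypicalWords.

Section Blocks.
Variables (R : realType) (I : finType) (i0 : I).
Implicit Types (p s : seq I).

Lemma word_sum_flatten (u : (nat -> I) -> R) C s M (f : M.-tuple (seq I)) :
  bounded_distortion u C ->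
  `|word_sum i0 u (s ++ flatten f) - \sum_(p <- f) word_sum i0 u p|
    <= 2 * C * (M%:R + 1) + `|word_sum i0 u s|.
Proof.
move=> uC.
have C0 := bounded_distortion_ge0 i0 uC.
have h (ps : seq (seq I)) : `|word_sum i0 u (flatten ps) - \sum_(p <- ps) word_sum i0 u p|
   <= 2 * C * (size ps)%:R.
  elim: ps => [|p ps IH]; first by rewrite /= word_sum_nil big_nil subr0 normr0 mulr0.
  rewrite big_cons /= -natr1.
  have := word_sum_cat i0 p (flatten ps) uC.
  move: IH; rewrite !ler_norml => /andP[h1 h2] /andP[h3 h4].
  by apply/andP; split; lra.
have := h f; rewrite size_tuple.
have := word_sum_cat i0 s (flatten f) uC.
have := ler_norm (word_sum i0 u s); have := ler_norm (- word_sum i0 u s).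
rewrite normrN !ler_norml => h1 h2 /andP[h3 h4] /andP[h5 h6].
by apply/andP; split; lra.
Qed.

Variables (phi psi : (nat -> I) -> R) (Cf Cp D alpha C : R).
Hypothesis phiC : bounded_distortion phi Cf.
Hypothesis psiC : bounded_distortion psi Cp.
Hypotheses (D0 : 0 <= D) (C0 : 0 <= C).
Hypothesis hC : forall beta n, expR (- (C * (1 + `|beta|))) <=
  \sum_(p : n.-tuple I) expR (D * word_sum i0 phi p +
     beta * (word_sum i0 psi p - alpha * word_sum i0 phi p)).

(** Words of length [n] serve as letters for [typical_words]. All errors are constants per factor
    that do not depend on [n], so a large [n] makes them at most [e * n]. *)
Lemma homogeneous_blocks s (e : R) : 0 < e -> exists L (T : seq (seq I)),
  [/\ 1 <= e * L%:R, uniq T, T != [::] & forall p, p \in T ->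
   [/\ size p = L, exists r, p = s ++ r,
    `|word_sum i0 psi p - alpha * word_sum i0 phi p| <= e * L%:R &
    - (D * word_sum i0 phi p) - e * L%:R <= ln (size T)%:R]].
Proof.
move=> e0.
have Cf0 := bounded_distortion_ge0 i0 phiC.
have Cp0 := bounded_distortion_ge0 i0 psiC.
pose dev := fun w => 1 * psi w + (- alpha) * phi w.
have devC : bounded_distortion dev (`|1| * Cp + `|- alpha| * Cf).
  exact: bounded_distortion_lin.
set C1 := _ + _ in devC.
have devE p : word_sum i0 dev p = word_sum i0 psi p - alpha * word_sum i0 phi p.
  by rewrite word_sum_lin mul1r mulNr.
(* [K1] and [K2] bound the errors per factor. The prefix [s] occurs once, but charging it to every
   factor costs nothing in the limit. *)
pose K1 := C + 2 + 4 * C1 + `|word_sum i0 dev s|.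
pose K2 := D * (4 * Cf + `|word_sum i0 phi s|) + 2 * D + C + 2.
have [n [n0 hn1 hn2]] : exists n : nat, [/\ (0 < n)%N, K1 <= e * n%:R & K2 <= e * n%:R].
  near \oo => n; exists n; split.
  - by near: n; exists 1%N.
  - by rewrite mulrC -ler_pdivrMr//; near: n; exact: nbhs_infty_ger.
  - by rewrite mulrC -ler_pdivrMr//; near: n; exact: nbhs_infty_ger.
have [M [_ [M0 [T [T0 hT]]]]] := @typical_words R _
  (fun p : n.-tuple I => word_sum i0 phi p)
  (fun p : n.-tuple I => word_sum i0 psi p - alpha * word_sum i0 phi p)
  D C D0 C0 (fun beta => hC beta n) 0.
pose blk (f : M.-tuple (n.-tuple I)) := s ++ flatten (map (@tval n I) f).
have shp (f : M.-tuple (n.-tuple I)) : shape (map (@tval n I) f) = nseq M n.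
  apply: (@eq_from_nth _ 0%N); rewrite /shape !size_map size_tuple ?size_nseq//.
  move=> k kM; rewrite nth_nseq kM -map_comp.
  rewrite (nth_map (tnth f (Ordinal kM))) ?size_tuple//=.
  by rewrite size_tuple.
have blk_inj : injective blk.
  move=> f g /eqP; rewrite eqseq_cat// eqxx /= => /eqP fg.
  apply/val_inj/(inj_map val_inj) => /=.
  rewrite -[LHS]flattenK -[RHS]flattenK.
  by rewrite !shp fg.
exists (size s + M * n)%N, [seq blk f | f <- enum T]; split.
- apply: le_trans (_ : K1 <= _).
    have C1' : 0 <= C1 by rewrite addr_ge0 ?mulr_ge0.
    have h1 : 1 <= C + 2 by move: C0; lra.
    rewrite /K1 -(addrA (C + 2)); apply: (le_trans h1).
    by rewrite lerDl addr_ge0// mulr_ge0.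
  apply: le_trans hn1 _; rewrite ler_pM2l// ler_nat.
  by rewrite (leq_trans (leq_pmull n M0))// leq_addl.
- by rewrite map_inj_uniq// enum_uniq.
- by rewrite -size_eq0 size_map -cardE -lt0n.
move=> p0 /mapP[f]; rewrite mem_enum => fT ->; have [h1 h2] := hT _ fT.
have M1 : 1 <= M%:R :> R by rewrite ler1n.
have LM (k : R) : k <= e * n%:R -> k * M%:R <= e * (size s + M * n)%:R.
  move=> kn; rewrite natrD natrM mulrDr.
  have -> : e * (M%:R * n%:R) = (e * n%:R) * M%:R by ring.
  by rewrite ler_wpDl// ?ler_wpM2r// mulr_ge0// ltW.
have fs : \sum_(p <- (map (@tval n I) f)) word_sum i0 dev p =
    \sum_(x <- f) (word_sum i0 psi x - alpha * word_sum i0 phi x).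
  by rewrite big_map; apply: eq_bigr => p _; rewrite devE.
have fs' : \sum_(p <- (map (@tval n I) f)) word_sum i0 phi p =
    \sum_(x <- f) word_sum i0 phi x by rewrite big_map.
have d1 := word_sum_flatten s [tuple of map (@tval n I) f] devC.
have d2 := word_sum_flatten s [tuple of map (@tval n I) f] phiC.
rewrite /= fs in d1; rewrite /= fs' in d2.
have C10 : 0 <= C1 by rewrite addr_ge0 ?mulr_ge0.
have n1 := normr_ge0 (word_sum i0 dev s).
have n2 := normr_ge0 (word_sum i0 phi s).
split.
- rewrite size_cat size_flatten shp; congr (_ + _)%N.
  by rewrite sumn_nseq mulnC.
- by eexists.
- rewrite -devE.
  apply: le_trans (LM _ hn1).
  set x := word_sum i0 dev _ in d1 *; set y := \sum_(_ <- _) _ in h1 d1.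
  have := ler_normD (x - y) y; rewrite subrK => h3.
  apply: le_trans h3 _; rewrite /K1.
  set z := `|word_sum i0 dev s| in d1 n1 *.
  have : C1 <= C1 * M%:R by rewrite ler_peMr.
  have : z <= z * M%:R by rewrite ler_peMr.
  lra.
- have := LM _ hn2; rewrite size_map -cardE /K2.
  have ln2 : ln 2 <= 2 :> R by apply/ltW/ln_sublinear.
  set x := word_sum i0 phi _ in d2 *; set y := \sum_(_ <- _) _ in h2 d2.
  set z := `|word_sum i0 phi s| in d2 n2 *.
  have : D * `|x - y| <= D * (4 * Cf * M%:R + z * M%:R).
    rewrite ler_wpM2l//; apply: le_trans d2 _.
    have : Cf <= Cf * M%:R by rewrite ler_peMr.
    have : z <= z * M%:R by rewrite ler_peMr.
    lra.
  have := ler_wpM2l D0 (ler_norm (- (x - y))); rewrite normrN.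
  lra.
Unshelve. all: by end_near. Qed.

End Blocks.

(** * A converse of Kraft's inequality on trees of blocks *)

Section Kraft.
Variables (R : realType) (S : eqType) (T : nat -> seq S).
Hypothesis T_uniq : forall j, uniq (T j).
Hypothesis T_neq0 : forall j, T j != [::].

(** Equidistribution: the reciprocal of the number of nodes at level [j]. *)
Definition node_mass j : R := \prod_(i < j) (size (T i))%:R^-1.

Let size_gt0 j : 0 < (size (T j))%:R :> R.
Proof. by rewrite ltr0n lt0n size_eq0. Qed.

Lemma node_mass_gt0 j : 0 < node_mass j.
Proof. by apply: prodr_gt0 => i _; rewrite invr_gt0. Qed.

Let node_massS j : node_mass j.+1 *+ size (T j) = node_mass j.
Proof.
by rewrite -mulr_natr /node_mass big_ord_recr /= divfK// gt_eqF.
Qed.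

(* The converse of Kraft's inequality: follow, from the root, children whose
   subtree carries less mass of the given nodes than the child itself. *)
Lemma kraft (q : nat -> bool -> seq S) :
  (forall c, (forall k, c k \in T k) ->
     exists n b, mkseq c (size (q n b)) = q n b) ->
  (1 <= \sum_(0 <= n <oo) (\sum_(b : bool) node_mass (size (q n b)))%:E)%E.
Proof.
move=> hq; rewrite leNgt; apply/negP => hlt.
(* The total [m v] is the mass of the listed nodes below [v]; a good [v] has more mass of its
   own. *)
pose g v n b := if seq.prefix v (q n b) then node_mass (size (q n b)) else 0.
have g0 v n b : 0 <= g v n b.
  by rewrite /g; case: ifP => // _; exact/ltW/node_mass_gt0.
pose m v := (\sum_(0 <= n <oo) (\sum_(b : bool) g v n b)%:E)%E.
pose good v := (m v < (node_mass (size v))%:E)%E.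
have good0 : good [::].
  rewrite /good /node_mass /= big_ord0 /m.
  by under eq_eseriesr do under eq_bigr do rewrite /g prefix0s.
have step v : good v -> exists t, t \in T (size v) /\ good (rcons v t).
  move=> gv; apply: contrapT => /forallNP nt; move: gv; apply/negP; rewrite -leNgt.
  rewrite -node_massS.
  apply: le_trans (_ : (\sum_(t <- T (size v)) m (rcons v t) <= _)%E).
    have -> : (node_mass (size v).+1 *+ size (T (size v)))%:E =
      (\sum_(t <- T (size v)) (node_mass (size v).+1)%:E)%E.
      by rewrite sumEFin big_const_seq count_predT iter_addr_0.
    rewrite big_seq [leRHS]big_seq; apply: lee_sum => t tT.
    rewrite leNgt; apply/negP => gt; apply: (nt t); split => //.
    by rewrite /good size_rcons.
  rewrite /m -nneseries_sum; last first.
    by move=> t n _; rewrite lee_fin sumr_ge0.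
  apply: lee_nneseries => [n _ _|n _].
    by apply: sume_ge0 => t _; rewrite lee_fin sumr_ge0.
  rewrite sumEFin lee_fin exchange_big /=; apply: ler_sum => b _.
  rewrite /g; set Q := q n b; set mu := node_mass _.
  have mu0 : 0 <= mu by exact/ltW/node_mass_gt0.
  (* A listed node [Q] equal to [v] lies below no child of [v], one strictly below [v] lies below at
     most one listed child, and any other lies below none. *)
  have [/seq.prefixP[[|t0 r] QE]|nv] := boolP (seq.prefix v Q).
  - rewrite big1// => t _; rewrite QE cats0.
    case: ifP => // /seq.prefixP[r /(congr1 size)]; rewrite size_cat size_rcons; lia.
  - have -> : \sum_(t <- T (size v)) (if seq.prefix (rcons v t) Q then mu else 0)
        = \sum_(t <- T (size v) | t == t0) mu.
      rewrite [RHS]big_mkcond; apply: eq_bigr => t _.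
      rewrite QE seq.prefixE size_rcons take_cat ltnNge leqnSn /= subSnn /= take0.
      by rewrite -cats1 eqseq_cat// eqxx /= eqseq_cons andbT eq_sym.
    rewrite big_const_seq -Monoid.iteropE /=.
    by rewrite count_uniq_mem//; case: (_ \in _).
  - rewrite big1// => t _; case: ifP => // /seq.prefixP[r QE].
    by move: nv; rewrite QE cat_rcons prefix_prefix.
have /choice[F hF] : forall v, exists t, good v -> t \in T (size v) /\ good (rcons v t).
  move=> v; have [gv|ngv] := pselect (good v).
    by have [t ht] := step v gv; exists t.
  by have := T_neq0 (size v); case: (T _) => // t l _; exists t.
pose vs := fix vs k := if k is k'.+1 then rcons (vs k') (F (vs k')) else [::].
pose c k := F (vs k).
have vsE k : vs k = mkseq c k.
  by elim: k => // k IH; rewrite mkseqS -IH.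
have gvs k : good (vs k) by elim: k => // k IH; exact: (hF _ IH).2.
have [n [b qE]] : exists n b, mkseq c (size (q n b)) = q n b.
  apply: hq => k; have := (hF _ (gvs k)).1.
  by rewrite {2}vsE size_mkseq.
(* At the node met by the branch, [m] already contains the mass of that node itself, so it cannot be
   good. *)
have := gvs (size (q n b)); rewrite vsE qE; apply/negP; rewrite -leNgt.
have hl := @nneseries_lim_ge R
  (fun k => (\sum_(b' : bool) g (q n b) k b')%:E) xpredT 0%N n.+1.
apply: le_trans (hl _); last by move=> *; rewrite lee_fin sumr_ge0.
rewrite big_nat_recr//= -[leLHS]add0e; apply: leeD.
  by apply: sume_ge0 => k _; rewrite lee_fin sumr_ge0.
rewrite lee_fin (bigD1 b)//= {1}/g prefix_refl lerDl.
by rewrite sumr_ge0.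
Qed.

End Kraft.

(** * Hausdorff dimension *)

Section HausdorffBasics.
Variable R : realType.
Implicit Types (A B : set R) (s d : R) (C : nat -> set R).
Local Open Scope ereal_scope.

Lemma diam_pow_ge0 s A : 0 <= diam_pow s A.
Proof. by rewrite /diam_pow; case: ifP => // _; exact: poweR_ge0. Qed.

Lemma diam_le A (d : R) : (forall x y, A x -> A y -> (`|x - y| <= d)%R) ->
  diam A <= d%:E.
Proof.
move=> h; apply: ge_ereal_sup => _ [[x y] /= [Ax Ay] <-].
by rewrite lee_fin; exact: h.
Qed.

Lemma le_diam A (d : R) x y : diam A <= d%:E -> A x -> A y -> (`|x - y| <= d)%R.
Proof.
move=> h Ax Ay; rewrite -lee_fin; apply: le_trans h.
by apply: ereal_sup_ubound; exists (x, y).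
Qed.

Lemma diam_pow_le s A (d : R) : (0 <= s)%R -> (0 <= d)%R -> diam A <= d%:E ->
  diam_pow s A <= (d `^ s)%:E.
Proof.
move=> s0 d0 h; rewrite /diam_pow; case: ifPn => [_|/set0P[x Ax]].
  by rewrite lee_fin powR_ge0.
rewrite -poweR_EFin; apply: gt0_ler_poweR => //.
  rewrite in_itv /= leey andbT.
  apply: le_trans (_ : `|x - x|%:E <= _); first by rewrite lee_fin.
  by apply: ereal_sup_ubound; exists (x, x).
by rewrite in_itv /= leey lee_fin d0.
Qed.

Lemma diam_powE s A (d : R) : A !=set0 -> diam A = d%:E -> diam_pow s A = (d `^ s)%:E.
Proof. by move=> /set0P A0 dE; rewrite /diam_pow (negbTE A0) dE poweR_EFin. Qed.

Lemma hausdorff_content_ge0 s d A : 0 <= hausdorff_content s d A.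
Proof.
apply: le_ereal_inf_tmp => _ [C _ <-]; apply: nneseries_ge0 => n _ _.
exact: diam_pow_ge0.
Qed.

Lemma hausdorff_measure_ge0 s A : 0 <= hausdorff_measure s A.
Proof.
apply: le_trans (hausdorff_content_ge0 s 1 A) _.
by apply: ereal_sup_ubound; exists 1%R => /=.
Qed.

Lemma hausdorff_measure_eq0 s A :
  (forall d e : R, (0 < d)%R -> (0 < e)%R -> exists C, [/\ A `<=` \bigcup_n C n,
     forall n, diam (C n) <= d%:E & \sum_(0 <= n <oo) diam_pow s (C n) <= e%:E]) ->
  hausdorff_measure s A = 0.
Proof.
move=> h; apply/eqP; rewrite eq_le hausdorff_measure_ge0 andbT.
apply: ge_ereal_sup => _ [d /= d0 <-].
apply/lee_addgt0Pr => e e0; rewrite add0e.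
have [C [h1 h2 h3]] := h d e d0 e0; apply: le_trans h3.
by apply: ereal_inf_lbound; exists C.
Qed.

Lemma hausdorff_measure_neq0 s A (d c : R) : (0 < d)%R -> (0 < c)%R ->
  (forall C, A `<=` \bigcup_n C n -> (forall n, diam (C n) <= d%:E) ->
     c%:E <= \sum_(0 <= n <oo) diam_pow s (C n)) ->
  hausdorff_measure s A <> 0.
Proof.
move=> d0 c0 h H0; have : c%:E <= hausdorff_measure s A.
  apply: le_trans (_ : hausdorff_content s d A <= _); last first.
    by apply: ereal_sup_ubound; exists d.
  by apply: le_ereal_inf_tmp => _ [C [h1 h2] <-]; exact: h.
by rewrite H0 lee_fin leNgt c0.
Qed.

Lemma hausdorff_measureS s A B : A `<=` B ->
  hausdorff_measure s A <= hausdorff_measure s B.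
Proof.
move=> AB; apply: ge_ereal_sup => _ [d /= d0 <-].
apply: le_trans (_ : hausdorff_content s d B <= _); last first.
  by apply: ereal_sup_ubound; exists d.
apply: le_ereal_inf_tmp => _ [C [BC dC] <-]; apply: ereal_inf_lbound; exists C => //.
by split => //; exact: subset_trans BC.
Qed.

Lemma hausdorff_dim_ge0 A : 0 <= hausdorff_dim A.
Proof. by apply: le_ereal_inf_tmp => _ [s [s0 _] <-]; rewrite lee_fin. Qed.

Lemma hausdorff_dimS A B : A `<=` B -> hausdorff_dim A <= hausdorff_dim B.
Proof.
move=> AB; apply: le_ereal_inf_tmp => _ [s [s0 Bs] <-].
apply: ereal_inf_lbound; exists s => //; split => //.
apply/eqP; rewrite eq_le hausdorff_measure_ge0 andbT -Bs.
exact: hausdorff_measureS.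
Qed.

Lemma hausdorff_dim_le s A : (0 <= s)%R -> hausdorff_measure s A = 0 ->
  hausdorff_dim A <= s%:E.
Proof. by move=> s0 h; apply: ereal_inf_lbound; exists s. Qed.

Lemma hausdorff_dim_ge (D : R) A :
  (forall s, (0 <= s)%R -> (s < D)%R -> hausdorff_measure s A <> 0) ->
  D%:E <= hausdorff_dim A.
Proof.
move=> h; apply: le_ereal_inf_tmp => _ [s [s0 As] <-].
by rewrite lee_fin leNgt; apply/negP => /(h s s0).
Qed.

End HausdorffBasics.

(* Of three ordered intervals longer than the diameter of [C], the middle one
   separates the points of [C] in the two others. *)
Lemma at_most_two_intervals (R : realType) (T : Type) (P : set T) (l h : T -> R)
    (C : set R) (d : R) :
  (forall p q, P p -> P q -> p <> q -> h p <= l q \/ h q <= l p) ->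
  (forall p, P p -> d < h p - l p) ->
  (forall p, P p -> exists2 y, C y & l p <= y <= h p) ->
  (forall y z, C y -> C z -> `|y - z| <= d) ->
  P !=set0 -> exists q1 q2, [/\ P q1, P q2 & forall p, P p -> p = q1 \/ p = q2].
Proof.
move=> ord len hit dC [q1 Pq1].
have [[q2 [Pq2 q12]]|nq] := pselect (exists q2, P q2 /\ q1 <> q2); last first.
  exists q1, q1; split => // p Pp; left; apply: contrapT => pq.
  by apply: nq; exists p; split => // /esym.
exists q1, q2; split => // p Pp.
have [->|p1] := pselect (p = q1); first by left.
have [->|p2] := pselect (p = q2); first by right.
exfalso.
have [y1 Cy1 /andP[l1 h1]] := hit _ Pq1.
have [y2 Cy2 /andP[l2 h2]] := hit _ Pq2.
have [y3 Cy3 /andP[l3 h3]] := hit _ Pp.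
have := dC _ _ Cy1 Cy2; have := dC _ _ Cy1 Cy3; have := dC _ _ Cy2 Cy3.
rewrite !ler_norml => /andP[? ?] /andP[? ?] /andP[? ?].
have := len _ Pq1; have := len _ Pq2; have := len _ Pp.
by have [] := ord _ _ Pq1 Pq2 q12; have [] := ord _ _ Pp Pq1 p1;
  have [] := ord _ _ Pp Pq2 p2; lra.
Qed.

(** * Upper bound *)

Section CodedIntervals.
Variables (R : realType) (I : finType) (i0 : I).
Variables (phi psi : (nat -> I) -> R) (x_ : (nat -> I) -> R) (M : R -> R -> R).

(* [x_] is the coding map, [ci_lo p, ci_hi p] the interval of the word [p],
   [M x r] the mass of the ball of centre [x] and radius [r], and [ci_sep] a
   word whose interval lies well inside the one of the empty word. *)
Record coded_intervals := CodedIntervals {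
  ci_Cf : R ; ci_Cp : R ; ci_C : R ; ci_eta : R ; ci_K : R ; ci_c : R ;
  ci_sep : seq I ; ci_lo : seq I -> R ; ci_hi : seq I -> R ;
  ci_mass : seq I -> R ;
  ci_phi_bd : bounded_distortion phi ci_Cf ;
  ci_psi_bd : bounded_distortion psi ci_Cp ;
  ci_eta_gt0 : 0 < ci_eta ;
  ci_decay : forall n w, birkhoff phi n w <= ci_K - ci_eta * n%:R ;
  ci_len : forall p, expR (word_sum i0 phi p - ci_C) <= ci_hi p - ci_lo p
                     <= expR (word_sum i0 phi p + ci_C) ;
  ci_point : forall w n, ci_lo (mkseq w n) <= x_ w <= ci_hi (mkseq w n) ;
  ci_order : forall p q, ~~ seq.prefix p q -> ~~ seq.prefix q p ->
    ci_hi p <= ci_lo q \/ ci_hi q <= ci_lo p ;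
  ci_c_gt0 : 0 < ci_c ;
  ci_sepP : forall p w, mkseq w (size (p ++ ci_sep)) = p ++ ci_sep ->
    ci_lo p + ci_c * expR (word_sum i0 phi p) <= x_ w <=
    ci_hi p - ci_c * expR (word_sum i0 phi p) ;
  ci_massP : forall p, expR (word_sum i0 psi p - ci_C) <= ci_mass p
                       <= expR (word_sum i0 psi p + ci_C) ;
  ci_sub : forall p x r,
    (forall w, mkseq w (size p) = p -> `|x_ w - x| < r) -> ci_mass p <= M x r ;
  ci_sup : forall p q x r, (forall w, `|x_ w - x| < r ->
      mkseq w (size p) = p \/ mkseq w (size q) = q) ->
    M x r <= ci_mass p + ci_mass q
}.

(** [alpha] is a cluster value of the exponents at [x]; each of the four level sets is contained in
    the set of coded points with this property. *)
Definition limit_exponent (alpha x : R) : Prop := forall e rho : R,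
  0 < e -> 0 < rho -> exists r, [/\ 0 < r, r < rho & `|ln (M x r) / ln r - alpha| <= e].

Variable S : coded_intervals.
Let Cf := ci_Cf S.
Let Cp := ci_Cp S.
Let CG := ci_C S.
Let eta := ci_eta S.
Let K0 := ci_K S.
Let lo := ci_lo S.
Let hi := ci_hi S.
Let mass := ci_mass S.
Let sf := word_sum i0 phi.
Let sp := word_sum i0 psi.

Lemma ci_C_ge0 : 0 <= CG.
Proof.
have := ci_len S [::]; rewrite word_sum_nil add0r => /andP[h1 h2].
by have := le_trans h1 h2; rewrite ler_expR -/CG; lra.
Qed.

Lemma word_sum_decay p : sf p <= K0 - eta * (size p)%:R.
Proof. exact: ci_decay. Qed.

Lemma word_sum_step : exists2 B : R, 0 <= B & forall w n,
  `|sf (mkseq w n.+1) - sf (mkseq w n)| <= B.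
Proof.
have [B B0 hB] := bounded_distortion_bounded i0 (ci_phi_bd S).
have C0 := bounded_distortion_ge0 i0 (ci_phi_bd S).
exists (B + 2 * Cf); first by rewrite addr_ge0 ?mulr_ge0.
move=> w n.
have h1 := word_sum_mkseq i0 n.+1 w (ci_phi_bd S).
have h2 := word_sum_mkseq i0 n w (ci_phi_bd S).
have : birkhoff phi n.+1 w - birkhoff phi n w = phi (iter n (@Defs.shift I) w).
  by rewrite -addn1 birkhoffD birkhoff1 addrC addKr.
have := hB (iter n (@Defs.shift I) w).
move: h1 h2; rewrite -/sf -/Cf; move: (phi _) (birkhoff _ _ _) (birkhoff _ _ _).
move=> x y z; move: (sf _) (sf _) => a b.
rewrite !ler_norml => /andP[? ?] /andP[? ?] /andP[? ?] ?.
by apply/andP; split; lra.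
Qed.

(** First passage of the sums below [- L]: decay makes it happen, and the bound [B] on the steps
    controls the overshoot. *)
Lemma stopping_word (B L : R) w : 0 < L ->
  (forall w n, `|sf (mkseq w n.+1) - sf (mkseq w n)| <= B) ->
  exists n, [/\ sf (mkseq w n) <= - L, - L - B <= sf (mkseq w n) &
    forall k, (k < n)%N -> - L < sf (mkseq w k)].
Proof.
move=> L0 hB.
have ex : exists n, sf (mkseq w n) <= - L.
  near \oo => n; exists n.
  apply: le_trans (word_sum_decay _) _; rewrite size_mkseq.
  rewrite lerBlDr -lerBlDl opprK -ler_pdivrMl ?ci_eta_gt0//.
  near: n; exact: nbhs_infty_ger.
have [n hn hmin] := ex_minnP ex.
exists n; split => //; last first.
  by move=> k kn; rewrite ltNge; apply/negP => /hmin; rewrite leqNgt kn.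
case: n hn hmin => [|n] hn hmin.
  by move: hn; rewrite /sf word_sum_nil; lra.
have : - L < sf (mkseq w n).
  by rewrite ltNge; apply/negP => /hmin; rewrite ltnn.
have := hB w n; rewrite ler_norml => /andP[? ?]; lra.
Unshelve. all: by end_near. Qed.

Let mass_gt0 p : 0 < mass p.
Proof. by have /andP[+ _] := ci_massP S p; apply: lt_le_trans (expR_gt0 _). Qed.

Lemma ball_mass_ge : exists2 K : R, 0 <= K & forall w r, 0 < r -> r < 1 ->
  exists n, [/\ `|sf (mkseq w n) - ln r| <= K,
    sp (mkseq w n) - K <= ln (M (x_ w) r) & 0 < M (x_ w) r].
Proof.
have [B B0 hB] := word_sum_step.
have C0 := ci_C_ge0.
exists (CG + 1 + B); first by lra.
move=> w r r0 r1.
have lr0 : ln r < 0 by rewrite ln_lt0// r0.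
(* This threshold makes the interval of length at most [r / e], so it lies in the ball. *)
have [|n [h1 h2 _]] := @stopping_word B (CG + 1 - ln r) w _ hB; first by lra.
have h3 : mass (mkseq w n) <= M (x_ w) r.
  apply: ci_sub => v vw.
  have := ci_point S v (size (mkseq w n)); rewrite vw.
  have := ci_point S w n; have /andP[_] := ci_len S (mkseq w n).
  have : expR (sf (mkseq w n) + CG) < r.
    by rewrite -[ltRHS]lnK// ltr_expR; lra.
  rewrite -/sf -/CG => ? ? /andP[? ?] /andP[? ?].
  by rewrite ltr_norml; apply/andP; split; lra.
have M0 := lt_le_trans (mass_gt0 _) h3.
exists n; split => //.
  by rewrite ler_norml; apply/andP; split; lra.
apply: le_trans (_ : ln (mass (mkseq w n)) <= _); last by rewrite ler_ln ?posrE.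
have /andP[h4 _] := ci_massP S (mkseq w n).
rewrite -[leLHS]expRK ler_ln ?posrE ?expR_gt0//; apply: le_trans h4.
by rewrite ler_expR -/sp -/CG; lra.
Qed.

(** Stop at intervals longer than the diameter of the ball: at most two of them contain coded points
    of the ball, and the heavier one carries at least half of the mass. It may be a neighbour of the
    interval of [w], hence the second point [v]. *)
Lemma ball_mass_le : exists K r0 : R, [/\ 0 <= K, 0 < r0, r0 <= 1 &
  forall w r, 0 < r -> r < r0 -> exists p v,
   [/\ mkseq v (size p) = p, `|x_ v - x_ w| < r, `|sf p - ln r| <= K &
       ln (M (x_ w) r) <= sp p + K]].
Proof.
have [B B0 hB] := word_sum_step.
have C0 := ci_C_ge0.
have ln2 : 0 <= ln 2 :> R by rewrite ln_ge0// ler1n.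
pose K := CG + 1 + B + ln 2.
exists K, (expR (- K)); split; rewrite ?expR_gt0//.
- by rewrite /K; lra.
- by rewrite -expR0 ler_expR /K; lra.
move=> w r r0 rK.
have lr : ln r < - K by rewrite -[ltRHS]expRK ltr_ln ?posrE ?expR_gt0.
(* Stopped intervals then have length at least [2 * r * e]; the condition [r < expR (- K)] says
   exactly that [L] is positive. *)
pose L := - (ln 2 + ln r + CG + 1 + B).
have L0 : 0 < L by rewrite /L; move: lr; rewrite /K; lra.
pose P := [set p | exists v, [/\ mkseq v (size p) = p, `|x_ v - x_ w| < r &
  [/\ sf p <= - L, - L - B <= sf p & forall k, (k < size p)%N -> - L < sf (mkseq v k)]]].
have stopP v : `|x_ v - x_ w| < r -> exists n, P (mkseq v n).
  move=> vr; have [n [h1 h2 h3]] := @stopping_word B L v L0 hB.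
  by exists n; exists v; rewrite size_mkseq.
have noprefix p q : P p -> P q -> p <> q -> ~~ seq.prefix p q.
  move=> [v [vp _ [hp _ _]]] [v' [vq _ [_ _ hq]]] pq; apply/negP => /seq.prefixP[s qE].
  have ps : (size p < size q)%N.
    rewrite qE size_cat -{1}[size p]addn0 ltn_add2l lt0n size_eq0; apply/eqP => s0.
    by apply: pq; rewrite qE s0 cats0.
  have := hq _ ps.
  have -> : mkseq v' (size p) = p.
    move: vq; rewrite qE size_cat mkseqD => /eqP.
    by rewrite eqseq_cat ?size_mkseq// => /andP[/eqP].
  by rewrite ltNge hp.
have [|||||q1 [q2 [P1 P2 hP]]] := @at_most_two_intervals R _ P lo hi
    [set y | `|y - x_ w| < r] (2 * r).
- move=> p q Pp Pq pq; apply: ci_order; apply: noprefix => //.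
  exact: nesym.
- move=> p [v [_ _ [_ h _]]].
  have /andP[+ _] := ci_len S p; apply: lt_le_trans.
  rewrite -[ltLHS]lnK ?posrE ?mulr_gt0// ltr_expR lnM ?posrE//.
  by rewrite -/sf -/CG; move: h; rewrite /L; lra.
- move=> p [v [vp vr _]]; exists (x_ v) => //.
  by have := ci_point S v (size p); rewrite vp.
- move=> y z /=; rewrite !ltr_norml ler_norml => /andP[? ?] /andP[? ?].
  by apply/andP; split; lra.
- by have [|n Pn] := stopP w; [rewrite subrr normr0|exists (mkseq w n)].
have h : M (x_ w) r <= mass q1 + mass q2.
  apply: ci_sup => v vr; have [n Pn] := stopP v vr.
  by have [<-|<-] := hP _ Pn; [left|right]; rewrite size_mkseq.
have [q [Pq hq1 hq2]] : exists q, [/\ P q, sp q1 <= sp q & sp q2 <= sp q].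
  by have [?|/ltW ?] := leP (sp q1) (sp q2); [exists q2|exists q1].
have [v [vq vr [h1 h2 _]]] := Pq.
have [K' _ hge] := ball_mass_ge.
have r1 : r < 1.
  by apply: lt_le_trans rK _; rewrite -expR0 ler_expR /K; lra.
have [n [_ _ M0]] := hge w r r0 r1.
exists q, v; split => //.
  by rewrite ler_norml; apply/andP; split; move: h1 h2; rewrite /L /K; lra.
have hm q' : sp q' <= sp q -> mass q' <= expR (sp q + CG).
  move=> h'; have /andP[_ h''] := ci_massP S q'; apply: le_trans h'' _.
  by rewrite ler_expR lerD2r.
apply: (@le_trans _ _ (ln (2 * expR (sp q + CG)))).
  rewrite ler_ln ?posrE ?mulr_gt0 ?expR_gt0//; apply: le_trans h _.
  by rewrite mulr_natl mulr2n lerD// hm.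
by rewrite lnM ?posrE ?expR_gt0// expRK /K; lra.
Qed.

Lemma limit_exponent_small alpha x (e rho L : R) : limit_exponent alpha x ->
  0 < e -> 0 < rho -> exists r, [/\ 0 < r, r < 1, r < rho, ln r < - L &
    `|ln (M x r) - alpha * ln r| <= - (e * ln r)].
Proof.
move=> h e0 rho0.
have m0 : 0 < Num.min (Num.min rho 1) (expR (- L)) by rewrite !lt_min rho0 ltr01 expR_gt0.
have [r [r0]] := h e _ e0 m0; rewrite !lt_min => /andP[/andP[rr r1] rL] hr.
exists r; have lr0 : ln r < 0 by rewrite ln_lt0// r0.
split => //; first by rewrite -[ltRHS]expRK ltr_ln ?posrE ?expR_gt0.
have -> : ln (M x r) - alpha * ln r = (ln (M x r) / ln r - alpha) * ln r.
  by rewrite mulrBl divfK// lt_eqF.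
by rewrite normrM (ltr0_norm lr0) mulrN lerN2 ler_wnM2r// ltW.
Qed.

Lemma limit_exponent_ge (A C alpha : R) w :
  (forall p, sp p <= A * sf p + C) -> limit_exponent alpha (x_ w) -> A <= alpha.
Proof.
move=> hA h; rewrite leNgt; apply/negP => aA.
have [K [r0 [K_ge0 r0_gt0 r0_le1 hK]]] := ball_mass_le.
pose K2 := `|A| * K + C + K.
pose e := (A - alpha) / 2.
have e0 : 0 < e by rewrite /e; lra.
have [r [rgt0 _ rlt lrL hr]] := limit_exponent_small (K2 / e) h e0 r0_gt0.
have [p [v [_ _ h1 h2]]] := hK w r rgt0 rlt.
have h3 := hA p.
have h4 : A * (sf p - ln r) <= `|A| * K.
  by apply: le_trans (ler_norm _) _; rewrite normrM ler_wpM2l.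
have h5 : - (e * ln r) <= K2.
  move: hr; rewrite ler_norml => /andP[h6 _].
  have : (A - alpha) * ln r = 2 * (e * ln r) by rewrite /e; field.
  by rewrite /K2; lra.
by move: lrL; rewrite -mulNr ltr_pdivlMr// => h7; move: h5 h7; rewrite mulrC; lra.
Qed.

Lemma limit_exponent_le (A C alpha : R) w :
  (forall p, A * sf p <= sp p + C) -> limit_exponent alpha (x_ w) -> alpha <= A.
Proof.
move=> hA h; rewrite leNgt; apply/negP => aA.
have [K K_ge0 hK] := ball_mass_ge.
pose K2 := `|A| * K + C + K.
pose e := (alpha - A) / 2.
have e0 : 0 < e by rewrite /e; lra.
have [r [rgt0 rlt _ lrL hr]] := limit_exponent_small (K2 / e) h e0 ltr01.
have [n [h1 h2 _]] := hK w r rgt0 rlt.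
have h3 := hA (mkseq w n).
have h4 : A * (ln r - sf (mkseq w n)) <= `|A| * K.
  by apply: le_trans (ler_norm _) _; rewrite normrM ler_wpM2l// distrC.
have h5 : - (e * ln r) <= K2.
  move: hr; rewrite ler_norml => /andP[_ h6].
  have : (alpha - A) * ln r = 2 * (e * ln r) by rewrite /e; field.
  by rewrite /K2; lra.
by move: lrL; rewrite -mulNr ltr_pdivlMr// => h7; move: h5 h7; rewrite mulrC; lra.
Qed.

End CodedIntervals.

(** * Series indexed by words *)

Section WordSeries.
Variables (R : realType) (I : finType).

Lemma geometric_sum_le (rho : R) N L : 0 <= rho -> rho < 1 ->
  \sum_(N <= n < L) rho ^+ n <= rho ^+ N / (1 - rho).
Proof.
move=> r0 r1; rewrite ler_pdivlMr ?subr_gt0//.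
have [NL|LN] := leqP N L; last by rewrite big_geq ?mul0r ?exprn_ge0// ltnW.
suff -> : (\sum_(N <= n < L) rho ^+ n) * (1 - rho) = rho ^+ N - rho ^+ L.
  by rewrite gerBl exprn_ge0.
elim: L NL => [|L IH]; first by rewrite leqn0 => /eqP ->; rewrite big_geq// mul0r subrr.
rewrite leq_eqVlt => /orP[/eqP ->|]; first by rewrite big_geq// mul0r subrr.
rewrite ltnS => NL; rewrite big_nat_recr//= mulrDl IH// exprS; ring.
Qed.

(** Covers are indexed by natural numbers, so words are enumerated by [pickle]; numbers that encode
    no word contribute 0. *)
Definition word_tail (V : seq I -> R) N (m : nat) : R :=
  if (pickle_inv m : option (seq I)) is Some p then
    if (N <= size p)%N then V p else 0
  else 0.

Lemma word_series_small (V : seq I -> R) (K rho : R) :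
  (forall p, 0 <= V p) -> 0 <= rho -> rho < 1 ->
  (forall n, \sum_(p : n.-tuple I) V p <= K * rho ^+ n) ->
  forall e, 0 < e -> exists N0, forall N, (N0 <= N)%N ->
  (\sum_(0 <= m <oo) (word_tail V N m)%:E <= e%:E)%E.
Proof.
move=> V0 r0 r1 hV e e0.
have K0 : 0 <= K.
  by have := hV 0%N; rewrite expr0 mulr1; apply: le_trans; exact: sumr_ge0.
have [N0 hN0] : exists N0 : nat, forall N, (N0 <= N)%N -> K * (rho ^+ N / (1 - rho)) <= e.
  have /cvgr0Pnorm_le H : rho ^+ n @[n --> \oo] --> 0.
    by apply: cvg_expr; rewrite ger0_norm.
  have d0 : 0 < e * (1 - rho) / (K + 1).
    by rewrite divr_gt0 ?mulr_gt0 ?subr_gt0// ltr_wpDl.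
  have [N0 _ h] := H _ d0; exists N0 => N NN.
  have := h N NN; rewrite ger0_norm ?exprn_ge0// ler_pdivlMr ?ltr_wpDl// => h'.
  rewrite mulrA ler_pdivrMr ?subr_gt0//; apply: le_trans h'.
  by rewrite mulrC ler_wpM2l ?exprn_ge0// lerDl.
exists N0 => N NN.
set h := word_tail V N.
have h0 m : 0 <= h m by rewrite /h /word_tail; case: pickle_inv => // p; case: ifP.
apply: lime_le; first by apply: is_cvg_nneseries => n _ _; rewrite lee_fin.
apply: nearW => k; rewrite sumEFin lee_fin; apply: le_trans (hN0 _ NN).
(* Exceeds the length of every word with code below [k], which lets the partial sum be regrouped by
   length. *)
pose L := (\sum_(m < k) (if (pickle_inv m : option (seq I)) is Some p then (size p).+1 else 0))%N.
rewrite big_mkord.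
apply: le_trans (_ : \sum_(m < k) \sum_(N <= n < L) \sum_(p : n.-tuple I)
   (if pickle (val p) == m then V p else 0) <= _).
  apply: ler_sum => m _.
  have F0 : 0 <= \sum_(N <= n < L) \sum_(p : n.-tuple I)
     (if pickle (val p) == m :> nat then V p else 0).
    by apply: sumr_ge0 => n _; apply: sumr_ge0 => p _; case: ifP.
  rewrite /h /word_tail; case E: (pickle_inv m : option (seq I)) => [p|//]; case: ifPn => // Np.
  have pL : (size p < L)%N.
    by rewrite /L (bigD1 m)//= E leq_addr.
  rewrite (bigD1_seq (size p)) ?iota_uniq//=; last by rewrite mem_index_iota Np.
  rewrite (bigD1 (in_tuple p))//=.
  have -> : pickle p == m.
    by have := @pickle_invK (seq I) m; rewrite /ocancel E /= => ->.
  rewrite -addrA lerDl addr_ge0//; first by apply: sumr_ge0 => q _; case: ifP.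
  by apply: sumr_ge0 => n _; apply: sumr_ge0 => q _; case: ifP.
rewrite exchange_big /=.
apply: le_trans (ler_wpM2l K0 (geometric_sum_le N L r0 r1)).
rewrite mulr_sumr; apply: ler_sum => n _; apply: le_trans (hV n).
rewrite exchange_big /=; apply: ler_sum => p _.
have [kp|kp] := ltnP (pickle (val p)) k.
  rewrite (bigD1 (Ordinal kp))//= eqxx big1 ?addr0// => m.
  by rewrite -val_eqE /= eq_sym => /negbTE ->.
by rewrite big1// => m _; rewrite gtn_eqF// (leq_trans (ltn_ord m)).
Qed.

End WordSeries.

Section UpperBound.
Variables (R : realType) (I : finType) (i0 : I).
Variables (phi psi : (nat -> I) -> R) (x_ : (nat -> I) -> R) (M : R -> R -> R).
Variable S : coded_intervals i0 phi psi x_ M.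
Let sf := word_sum i0 phi.
Let sp := word_sum i0 psi.

(** For [beta >= 0] the mass of the ball must be bounded above, by a word that may belong to a
    neighbouring interval; for [beta < 0] it must be bounded below, by a prefix of [w]. One [theta]
    absorbs the tolerance in the exponent, the other is kept for the convergence of the sum over all
    words. *)
Lemma exponent_word (alpha beta t theta : R) : 0 < theta -> 0 <= alpha * beta + t ->
  exists K1 K2 : R, forall w N, limit_exponent M alpha (x_ w) -> exists p,
  [/\ (N <= size p)%N,
      ci_lo S p - expR (sf p + K1) <= x_ w <= ci_hi S p + expR (sf p + K1) &
      (alpha * beta + t + 2 * theta) * sf p <= (t + theta) * sf p + beta * sp p + K2].
Proof.
move=> th0 st0; set s := _ + 2 * theta.
have s0 : 0 < s by rewrite /s; lra.
have [Ka [r0 [Ka0 r0_gt0 r0_le1 hKa]]] := ball_mass_le S.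
have [Kb Kb0 hKb] := ball_mass_ge S.
have [B B0 hB] := bounded_distortion_bounded i0 (ci_phi_bd S).
pose K := Num.max Ka Kb.
have KaK : Ka <= K by rewrite le_max lexx.
have KbK : Kb <= K by rewrite le_max lexx orbT.
pose K2 := s * K + `|t + theta| * K + `|beta| * K.
exists K, K2 => w N h.
have be0 : 0 < `|beta| + 1 by rewrite ltr_wpDl.
have e0 : 0 < theta / (`|beta| + 1) by rewrite divr_gt0.
(* A radius this small forces long words, since sums over words of length below [N] are at most
   [B * N] in absolute value. *)
have [r [rgt0 r1 rlt lrL hr]] :=
  limit_exponent_small (K + B * N%:R) h e0 r0_gt0.
have lr0 : ln r < 0 by rewrite ln_lt0// rgt0.
have hr' : `|beta| * `|ln (M (x_ w) r) - alpha * ln r| <= - (theta * ln r).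
  apply: le_trans (ler_wpM2l (normr_ge0 _) hr) _.
  rewrite mulrN lerN2 mulrA ler_wnM2r//; first exact: ltW.
  by rewrite mulrCA ger_pMr// ler_pdivrMr// mul1r lerDl.
have size_ge p : `|sf p - ln r| <= K -> (N <= size p)%N.
  move=> hp; rewrite leqNgt; apply/negP => pN.
  have := birkhoff_le (size p) (word_point i0 p) hB; rewrite -/(word_sum _ _ _) -/sf.
  have : B * (size p)%:R <= B * N%:R by rewrite ler_wpM2l// ler_nat ltnW.
  move: hp; rewrite !ler_norml => /andP[h1 h2] h3 /andP[h4 h5]; lra.
have last_step p : `|sf p - ln r| <= K -> beta * ln (M (x_ w) r) <= beta * sp p + `|beta| * K ->
   s * sf p <= (t + theta) * sf p + beta * sp p + K2.
  move=> hp h1.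
  have h2 : beta * (alpha * ln r - ln (M (x_ w) r)) <= - (theta * ln r).
    by apply: le_trans (ler_norm _) _; rewrite normrM distrC.
  have h3 : s * (sf p - ln r) <= s * K.
    by rewrite ler_wpM2l ?(ltW s0)//; apply: le_trans (ler_norm _) _.
  have h4 : (t + theta) * (ln r - sf p) <= `|t + theta| * K.
    by apply: le_trans (ler_norm _) _; rewrite normrM distrC ler_wpM2l.
  have h5 : s * ln r = alpha * beta * ln r + t * ln r + 2 * theta * ln r by rewrite /s; ring.
  by rewrite /K2; lra.
have r_le p : `|sf p - ln r| <= K -> r <= expR (sf p + K).
  move=> hp; rewrite -[leLHS]lnK// ler_expR; move: hp; rewrite ler_norml => /andP[? ?].
  lra.
have [b0|b0] := leP 0 beta.
  have [p [v [vp vw h1 h2]]] := hKa w r rgt0 rlt.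
  have h1' := le_trans h1 KaK.
  exists p; split; first exact: size_ge.
    have := r_le _ h1'; have := ci_point S v (size p); rewrite vp.
    move: vw; rewrite ltr_norml => /andP[? ?] /andP[? ?] ?.
    by apply/andP; split; lra.
  apply: last_step => //; rewrite ger0_norm// -mulrDr ler_wpM2l//.
  by apply: le_trans h2 _; rewrite lerD2l.
have [n [h1 h2 _]] := hKb w r rgt0 r1.
have h1' := le_trans h1 KbK.
exists (mkseq w n); split; first exact: size_ge.
  have := expR_ge0 (sf (mkseq w n) + K); have := ci_point S w n.
  by move=> /andP[? ?] ?; apply/andP; split; lra.
apply: last_step => //; rewrite ltr0_norm// mulNr -mulrBr; apply: ler_wnM2l; first exact: ltW.
by apply: le_trans h2; rewrite lerB.
Qed.

Lemma limit_exponent_measure0 (alpha beta t theta Z : R) : 0 < theta ->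
  0 <= alpha * beta + t ->
  (forall n, \sum_(p : n.-tuple I) expR (t * sf p + beta * sp p) <= Z) ->
  hausdorff_measure (alpha * beta + t + 2 * theta)
    [set x | exists w, x = x_ w /\ limit_exponent M alpha x] = 0%E.
Proof.
move=> th0 st0 hZ.
have [K1 [K2 hK]] := exponent_word th0 st0.
set s := _ + 2 * theta in hK *.
have s0 : 0 < s by rewrite /s; lra.
have eta0 := ci_eta_gt0 S; set eta := ci_eta S in eta0.
have decay p : sf p <= ci_K S - eta * (size p)%:R := word_sum_decay S p.
have C0 := ci_C_ge0 S; set CG := ci_C S in C0.
pose V p := expR ((t + theta) * sf p + beta * sp p).
have VE n : \sum_(p : n.-tuple I) V p <= (expR (theta * ci_K S) * Z) * expR (- (theta * eta)) ^+ n.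
  rewrite -expRM_natl mulrAC -expRD -mulrC.
  apply: le_trans (ler_wpM2r _ (hZ n)).
    rewrite mulr_suml; apply: ler_sum => p _; rewrite -expRD ler_expR.
    have := ler_wpM2l (ltW th0) (decay p); rewrite size_tuple; lra.
  exact: expR_ge0.
pose K3 := Num.max K1 CG.
have K1K3 : K1 <= K3 by rewrite le_max lexx.
have CGK3 : CG <= K3 by rewrite le_max lexx orbT.
pose J p := [set x | ci_lo S p - expR (sf p + K1) <= x <= ci_hi S p + expR (sf p + K1)].
have diamJ p : (diam (J p) <= (3 * expR (sf p + K3))%:E)%E.
  apply: diam_le => x y /= /andP[x1 x2] /andP[y1 y2].
  have /andP[_ h1] := ci_len S p.
  have h2 : expR (sf p + CG) <= expR (sf p + K3) by rewrite ler_expR lerD2l.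
  have h3 : expR (sf p + K1) <= expR (sf p + K3) by rewrite ler_expR lerD2l.
  rewrite -/sf -/CG in h1.
  by rewrite ler_norml; apply/andP; split; lra.
(* Only for these words is the power of the diameter controlled by [V]; the other words get the
   empty set in the cover. *)
pose good p := s * sf p <= (t + theta) * sf p + beta * sp p + K2.
pose K4 := s * (ln 3 + K3) + K2.
have powJ p : good p -> (diam_pow s (J p) <= (expR K4 * V p)%:E)%E.
  move=> gp; apply: le_trans (diam_pow_le (ltW s0) _ (diamJ p)) _.
    by rewrite mulr_ge0 ?expR_ge0.
  rewrite lee_fin /powR gt_eqF ?mulr_gt0 ?expR_gt0//.
  rewrite lnM ?posrE ?expR_gt0// expRK -expRD ler_expR /K4.
  by move: gp; rewrite /good; lra.
apply: hausdorff_measure_eq0 => d e d0 e0.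
have e'0 : 0 < e / expR K4 by rewrite divr_gt0 ?expR_gt0.
have rho1 : expR (- (theta * eta)) < 1 by rewrite expR_lt1 oppr_lt0 mulr_gt0.
have [N0 hN0] := word_series_small (V := V) (fun p => expR_ge0 _) (expR_ge0 _) rho1 VE e'0.
have [N [NN0 hN]] : exists N : nat, (N0 <= N)%N /\
    ci_K S - eta * N%:R + K3 + ln 3 <= ln d.
  near \oo => N; exists N; split; first by near: N; exists N0.
  have : (ci_K S + K3 + ln 3 - ln d) / eta <= N%:R by near: N; exact: nbhs_infty_ger.
  rewrite ler_pdivrMr//; lra.
pose C m := if (pickle_inv m : option (seq I)) is Some p then
   if (N <= size p)%N && good p then J p else set0 else set0.
exists C; split.
- move=> _ [w [-> hw]]; have [p [h1 h2 h3]] := hK w N hw.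
  exists (pickle p) => //; rewrite /C pickleK_inv h1 /good.
  by rewrite h3 /J /= h2.
- move=> m; rewrite /C.
  have D0 : (diam (@set0 R) <= d%:E)%E by apply: diam_le.
  case: pickle_inv => // p; case: ifP => // /andP[Np _].
  apply: le_trans (diamJ p) _; rewrite lee_fin -[leRHS]lnK ?posrE//.
  rewrite -[X in X * _]lnK ?posrE// -expRD ler_expR.
  have := decay p; have : eta * N%:R <= eta * (size p)%:R by rewrite ler_pM2l// ler_nat.
  lra.
- have := hN0 N NN0; set F := word_tail V N => hF.
  apply: le_trans (_ : (\sum_(0 <= m <oo) ((expR K4)%:E * (F m)%:E) <= _)%E); last first.
    rewrite nneseriesZl; last first.
      move=> m _; rewrite lee_fin /F /word_tail; case: pickle_inv => // p.
      by case: ifP => // _; exact: expR_ge0.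
    apply: le_trans (lee_wpmul2l _ hF) _; first by rewrite lee_fin expR_ge0.
    by rewrite -EFinM lee_fin mulrC divfK// gt_eqF ?expR_gt0.
  apply: lee_nneseries => [m _ _|m _]; first exact: diam_pow_ge0.
  rewrite /C /F /word_tail; case: pickle_inv => [p|].
    case: (N <= size p)%N => /=.
      case: ifP => [gp|_]; first by rewrite -EFinM; exact: powJ.
      by rewrite /diam_pow eqxx -EFinM lee_fin mulr_ge0 ?expR_ge0.
    by rewrite /diam_pow eqxx mule0.
  by rewrite /diam_pow eqxx mule0.
Unshelve. all: by end_near. Qed.

End UpperBound.

(** * Lower bound *)

(** The stage is raised only when [j] has reached the next stage times its block length. Every block
    used is then short compared with the number of blocks before it. *)
Lemma slow_schedule (L : nat -> nat) : exists k : nat -> nat,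
  (forall N, exists J, forall j, (J <= j)%N -> (N <= k j)%N) /\
  forall j, (k j * L (k j) <= j)%N.
Proof.
pose k := fix k j := if j is j'.+1 then
  if ((k j').+1 * L (k j').+1 <= j)%N then (k j').+1 else k j' else 0%N.
have kS j : k j.+1 =
  if ((k j).+1 * L (k j).+1 <= j.+1)%N then (k j).+1 else k j by [].
have kmono i j : (i <= j)%N -> (k i <= k j)%N.
  move=> /subnK <-; elim: (j - i)%N => // n IH; apply: leq_trans IH _.
  by rewrite addSn kS; case: ifP.
exists k; split; last first.
  by elim=> [|j IH]; [rewrite mul0n | rewrite kS; case: ifP => // _; exact: leqW].
elim=> [|N [J hJ]]; first by exists 0%N.
pose j0 := maxn J (N.+1 * L N.+1).
exists j0.+1 => j jj; apply: leq_trans (kmono _ _ jj).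
have := hJ j0 (leq_maxl _ _); rewrite leq_eqVlt => /orP[/eqP kE|kN]; last first.
  exact: leq_trans kN (kmono _ _ (leqnSn _)).
have h : (N.+1 * L N.+1 <= j0.+1)%N by rewrite leqW// leq_maxr.
by rewrite kS -kE h.
Qed.

Section LowerBound.
Variables (R : realType) (I : finType) (i0 : I).
Variables (phi psi : (nat -> I) -> R) (x_ : (nat -> I) -> R) (M : R -> R -> R).
Variable S : coded_intervals i0 phi psi x_ M.
Variables (alpha D : R).
Hypothesis D_gt0 : 0 < D.
Let sf := word_sum i0 phi.
Let sp := word_sum i0 psi.
Let Cf := ci_Cf S.
Let Cp := ci_Cp S.

Definition has_exponent (x : R) : Prop := forall e : R, 0 < e ->
  exists2 rho : R, 0 < rho & forall r, 0 < r -> r < rho ->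
    `|ln (M x r) / ln r - alpha| <= e.

(* [1 <= e * L] lets [e * L] absorb the distortion of one concatenation. *)
Definition is_block (e : R) (L : nat) (T : seq (seq I)) : Prop :=
  [/\ 1 <= e * L%:R, uniq T, T != [::] & forall p, p \in T ->
   [/\ size p = L, exists r, p = ci_sep S ++ r,
    `|sp p - alpha * sf p| <= e * L%:R &
    - (D * sf p) - e * L%:R <= ln (size T)%:R]].

Definition total_length (l : nat -> nat) j := (\sum_(i < j) l i)%N.

Lemma block_sequence : (forall e, 0 < e -> exists L T, is_block e L T) ->
  exists (e : nat -> R) (l : nat -> nat) (T : nat -> seq (seq I)),
  [/\ forall j, 0 < e j, forall j, is_block (e j) (l j) (T j),
    forall d : R, 0 < d -> exists J, forall j, (J <= j)%N -> e j <= d &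
    forall d : R, 0 < d -> exists J, forall j, (J <= j)%N ->
      (l j)%:R <= d * (total_length l j)%:R].
Proof.
move=> H.
have /choice[F hF] : forall k : nat, exists LT : nat * seq (seq I),
    is_block (k.+1%:R^-1) LT.1 LT.2.
  by move=> k; have [|L [T hT]] := H (k.+1%:R^-1) _; [rewrite invr_gt0|exists (L, T)].
have [k [kinf kL]] := slow_schedule (fun k => (F k).1).
exists (fun j => (k j).+1%:R^-1), (fun j => (F (k j)).1), (fun j => (F (k j)).2).
have len_gt0 j : (0 < (F j).1)%N.
  rewrite lt0n; apply/eqP => F0; have [+ _ _ _] := hF j.
  by rewrite F0 mulr0 ler10.
split => //.
- move=> d d0; have [N hN] : exists N : nat, d^-1 <= N%:R.
    near \oo => N; exists N; near: N; exact: nbhs_infty_ger.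
  have [J hJ] := kinf N; exists J => j /hJ kj.
  rewrite invf_ple ?posrE//; apply: le_trans hN _.
  by rewrite ler_nat (leq_trans kj).
- move=> d d0; have [N hN] : exists N : nat, d^-1 <= N%:R.
    near \oo => N; exists N; near: N; exact: nbhs_infty_ger.
  have [J hJ] := kinf N; exists J => j /hJ kj.
  rewrite -ler_pdivrMl//.
  apply: (@le_trans _ _ ((k j)%:R * (F (k j)).1%:R)).
    by rewrite ler_wpM2r//; apply: le_trans hN _; rewrite ler_nat.
  rewrite -natrM ler_nat; apply: leq_trans (kL j) _.
  rewrite /total_length -[leqLHS]card_ord -sum1_card.
  by apply: leq_sum => i _; exact: len_gt0.
Unshelve. all: by end_near. Qed.

Section Branches.
Variables (e : nat -> R) (l : nat -> nat) (T : nat -> seq (seq I)).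
Hypothesis e_gt0 : forall j, 0 < e j.
Hypothesis T_block : forall j, is_block (e j) (l j) (T j).
Hypothesis e_small : forall d : R, 0 < d -> exists J, forall j, (J <= j)%N -> e j <= d.
Hypothesis l_small : forall d : R, 0 < d -> exists J, forall j, (J <= j)%N ->
  (l j)%:R <= d * (total_length l j)%:R.

Let N j : R := (total_length l j)%:R.
Let Err j : R := \sum_(i < j) e i * (l i)%:R.
Let Lam j : R := \sum_(i < j) ln (size (T i))%:R.

Let NS j : N j.+1 = N j + (l j)%:R.
Proof. by rewrite /N /total_length big_ord_recr /= natrD. Qed.

Let N_mono i j : (i <= j)%N -> N i <= N j.
Proof.
move=> /subnK <-; elim: (j - i)%N => // n IH; apply: le_trans IH _.
by rewrite addSn NS lerDl.
Qed.

Let ErrS j : Err j.+1 = Err j + e j * (l j)%:R.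
Proof. by rewrite /Err big_ord_recr. Qed.

Let LamS j : Lam j.+1 = Lam j + ln (size (T j))%:R.
Proof. by rewrite /Lam big_ord_recr. Qed.

Let el_ge1 j : 1 <= e j * (l j)%:R. Proof. by have [] := T_block j. Qed.

Let l_gt0 j : (0 < l j)%N.
Proof.
rewrite lt0n; apply/eqP => l0; have := el_ge1 j.
by rewrite l0 mulr0 ler10.
Qed.

Let N_ge j : j%:R <= N j.
Proof.
rewrite ler_nat /total_length -[leqLHS]card_ord -sum1_card.
by apply: leq_sum => i _; exact: l_gt0.
Qed.

Let N_ge0 j : 0 <= N j. Proof. by []. Qed.

Let Err_ge0 j : 0 <= Err j.
Proof. by apply: sumr_ge0 => i _; rewrite mulr_ge0// ltW. Qed.

(** One half of little-o of the total length: only upper bounds are recorded. *)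
Let small (f : nat -> R) := forall d : R, 0 < d -> exists J, forall j, (J <= j)%N ->
  f j <= d * N j.

Let smallD f g : small f -> small g -> small (fun j => f j + g j).
Proof.
move=> hf hg d d0; have d2 : 0 < d / 2 by rewrite divr_gt0.
have [J1 h1] := hf _ d2; have [J2 h2] := hg _ d2.
exists (maxn J1 J2) => j; rewrite geq_max => /andP[/h1 ? /h2 ?]; lra.
Qed.

Let smallZ c f : 0 <= c -> (forall j, 0 <= f j) -> small f -> small (fun j => c * f j).
Proof.
move=> c0 f0 hf d d0; have c1 : 0 < c + 1 by rewrite ltr_wpDl.
have [J h] := hf (d / (c + 1)) (divr_gt0 d0 c1).
exists J => j /h; rewrite mulrAC ler_pdivlMr// => hj.
by apply: le_trans hj; rewrite mulrC ler_wpM2l// lerDl.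
Qed.

Let small_cst c : small (fun=> c).
Proof.
move=> d d0; near \oo => J; exists J => j Jj.
rewrite -ler_pdivrMl//; apply: le_trans (N_ge j).
apply: le_trans (_ : J%:R <= _); last by rewrite ler_nat.
rewrite mulrC; near: J; exact: nbhs_infty_ger.
Unshelve. all: by end_near. Qed.

Let small_shift f : small f -> small (fun j => f j.+1).
Proof.
move=> hf d d0; have d2 : 0 < d / 2 by rewrite divr_gt0.
have [J1 h1] := hf _ d2; have [J2 h2] := l_small ltr01.
exists (maxn J1 J2) => j; rewrite geq_max => /andP[j1 /h2]; rewrite mul1r => lN.
have := h1 j.+1 (leqW j1); rewrite NS => h.
have : d / 2 * (N j + (l j)%:R) <= d / 2 * (N j + N j).
  by rewrite ler_pM2l// lerD2l.
lra.
Qed.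

Let small_l : small (fun j => (l j)%:R).
Proof. exact: l_small. Qed.

Let small_Err : small Err.
Proof.
move=> d d0; have d2 : 0 < d / 2 by rewrite divr_gt0.
have [J1 h1] := e_small d2.
have hE j : (J1 <= j)%N -> Err j <= Err J1 + d / 2 * N j.
  move=> /subnK <-; elim: (j - J1)%N => [|n IH].
    by rewrite lerDl mulr_ge0// ltW.
  rewrite addSn ErrS NS mulrDr addrA lerD// ler_wpM2r// h1//.
  exact: leq_addl.
have [J2 h2] := small_cst (Err J1) d2.
exists (maxn J1 J2) => j; rewrite geq_max => /andP[/hE ? /h2 ?]; lra.
Qed.

Definition is_branch (c : nat -> seq I) := forall j, c j \in T j.

Definition branch_word (c : nat -> seq I) j : seq I := flatten (mkseq c j).

(** Blocks are nonempty, so the first [k.+1] of them reach position [k]. *)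
Definition branch_point (c : nat -> seq I) : nat -> I :=
  fun k => nth i0 (branch_word c k.+1) k.

Let word0 c : branch_word c 0 = [::]. Proof. by []. Qed.

Let wordS c j : branch_word c j.+1 = branch_word c j ++ c j.
Proof. by rewrite /branch_word mkseqS flatten_rcons. Qed.

Let size_block c j : is_branch c -> size (c j) = l j.
Proof. by move=> hc; have [_ _ _ /(_ _ (hc j))[]] := T_block j. Qed.

Lemma size_branch_word c j : is_branch c -> size (branch_word c j) = total_length l j.
Proof.
move=> hc; elim: j => [|j IH]; first by rewrite /total_length big_ord0.
by rewrite wordS size_cat IH size_block// /total_length big_ord_recr.
Qed.

Let word_prefix c i j : (i <= j)%N -> exists r, branch_word c j = branch_word c i ++ r.
Proof.
move=> /subnK <-; elim: (j - i)%N => [|n [r IH]]; first by exists [::]; rewrite cats0.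
by rewrite addSn wordS IH -catA; eexists.
Qed.

Lemma mkseq_branch_point c j : is_branch c ->
  mkseq (branch_point c) (size (branch_word c j)) = branch_word c j.
Proof.
move=> hc; apply: (@eq_from_nth _ i0); rewrite size_mkseq// => k kj.
rewrite nth_mkseq// /branch_point.
have kk : (k < size (branch_word c k.+1))%N.
  by rewrite size_branch_word// -(ler_nat R); exact: N_ge.
have [r1 h1] := word_prefix c (leq_maxl k.+1 j).
have [r2 h2] := word_prefix c (leq_maxr k.+1 j).
have := congr1 (fun p => nth i0 p k) h1; rewrite h2 !nth_cat kj kk.
by move=> ->.
Qed.

Let Cf0 : 0 <= Cf. Proof. exact: (bounded_distortion_ge0 i0 (ci_phi_bd S)). Qed.
Let Cp0 : 0 <= Cp. Proof. exact: (bounded_distortion_ge0 i0 (ci_psi_bd S)). Qed.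

Let K1 := 1 + 2 * (Cp + `|alpha| * Cf).
Let K2 := 1 + 2 * (D * Cf).

Lemma branch_deviation c j : is_branch c ->
  `|sp (branch_word c j) - alpha * sf (branch_word c j)| <= K1 * Err j.
Proof.
move=> hc; elim: j => [|j IH].
  rewrite word0 /sp /sf !word_sum_nil mulr0 subrr normr0 mulr_ge0// /K1.
  by rewrite addr_ge0// mulr_ge0// addr_ge0// mulr_ge0.
rewrite wordS ErrS mulrDr.
have [_ _ _ /(_ _ (hc j))[_ _ h1 _]] := T_block j.
have h2 := word_sum_cat i0 (branch_word c j) (c j) (ci_psi_bd S).
have h3 := word_sum_cat i0 (branch_word c j) (c j) (ci_phi_bd S).
have h4 := ler_wpM2l (normr_ge0 alpha) h3; rewrite -normrM in h4.
move: IH h1 h2 h4; rewrite -/sp -/sf -/Cp -/Cf.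
move: (sp (_ ++ _)) (sf (_ ++ _)) (sp _) (sf _) (sp _) (sf _) => a b a1 b1 a2 b2.
have h5 : 2 * (Cp + `|alpha| * Cf) <= 2 * (Cp + `|alpha| * Cf) * (e j * (l j)%:R).
  by rewrite ler_peMr// mulr_ge0// addr_ge0// mulr_ge0.
move: h5; rewrite /K1; move: (Err j) (e j * _) => x y h5.
rewrite !ler_norml => /andP[? ?] /andP[? ?] /andP[? ?] /andP[? ?].
by apply/andP; split; lra.
Qed.

Lemma branch_entropy c j : is_branch c ->
  - (D * sf (branch_word c j)) <= Lam j + K2 * Err j.
Proof.
move=> hc; elim: j => [|j IH].
  rewrite word0 /sf word_sum_nil mulr0 oppr0 /Lam big_ord0 add0r mulr_ge0//.
  by rewrite /K2 addr_ge0// mulr_ge0// mulr_ge0// ltW.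
rewrite wordS ErrS LamS mulrDr.
have [_ _ _ /(_ _ (hc j))[_ _ _ h1]] := T_block j.
have h3 := word_sum_cat i0 (branch_word c j) (c j) (ci_phi_bd S).
have h4 := ler_wpM2l (ltW D_gt0) h3.
have h6 := ler_norm (- (D * (word_sum i0 phi (branch_word c j ++ c j) -
   word_sum i0 phi (branch_word c j) - word_sum i0 phi (c j)))).
rewrite normrN normrM (ger0_norm (ltW D_gt0)) in h6.
have h5 : 2 * (D * Cf) <= 2 * (D * Cf) * (e j * (l j)%:R).
  by rewrite ler_peMr// mulr_ge0// mulr_ge0// ltW.
have := le_trans h6 h4.
move: IH h1; rewrite -/sf -/Cf {h3 h4 h6}.
move: (sf (_ ++ _)) (sf _) (sf _) => b b1 b2.
rewrite /K2 in h5 *; lra.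
Qed.

Let block_bound : exists2 B : R, 0 <= B & forall p, `|sf p| <= B * (size p)%:R.
Proof.
have [B B0 hB] := bounded_distortion_bounded i0 (ci_phi_bd S).
by exists B => // p; exact: birkhoff_le.
Qed.

Let l_large (K : R) : exists J, forall j, (J <= j)%N -> K <= (l j)%:R.
Proof.
have K0 : 0 < `|K| + 1 by rewrite ltr_wpDl.
have iK0 : 0 < (`|K| + 1)^-1 by rewrite invr_gt0.
have [J h] := e_small iK0; exists J => j /h ej.
apply: le_trans (ler_norm K) _; apply: le_trans (_ : `|K| + 1 <= _); first by rewrite lerDl.
rewrite -[leLHS]mulr1 -ler_pdivlMl// mulrC.
apply: le_trans (el_ge1 j) _; rewrite mulrC.
by rewrite ler_wpM2r.
Qed.

Let ball_upper c j r : is_branch c -> 0 < r -> r < 1 ->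
  r < ci_c S * expR (sf (branch_word c j)) ->
  ln (M (x_ (branch_point c)) r) <= sp (branch_word c j) + (ci_C S + ln 2).
Proof.
move=> hc r0 r1 rj; set p := branch_word c j; set w := branch_point c.
(* Taken only for the positivity of the mass, which monotonicity of [ln] requires. *)
have [K _ /(_ w r r0 r1)[n [_ _ M0]]] := ball_mass_ge S.
have wp : mkseq w (size (p ++ ci_sep S)) = p ++ ci_sep S.
  have [_ _ _ /(_ _ (hc j))[_ [q qE] _ _]] := T_block j.
  have := mkseq_branch_point j.+1 hc; rewrite wordS qE catA -/p size_cat mkseqD.
  by move/eqP; rewrite eqseq_cat ?size_mkseq// => /andP[/eqP].
have /andP[h1 h2] := ci_sepP wp.
(* [ci_sup] expects two words; both are [p] here, which accounts for the [ln 2]. *)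
have hM : M (x_ w) r <= ci_mass S p + ci_mass S p.
  apply: ci_sup => v; rewrite ltr_norml => /andP[v1 v2].
  suff : mkseq v (size p) = p by left.
  have /andP[v3 v4] := ci_point S v (size p).
  apply/eqP; apply/negPn/negP => /eqP vp.
  have np : ~~ seq.prefix p (mkseq v (size p)).
    apply/negP => /seq.prefixP[q qE]; have := congr1 size qE.
    rewrite size_mkseq size_cat => /esym/eqP.
    rewrite -{2}[size p]addn0 eqn_add2l => /eqP/size0nil q0.
    by apply: vp; rewrite qE q0 cats0.
  have np' : ~~ seq.prefix (mkseq v (size p)) p.
    apply/negP => /seq.prefixP[q qE]; have := congr1 size qE.
    rewrite size_cat size_mkseq => /esym/eqP.
    rewrite -{2}[size p]addn0 eqn_add2l => /eqP/size0nil q0.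
    by apply: vp; rewrite [RHS]qE q0 cats0.
  rewrite -/sf in h1 h2.
  by have [] := ci_order S np np'; lra.
have /andP[_ h3] := ci_massP S p.
apply: (@le_trans _ _ (ln (2 * expR (sp p + ci_C S)))).
  rewrite ler_ln ?posrE ?mulr_gt0 ?expR_gt0//; apply: le_trans hM _.
  by rewrite mulr_natl mulr2n lerD.
by rewrite lnM ?posrE ?expR_gt0// expRK; lra.
Qed.

Let ball_lower c j r : is_branch c -> expR (sf (branch_word c j) + ci_C S) < r ->
  sp (branch_word c j) - ci_C S <= ln (M (x_ (branch_point c)) r).
Proof.
move=> hc hr; set p := branch_word c j; set w := branch_point c.
have /andP[h1 _] := ci_massP S p.
have hM : ci_mass S p <= M (x_ w) r.
  apply: ci_sub => v vp.
  have := ci_point S v (size p); rewrite vp.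
  have := ci_point S w (size p); rewrite (mkseq_branch_point j hc).
  have /andP[_] := ci_len S p; move: hr; rewrite -/sf -/p => ? ? /andP[? ?] /andP[? ?].
  by rewrite ltr_norml; apply/andP; split; lra.
rewrite -[leLHS]expRK ler_ln ?posrE ?expR_gt0//.
- exact: le_trans hM.
- exact: lt_le_trans (expR_gt0 _) (le_trans h1 hM).
Qed.

Lemma branch_exponent c : is_branch c -> has_exponent (x_ (branch_point c)).
Proof.
move=> hc eps eps0; set w := branch_point c.
have [B B0 hB] := block_bound.
pose a j := sf (branch_word c j); pose b j := sp (branch_word c j).
have eta0 := ci_eta_gt0 S; set eta := ci_eta S in eta0.
set CG := ci_C S; have CG0 : 0 <= CG := ci_C_ge0 S.
set c0 := ci_c S; have c0_gt0 : 0 < c0 := ci_c_gt0 S.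
have sizeN j : (size (branch_word c j))%:R = N j by rewrite size_branch_word.
have a_low j : - (B * N j) <= a j.
  by have := hB (branch_word c j); rewrite sizeN ler_norml => /andP[].
have a_up j : a j <= ci_K S - eta * N j.
  by rewrite -sizeN; exact: word_sum_decay.
have aS j : `|a j.+1 - a j - sf (c j)| <= 2 * Cf.
  rewrite addrAC /a wordS.
  have := word_sum_cat i0 (branch_word c j) (c j) (ci_phi_bd S).
  by rewrite -/sf -/Cf addrAC.
have c_low j : `|sf (c j)| <= B * (l j)%:R by rewrite -(size_block j hc).
have c_up j : sf (c j) <= ci_K S - eta * (l j)%:R.
  by rewrite -(size_block j hc); exact: word_sum_decay.
have dev j : `|b j - alpha * a j| <= K1 * Err j := branch_deviation j hc.
have K1_ge0 : 0 <= K1 by rewrite /K1 addr_ge0// mulr_ge0// addr_ge0// mulr_ge0.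
(* [E j] bounds the error made when [r] lies between the scales of the levels
   [j] and [j.+1]. *)
pose Q := CG + ln 2 + `|alpha| * (`|ln c0| + 4 * Cf).
pose E j := K1 * Err j + K1 * Err j.+2 + `|alpha| * B * (l j)%:R +
   `|alpha| * B * (l j.+1)%:R + Q.
have smallE : small E.
  have aB : 0 <= `|alpha| * B by rewrite mulr_ge0.
  apply: smallD; last exact: small_cst.
  apply: smallD; last by apply: smallZ => //; exact: small_shift small_l.
  apply: smallD; last by apply: smallZ => //; exact: small_l.
  apply: smallD; first by apply: smallZ => //; exact: small_Err.
  apply: smallZ => //.
  exact/(small_shift (small_shift small_Err)).
have d0 : 0 < eps * eta / 2 by rewrite divr_gt0// mulr_gt0.
have [J1 hJ1] := smallE _ d0.
have eta2 : 0 < eta / 2 by rewrite divr_gt0.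
have [J2 hJ2] := small_cst (ci_K S + `|ln c0|) eta2.
have [J3 hJ3] := l_large ((ci_K S + 2 * Cf + CG + 1 - ln c0) / eta).
pose J := maxn J1 (maxn J2 J3).
exists (Num.min (c0 * expR (- (B * N J))) (Num.min c0 1)).
  by rewrite !lt_min mulr_gt0 ?expR_gt0// c0_gt0 ltr01.
move=> r r0; rewrite !lt_min => /andP[rJ /andP[rc0 r1]].
have lr0 : ln r < 0 by rewrite ln_lt0// r0.
have ex : exists j, c0 * expR (a j.+1) <= r.
  near \oo => j; exists j.
  rewrite -ler_pdivlMl// -[leRHS]lnK ?posrE ?mulr_gt0 ?invr_gt0// ler_expR.
  apply: le_trans (a_up _) _; rewrite lerBlDr -lerBlDl.
  rewrite -ler_pdivrMl//; apply: le_trans (N_ge _).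
  apply: le_trans (_ : j%:R <= _); last by rewrite ler_nat.
  near: j; exact: nbhs_infty_ger.
(* Minimality places [r] between the separation scales of the levels [j.+1] and [j]. *)
have [j hj hmin] := ex_minnP ex.
have rj : r < c0 * expR (a j).
  case: j hj hmin => [|j] _ hmin; first by rewrite /a word0 /sf word_sum_nil expR0 mulr1.
  by rewrite ltNge; apply/negP => /hmin; rewrite ltnn.
have Jj : (J <= j)%N.
  rewrite leqNgt; apply/negP => jJ.
  suff : c0 * expR (- (B * N J)) <= r by rewrite leNgt rJ.
  apply: le_trans hj; rewrite ler_pM2l// ler_expR; apply: le_trans (a_low _).
  by rewrite lerN2 ler_wpM2l// N_mono.
move: Jj; rewrite /J !geq_max => /and3P[j1 j2 j3].
have lnr_up : ln r < ln c0 + a j.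
  by rewrite -[a j]expRK -lnM ?posrE ?expR_gt0// ltr_ln ?posrE ?mulr_gt0 ?expR_gt0.
have lnr_low : ln c0 + a j.+1 <= ln r.
  by rewrite -[a _]expRK -lnM ?posrE ?expR_gt0// ler_ln ?posrE ?mulr_gt0 ?expR_gt0.
have hup := ball_upper hc r0 r1 rj.
(* The interval of level [j.+1] may still be longer than [r] by a constant factor. One more block,
   long by the choice of [J3], makes up for that factor. *)
have hlow : b j.+2 - CG <= ln (M (x_ w) r).
  apply: (ball_lower (j := j.+2) hc).
  rewrite -[ltRHS]lnK ?posrE// ltr_expR -/CG -/(a _).
  have := aS j.+1; have := c_up j.+1.
  have := hJ3 j.+1 (leqW j3); rewrite ler_pdivrMr// => h1 h2.
  rewrite ler_norml => /andP[_ h3].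
  lra.
rewrite -/w -/(b j) -/CG in hup.
have tri k : `|a k.+1 - a k| <= B * (l k)%:R + 2 * Cf.
  have := ler_normD (a k.+1 - a k - sf (c k)) (sf (c k)); rewrite subrK => h.
  by apply: le_trans h _; rewrite addrC lerD.
have err : `|ln (M (x_ w) r) - alpha * ln r| <= E j.
  have t1 := tri j; have t2 := tri j.+1.
  have lc0 := ler_norm (ln c0); have lc0' := ler_norm (- ln c0).
  rewrite normrN in lc0'.
  have e1 : `|a j - ln r| <= B * (l j)%:R + 2 * Cf + `|ln c0|.
    move: t1; rewrite !ler_norml => /andP[? ?].
    by apply/andP; split; lra.
  have e2 : `|a j.+2 - ln r| <= B * (l j)%:R + B * (l j.+1)%:R + 4 * Cf + `|ln c0|.
    move: t1 t2; rewrite !ler_norml => /andP[? ?] /andP[? ?].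
    by apply/andP; split; lra.
  have f1 : `|alpha * (a j - ln r)| <= `|alpha| * (B * (l j)%:R + 2 * Cf + `|ln c0|).
    by rewrite normrM ler_wpM2l.
  have f2 : `|alpha * (a j.+2 - ln r)| <=
     `|alpha| * (B * (l j)%:R + B * (l j.+1)%:R + 4 * Cf + `|ln c0|).
    by rewrite normrM ler_wpM2l.
  have g1 := dev j; have g2 := dev j.+2.
  have p1 : 0 <= K1 * Err j by rewrite mulr_ge0.
  have p2 : 0 <= K1 * Err j.+2 by rewrite mulr_ge0.
  have p3 : 0 <= `|alpha| * B * (l j.+1)%:R by rewrite !mulr_ge0.
  have p4 : 0 <= `|alpha| * Cf by rewrite mulr_ge0.
  have ln2 : 0 <= ln 2 :> R by rewrite ln_ge0// ler1n.
  move: g1 g2 f1 f2; rewrite /E /Q !ler_norml.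
  move=> /andP[? ?] /andP[? ?] /andP[? ?] /andP[? ?].
  by apply/andP; split; lra.
have lnr : eta / 2 * N j <= - ln r.
  have := a_up j; have := hJ2 j j2; have := ler_norm (ln c0).
  by move: lnr_up; lra.
have -> : ln (M (x_ w) r) / ln r - alpha = (ln (M (x_ w) r) - alpha * ln r) / ln r.
  by rewrite mulrBl mulfK// lt_eqF.
rewrite normrM normfV (ltr0_norm lr0) ler_pdivrMr ?oppr_gt0//.
apply: le_trans err _; apply: le_trans (hJ1 j j1) _.
by have := ler_wpM2l (ltW eps0) lnr; lra.
Unshelve. all: by end_near. Qed.

Let T_uniq j : uniq (T j). Proof. by have [] := T_block j. Qed.
Let T_neq0 j : T j != [::]. Proof. by have [] := T_block j. Qed.

Let size_T_gt0 j : 0 < (size (T j))%:R :> R.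
Proof. by rewrite ltr0n lt0n size_eq0. Qed.

Let ln_size_T j : ln (size (T j))%:R <= (l j)%:R * ln #|I|%:R :> R.
Proof.
have I0 : 0 < #|I|%:R :> R by rewrite ltr0n; apply/card_gt0P; exists i0.
rewrite mulr_natl -lnXn// -natrX ler_ln ?posrE// ?ltr0n ?expn_gt0 -?(ltr0n R) ?I0//.
rewrite ler_nat -(card_tuple (l j) I) cardE -(size_map val).
apply: uniq_leq_size => // p pT; apply/mapP.
have [_ _ _ /(_ _ pT)[pl _ _ _]] := T_block j.
by exists (Tuple (introT eqP pl)); rewrite ?mem_enum.
Qed.

Let node_massE j : node_mass R T j = expR (- Lam j).
Proof.
rewrite /node_mass /Lam -sumrN expR_sum; apply: eq_bigr => i _.
by rewrite expRN lnK ?posrE.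
Qed.

Let branch0 : is_branch (fun j => head [::] (T j)).
Proof. by move=> j; have := T_neq0 j; case: (T j) => //= p ps _; rewrite mem_head. Qed.

(** [Lam] is the same for all branches, so the entropy bound along one branch suffices; [D > 0]
    turns the decay of its intervals into growth. *)
Let Lam_large : exists2 kappa : R, 0 < kappa &
  exists J, forall j, (J <= j)%N -> kappa * N j <= Lam j.
Proof.
have eta0 := ci_eta_gt0 S.
have k0 : 0 < D * ci_eta S / 2 by rewrite divr_gt0// mulr_gt0.
exists (D * ci_eta S / 2) => //.
have K20 : 0 <= K2 by rewrite /K2 addr_ge0// mulr_ge0// mulr_ge0// ltW.
have h : small (fun j => D * `|ci_K S| + K2 * Err j).
  by apply: smallD; [exact: small_cst | apply: smallZ].
have [J hJ] := h _ k0; exists J => j /hJ hj.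
have := branch_entropy j branch0.
have := word_sum_decay S (branch_word (fun j => head [::] (T j)) j).
rewrite size_branch_word// -/sf -/(N j) => /(ler_wpM2l (ltW D_gt0)) h1 h2.
have := ler_wpM2l (ltW D_gt0) (ler_norm (ci_K S)).
lra.
Qed.

Let flatten_inj c c' j : is_branch c -> is_branch c' ->
  branch_word c j = branch_word c' j -> mkseq c j = mkseq c' j.
Proof.
move=> hc hc'; rewrite /branch_word => cc.
rewrite -(flattenK (mkseq c j)) -(flattenK (mkseq c' j)) cc; congr reshape.
by rewrite /shape /mkseq -!map_comp; apply: eq_map => i /=; rewrite !size_block.
Qed.

Let cover_nodes (C : set R) (d : R) j :
  (forall y z, C y -> C z -> `|y - z| <= d) ->
  (forall c, is_branch c ->
     d < ci_hi S (branch_word c j) - ci_lo S (branch_word c j)) ->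
  exists q : bool -> seq (seq I), (forall b, size (q b) = j) /\
  forall c, is_branch c -> C (x_ (branch_point c)) -> exists b, mkseq c j = q b.
Proof.
move=> hC hd.
pose P := [set v | exists c, [/\ is_branch c, C (x_ (branch_point c)) & v = mkseq c j]].
have [P0|nP] := pselect (P !=set0); last first.
  (* No branch point lies in [C], so any sequences of length [j] do. *)
  exists (fun=> nseq j [::]); split => [_|c hc cC]; first by rewrite size_nseq.
  by exfalso; apply: nP; exists (mkseq c j), c.
have [|||//|//|q1 [q2 [[c1 [_ _ q1E]] [c2 [_ _ q2E]] hP]]] := @at_most_two_intervals R _ P
   (fun v => ci_lo S (flatten v)) (fun v => ci_hi S (flatten v)) C d.
- move=> _ _ [c [hc _ ->]] [c' [hc' _ ->]] cc'.
  have np b b' : is_branch b -> is_branch b' -> mkseq b j <> mkseq b' j ->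
      ~~ seq.prefix (flatten (mkseq b j)) (flatten (mkseq b' j)).
    move=> hb hb' bb; apply/negP => /seq.prefixP[q qE]; have := congr1 size qE.
    rewrite size_cat !size_branch_word// => /esym/eqP.
    rewrite -{2}[total_length l j]addn0 eqn_add2l => /eqP/size0nil q0.
    by apply: bb; apply: flatten_inj => //; rewrite /branch_word qE q0 cats0.
  apply: (ci_order S); apply: np => //; exact: nesym.
- by move=> _ [c [hc _ ->]]; exact: hd.
- move=> _ [c [hc cC ->]]; exists (x_ (branch_point c)) => //.
  have := ci_point S (branch_point c) (size (branch_word c j)).
  by rewrite mkseq_branch_point.
exists (fun b => if b then q1 else q2); split.
  by case; rewrite ?q1E ?q2E size_mkseq.
move=> c hc cC; have [|->|->] := hP (mkseq c j); first by exists c.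
- by exists true.
- by exists false.
Qed.

Lemma branch_measure s : 0 <= s -> s < D ->
  hausdorff_measure s [set x_ (branch_point c) | c in is_branch] <> 0%E.
Proof.
move=> s0 sD.
(* The gap between [s1] and [D] absorbs the errors in the entropy ([len]); the gap between [s] and
   [s1] absorbs the passage from one level to the next ([Lam_step]). *)
pose s1 := (s + D) / 2.
have ss1 : s < s1 by rewrite /s1; lra.
have s1D : s1 < D by rewrite /s1; lra.
have s1_gt0 : 0 < s1 by exact: le_lt_trans ss1.
have [kappa k0 [J1 hJ1]] := Lam_large.
have K20 : 0 <= K2 by rewrite /K2 addr_ge0// mulr_ge0// mulr_ge0// ltW.
have d1 : 0 < kappa * (D - s1) / s1 by rewrite divr_gt0// mulr_gt0// subr_gt0.
have [J2 hJ2] : exists J, forall j, (J <= j)%N ->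
    D * (ci_C S + 1) + K2 * Err j <= kappa * (D - s1) / s1 * N j.
  have h : small (fun j => D * (ci_C S + 1) + K2 * Err j).
    by apply: smallD; [exact: small_cst | apply: smallZ].
  exact: h.
have lI : 0 <= ln #|I|%:R :> R.
  by rewrite ln_ge0// ler1n; apply/card_gt0P; exists i0.
have d2 : 0 < (s1 - s) * kappa by rewrite mulr_gt0// subr_gt0.
have [J3 hJ3] : exists J, forall j, (J <= j)%N ->
    (s * ln #|I|%:R) * (l j)%:R <= (s1 - s) * kappa * N j.
  have h : small (fun j => (s * ln #|I|%:R) * (l j)%:R).
    by apply: smallZ => //; rewrite mulr_ge0.
  exact: h.
pose J := maxn J1 (maxn J2 J3).
have len j c : (J <= j)%N -> is_branch c ->
    expR (- (Lam j / s1)) < ci_hi S (branch_word c j) - ci_lo S (branch_word c j).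
  rewrite /J !geq_max => /and3P[/hJ1 j1 /hJ2 j2 _] hc.
  have /andP[h1 _] := ci_len S (branch_word c j).
  apply: lt_le_trans h1; rewrite ltr_expR -/sf.
  have h2 := branch_entropy j hc.
  have h3 : kappa * (D - s1) / s1 * N j <= (D - s1) / s1 * Lam j.
    have -> : kappa * (D - s1) / s1 * N j = (D - s1) / s1 * (kappa * N j) by ring.
    by rewrite ler_pM2l// divr_gt0// subr_gt0.
  have h4 : (D - s1) / s1 * Lam j = D * (Lam j / s1) - Lam j by field; rewrite gt_eqF.
  suff : D * (- (Lam j / s1)) < D * (sf (branch_word c j) - ci_C S) by rewrite ltr_pM2l.
  by lra.
have Lam_step j : (J <= j)%N -> s * Lam j.+1 <= s1 * Lam j.
  rewrite /J !geq_max => /and3P[/hJ1 j1 _ /hJ3 j3].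
  rewrite LamS; have := ler_wpM2l s0 (ln_size_T j).
  have : (s1 - s) * (kappa * N j) <= (s1 - s) * Lam j by rewrite ler_pM2l// subr_gt0.
  lra.
have Lam_inf y j0 : exists2 j, (j0 <= j)%N & y <= Lam j.
  near \oo => j; exists j; first by near: j; exists j0.
  have Jj : (J1 <= j)%N by near: j; exists J1.
  apply: le_trans (hJ1 j Jj); rewrite -ler_pdivrMl//; apply: le_trans (N_ge j).
  near: j; exact: nbhs_infty_ger.
pose delta := expR (- (Lam J / s1)).
have cover (C : set R) (eta : R) : 0 < eta -> (diam C <= delta%:E)%E ->
    exists q : bool -> seq (seq I),
    (forall c, is_branch c -> C (x_ (branch_point c)) ->
       exists b, mkseq c (size (q b)) = q b) /\
    (forall b, (node_mass R T (size (q b)))%:E <= diam_pow s C + eta%:E)%E.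
  move=> e0 dC.
  have finish (d : R) j : (J <= j)%N -> d <= expR (- (Lam j / s1)) ->
      (forall y z, C y -> C z -> `|y - z| <= d) ->
      ((expR (- Lam j))%:E <= diam_pow s C + eta%:E)%E ->
      exists q : bool -> seq (seq I),
      (forall c, is_branch c -> C (x_ (branch_point c)) ->
         exists b, mkseq c (size (q b)) = q b) /\
      (forall b, (node_mass R T (size (q b)))%:E <= diam_pow s C + eta%:E)%E.
    move=> Jj dj hd hm.
    have [|q [qj hq]] := cover_nodes hd (j := j).
      by move=> c hc; exact: le_lt_trans dj (len j c Jj hc).
    exists q; split => [c hc cC|b]; last by rewrite qj node_massE.
    by have [b cb] := hq c hc cC; exists b; rewrite qj.
  (* A set that is empty or has diameter 0 may have weight 0; its nodes are then taken so deep that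
     their mass is at most [eta]. *)
  have [C0|/set0P[x0 Cx0]] := eqVneq C set0.
    have [j Jj hj] := Lam_inf (- ln eta) J.
    apply: (finish 0 j Jj); first exact: expR_ge0.
      by rewrite C0.
    rewrite /diam_pow C0 eqxx add0e lee_fin.
    by rewrite -[leRHS]lnK ?posrE// ler_expR lerNl.
  have dfin : diam C \is a fin_num.
    rewrite ge0_fin_numE; first exact: le_lt_trans dC (ltry _).
    apply: le_trans (_ : (`|x0 - x0|%:E <= _)%E); first by rewrite lee_fin.
    by apply: ereal_sup_ubound; exists (x0, x0).
  have [d dE] : exists d, diam C = d%:E by exists (fine (diam C)); rewrite fineK.
  have hd y z : C y -> C z -> `|y - z| <= d by apply: le_diam; rewrite dE.
  have d_ge0 : 0 <= d by have := hd _ _ Cx0 Cx0; rewrite subrr normr0.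
  have powE : diam_pow s C = (d `^ s)%:E by apply: diam_powE => //; exists x0.
  have [d0|d0] := eqVneq d 0.
    have [j Jj hj] := Lam_inf (- ln eta) J.
    apply: (finish d j Jj) => //; first by rewrite d0 expR_ge0.
    rewrite powE -EFinD lee_fin ler_wpDl ?powR_ge0//.
    by rewrite -[leRHS]lnK ?posrE// ler_expR lerNl.
  have d_gt0 : 0 < d by rewrite lt_neqAle eq_sym d0.
  have ex : exists j, (J <= j)%N && (expR (- (Lam j.+1 / s1)) <= d).
    have [j Jj hj] := Lam_inf (- ln d * s1) J.+1.
    case: j Jj hj => // j Jj hj; exists j; rewrite -ltnS Jj /=.
    by rewrite -[leRHS]lnK ?posrE// ler_expR lerNl ler_pdivlMr.
  (* By minimality, or by [dC] if [j = J], the scale of level [j] is at least [d], so two nodes of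
     that level suffice. *)
  have [j /andP[Jj hj] hmin] := ex_minnP ex.
  apply: (finish d j Jj) => //.
    case: (ltnP J j) => [Jj'|jJ]; last first.
      have -> : j = J by apply/eqP; rewrite eqn_leq jJ.
      by rewrite -lee_fin -dE.
    case: j Jj' {Jj} hj hmin => // j Jj' hj hmin.
    rewrite leNgt; apply/negP => /ltW h.
    by have := hmin j; rewrite -ltnS Jj' h ltnn => /(_ isT).
  rewrite powE -EFinD lee_fin ler_wpDr// ?(ltW e0)//.
  rewrite /powR (negbTE d0) ler_expR.
  have : - (Lam j.+1 / s1) <= ln d.
    by rewrite -[leLHS]expRK ler_ln ?posrE ?expR_gt0.
  move=> /(ler_wpM2l s0); apply: le_trans.
  rewrite mulrN lerN2 mulrA ler_pdivrMr// [Lam j * _]mulrC.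
  exact: Lam_step.
(* Two nodes per set and errors [eta n] of total at most 1/8 give the nodes a mass below 2 * (1/8 +
   1/8), which is less than the 1 demanded by [kraft]. *)
apply: (@hausdorff_measure_neq0 _ _ _ delta (8^-1)); rewrite ?expR_gt0 ?invr_gt0//.
move=> C hA hC; rewrite leNgt; apply/negP => hlt.
pose eta n : R := 8^-1 / (2 ^ n.+1)%:R.
have eta_gt0 n : 0 < eta n by rewrite divr_gt0 ?invr_gt0// ltr0n expn_gt0.
have /choice[q hq] : forall n, exists q : bool -> seq (seq I),
    (forall c, is_branch c -> C n (x_ (branch_point c)) ->
       exists b, mkseq c (size (q b)) = q b) /\
    (forall b, (node_mass R T (size (q b)))%:E <= diam_pow s (C n) + (eta n)%:E)%E.
  by move=> n; exact: cover.
have := @kraft R _ T T_uniq T_neq0 q _; rewrite leNgt => /(_ _)/negP; apply.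
  move=> c hc; have [n _ cn] : (\bigcup_n C n) (x_ (branch_point c)).
    by apply: hA; exists c.
  by have [b hb] := (hq n).1 c hc cn; exists n, b.
apply: (@le_lt_trans _ _ (\sum_(0 <= n <oo) (2%:E * (diam_pow s (C n) + (eta n)%:E)))%E).
  apply: lee_nneseries => [n _ _|n _].
    by rewrite lee_fin sumr_ge0// => b _; exact/ltW/node_mass_gt0.
  rewrite big_bool EFinD mule_natl mule2n leeD//; exact: (hq n).2.
rewrite nneseriesZl; last first.
  by move=> n _; rewrite adde_ge0 ?diam_pow_ge0// lee_fin ltW.
apply: (@le_lt_trans _ _ (2%:E * (\sum_(0 <= n <oo) diam_pow s (C n) + (8^-1)%:E))%E).
  rewrite lee_wpmul2l// ?lee_fin//.
  apply: (@epsilon_trick R (fun n => diam_pow s (C n)) (8^-1) xpredT).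
    by move=> n; exact: diam_pow_ge0.
  by rewrite invr_ge0.
have [S' SE] : exists S' : R, (\sum_(0 <= n <oo) diam_pow s (C n) = S'%:E)%E.
  exists (fine (\sum_(0 <= n <oo) diam_pow s (C n))%E); rewrite fineK//.
  rewrite ge0_fin_numE; first exact: lt_trans hlt (ltry _).
  by apply: nneseries_ge0 => n _ _; exact: diam_pow_ge0.
rewrite SE -EFinD -EFinM lte_fin; move: hlt; rewrite SE lte_fin; lra.
Unshelve. all: by end_near. Qed.

End Branches.

Lemma has_exponent_dim : (forall e, 0 < e -> exists L T, is_block e L T) ->
  (D%:E <= hausdorff_dim [set x | exists w, x = x_ w /\ has_exponent x])%E.
Proof.
move=> /block_sequence[e [l [T [h1 h2 h3 h4]]]].
apply: le_trans (_ : hausdorff_dim [set x_ (branch_point c) | c in is_branch T] <= _)%E; last first.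
  apply: hausdorff_dimS => _ [c hc <-]; exists (branch_point c); split => //.
  exact: branch_exponent hc.
by apply: hausdorff_dim_ge => s s0 sD; exact: branch_measure sD.
Qed.

End LowerBound.

(** * Geometry of the iterated function system *)

Section Geometry.
Variables (R : realType) (I : finType) (i0 : I) (Phi : conformal_ifs R I).
Let X := ifs_set Phi.
Let f := ifs_map Phi.
Let V := ifs_nbhd Phi.
Let df i := derive1 (f i).
Variable U : set R.
Hypothesis U_itv : is_interval U.
Hypothesis UX0 : U `&` X !=set0.
Hypothesis UV : forall i, U `<=` V i.
Hypothesis fU : forall i, f i @` U `<=` U.
Hypothesis f_disj : forall i j, i != j -> f i @` U `&` f j @` U = set0.

Lemma ifs_set_closed y : (forall e, 0 < e -> exists2 x, X x & `|y - x| < e) -> X y.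
Proof.
move=> h; have cX : closed X.
  by apply: compact_closed; [exact: Rhausdorff | exact: ifs_compact].
apply: cX => B /nbhs_ballP[e /= e0 eB].
by have [x Xx yx] := h e e0; exists x; split => //; apply: eB.
Qed.

Lemma ifs_set_bounded : exists2 B : R, 0 < B & forall x, X x -> `|x| <= B.
Proof.
by have /pinfty_ex_gt0[B B0 hB] := compact_bounded (@ifs_compact _ _ Phi); exists B.
Qed.

Lemma contraction_ratio : exists c : R, [/\ 0 <= c, c < 1 &
  forall i x y, X x -> X y -> `|f i x - f i y| <= c * `|x - y|].
Proof.
have [c c1 hc] := ifs_contract Phi; exists (Num.max c 0); split.
- by rewrite le_max lexx orbT.
- by rewrite gt_max c1 ltr01.
- move=> i x y Xx Xy; apply: le_trans (hc i x y Xx Xy) _.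
  by rewrite ler_wpM2r// le_max lexx.
Qed.

Let E := X `&` U.
(** The end points of [U] may lie outside the domains of the maps. Those of the hull of X cap U
    belong to the compact set X, where the maps contract and have positive derivative. *)
Definition hull_inf := inf E.
Definition hull_sup := sup E.
Let a := hull_inf.
Let b := hull_sup.

Let hasE : has_inf E /\ has_sup E.
Proof.
have [B B0 hB] := ifs_set_bounded.
have [x [Ux Xx]] := UX0.
split; split; [by exists x| |by exists x|].
- by exists (- B) => y [/hB]; rewrite ler_norml => /andP[].
- by exists B => y [/hB]; rewrite ler_norml => /andP[].
Qed.

Let E_le y : E y -> a <= y <= b.
Proof.
move=> Ey; apply/andP; split.
  by apply: ge_inf => //; exact: hasE.1.2.
by apply: ub_le_sup => //; exact: hasE.2.2.
Qed.

Let inf_approx e : 0 < e -> exists2 x, E x & x < a + e.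
Proof. by move=> e0; exact: inf_adherent e0 hasE.1. Qed.

Let sup_approx e : 0 < e -> exists2 x, E x & b - e < x.
Proof. by move=> e0; exact: sup_adherent e0 hasE.2. Qed.

Lemma hull_inf_in : X a.
Proof.
apply: ifs_set_closed => e e0; have [x Ex xe] := inf_approx e0.
exists x; first exact: Ex.1.
by have /andP[h _] := E_le Ex; rewrite distrC ger0_norm; lra.
Qed.

Lemma hull_sup_in : X b.
Proof.
apply: ifs_set_closed => e e0; have [x Ex xe] := sup_approx e0.
exists x; first exact: Ex.1.
by have /andP[_ h] := E_le Ex; rewrite ger0_norm; lra.
Qed.

Lemma hull_le : a <= b.
Proof.
have [x [Ux Xx]] := UX0; have /andP[h1 h2] := E_le (conj Xx Ux).
exact: le_trans h2.
Qed.

Lemma hull_open y : a < y < b -> U y.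
Proof.
move=> /andP[ay yb].
have e1 : 0 < y - a by lra.
have e2 : 0 < b - y by lra.
have [x1 [_ U1] h1] := inf_approx e1.
have [x2 [_ U2] h2] := sup_approx e2.
by apply: (U_itv U1 U2); apply/andP; split; lra.
Qed.

Lemma hull_nbhd i y : a <= y <= b -> V i y.
Proof.
move=> /andP[ay yb].
have [->|ya] := eqVneq y a; first exact/ifs_nbhd_sub/hull_inf_in.
have [->|yb'] := eqVneq y b; first exact/ifs_nbhd_sub/hull_sup_in.
apply/UV/hull_open; rewrite lt_neqAle eq_sym ya ay /=.
by rewrite lt_neqAle yb' yb.
Qed.

(** [a] need not lie in [U], but a point of X cap U closer to [a] than the supposed gap would be
    sent by the contraction to a point of X cap U left of [a]. *)
Lemma hull_stable_inf i : a <= f i a.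
Proof.
have [c [c0 c1 hc]] := contraction_ratio.
rewrite leNgt; apply/negP => fa.
have e0 : 0 < a - f i a by lra.
have [x [Xx Ux] xe] := inf_approx e0.
have Efx : E (f i x) by split; [exact: ifs_stable | apply: fU; exists x].
have := hc i x a Xx hull_inf_in.
have /andP[h1 _] := E_le Efx; have /andP[h2 _] := E_le (conj Xx Ux).
have h3 : c * `|x - a| <= `|x - a| by rewrite ler_piMl// ltW.
rewrite (ger0_norm (_ : 0 <= x - a)) ?subr_ge0// in h3 *.
have := ler_norm (f i x - f i a); lra.
Qed.

Lemma hull_stable_sup i : f i b <= b.
Proof.
have [c [c0 c1 hc]] := contraction_ratio.
rewrite leNgt; apply/negP => fb.
have e0 : 0 < f i b - b by lra.
have [x [Xx Ux] xe] := sup_approx e0.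
have Efx : E (f i x) by split; [exact: ifs_stable | apply: fU; exists x].
have := hc i b x hull_sup_in Xx.
have /andP[_ h1] := E_le Efx; have /andP[_ h2] := E_le (conj Xx Ux).
have h3 : c * `|b - x| <= `|b - x| by rewrite ler_piMl// ltW.
rewrite (ger0_norm (_ : 0 <= b - x)) ?subr_ge0// in h3 *.
have := ler_norm (f i b - f i x); lra.
Qed.

Lemma ifs_derivable i y : V i y -> derivable (f i) y 1 /\ {for y, continuous (df i)}.
Proof.
have [e e0 he] := ifs_diffeo Phi; have [[h _] _] := he i.
exact: h.
Qed.

Lemma derivative_neq0 i y : V i y -> df i y != 0.
Proof.
move=> Vy; have [e e0 he] := ifs_diffeo Phi; have [_ [g [gf dg]]] := he i.
have [dfy _] := ifs_derivable Vy.
have [dgy _] := dg (f i y) (ex_intro2 _ _ y Vy erefl).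
have := derive1_comp dfy dgy.
have -> : derive1 (g \o f i) y = 1.
  rewrite derive1E -[RHS](@derive_id _ _ y (1 : R)); apply: near_eq_derive.
  have := open_nbhs_nbhs (conj (@ifs_nbhd_open _ _ Phi i) Vy).
  by apply: filterS => z Vz /=; rewrite gf.
move=> h; apply/eqP => d0; move: h; rewrite -/(df i y) d0 mulr0.
by move/eqP; rewrite oner_eq0.
Qed.

Lemma derivative_continuous i y z : a <= y -> z <= b ->
  {within `[y, z], continuous (df i)}.
Proof.
move=> ay zb; apply: continuous_in_subspaceT => t; rewrite inE /= in_itv /= => /andP[yt tz].
apply: (ifs_derivable (i := i) _).2; apply: hull_nbhd.
by rewrite (le_trans ay yt) (le_trans tz zb).
Qed.

(** Positivity is given on X only. The differentiable inverse excludes zeros of the derivative on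
    the hull, so its sign at [a] persists. *)
Lemma derivative_gt0 i y : a <= y <= b -> 0 < df i y.
Proof.
move=> /andP[ay yb]; rewrite ltNge; apply/negP => dy.
have da : 0 < df i a := ifs_deriv_gt0 i hull_inf_in.
have [||z] := @IVT R (df i) a y 0 ay.
- exact: derivative_continuous.
- by rewrite ge_min dy orbT le_max (ltW da).
- rewrite in_itv /= => /andP[az zy] dz.
  have /eqP := dz; apply/negP; apply: derivative_neq0; apply: hull_nbhd.
  by rewrite az (le_trans zy yb).
Qed.

Lemma branch_mvt i y z : a <= y -> y < z -> z <= b ->
  exists x, [/\ y <= x, x <= z & f i z - f i y = df i x * (z - y)].
Proof.
move=> ay yz zb.
have ft x : y <= x <= z -> derivable (f i) x 1.
  move=> /andP[yx xz]; apply: (ifs_derivable (i := i) _).1; apply: hull_nbhd.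
  by rewrite (le_trans ay yx) (le_trans xz zb).
have [||x xyz fE] := @MVT R (f i) (df i) y z yz.
- move=> x; rewrite in_itv /= => /andP[/ltW yx /ltW xz].
  by rewrite /df derive1E; apply: derivableP; apply: ft; rewrite yx xz.
- by apply: derivable_within_continuous => x; rewrite in_itv /=; exact: ft.
- by exists x; move: xyz; rewrite in_itv /= => /andP[/ltW ? /ltW ?].
Qed.

Lemma branch_lt i y z : a <= y -> y < z -> z <= b -> f i y < f i z.
Proof.
move=> ay yz zb; have [x [yx xz fE]] := branch_mvt i ay yz zb.
rewrite -subr_gt0 fE mulr_gt0 ?subr_gt0// derivative_gt0//.
by rewrite (le_trans ay yx) (le_trans xz zb).
Qed.

Lemma branch_le i y z : a <= y -> y <= z -> z <= b -> f i y <= f i z.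
Proof.
move=> ay; rewrite le_eqVlt => /orP[/eqP ->//|yz] zb.
exact/ltW/branch_lt.
Qed.

Lemma branch_hull i y : a <= y <= b -> a <= f i y <= b.
Proof.
move=> /andP[ay yb]; apply/andP; split.
  by apply: le_trans (hull_stable_inf i) _; exact: branch_le.
by apply: le_trans (hull_stable_sup i); exact: branch_le.
Qed.

Lemma log_derivative_holder : exists H e : R, [/\ 0 <= H, 0 < e &
  forall i x y, a <= x <= b -> a <= y <= b ->
    `|ln (df i x) - ln (df i y)| <= H * `|x - y| `^ e].
Proof.
have [e e0 he] := ifs_diffeo Phi.
have hi i : exists H : R, 0 <= H /\ forall x y, a <= x <= b -> a <= y <= b ->
    `|ln (df i x) - ln (df i y)| <= H * `|x - y| `^ e.
  have [[_ [C hC]] _] := he i.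
  have [|m mab hm] := @EVT_min R (df i) a b hull_le.
    exact: derivative_continuous.
  have m0 : 0 < df i m by apply: derivative_gt0; move: mab; rewrite in_itv.
  exists (`|C| / df i m); split; first by rewrite divr_ge0// ltW.
  have key x y : a <= x <= b -> a <= y <= b ->
      ln (df i x) - ln (df i y) <= `|C| / df i m * `|x - y| `^ e.
    move=> xab yab.
    have x0 := derivative_gt0 i xab; have y0 := derivative_gt0 i yab.
    rewrite -ln_div ?posrE//.
    have -> : df i x / df i y = 1 + (df i x - df i y) / df i y.
      by field; rewrite gt_eqF.
    apply: le_trans (le_ln1Dx _) _.
      have -> : (df i x - df i y) / df i y = df i x / df i y - 1 by field; rewrite gt_eqF.
      by rewrite ltrBrDl subrr divr_gt0.
    rewrite ler_pdivrMr//.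
    apply: le_trans (_ : `|C| * `|x - y| `^ e <= _).
      apply: le_trans (ler_norm _) _.
      apply: le_trans (hC x y (hull_nbhd i xab) (hull_nbhd i yab)) _.
      by rewrite ler_wpM2r ?powR_ge0// ler_norm.
    rewrite [leRHS](_ : _ = (`|C| * `|x - y| `^ e) * (df i y / df i m)); last by ring.
    rewrite ler_peMr ?mulr_ge0 ?powR_ge0//.
    by rewrite ler_pdivlMr// mul1r hm// in_itv.
  move=> x y xab yab; rewrite ler_norml; apply/andP; split; last exact: key.
  by rewrite lerNl opprB distrC key.
have /choice[H hH] := hi.
exists (\sum_i H i), e; split => //.
  by apply: sumr_ge0 => i _; exact: (hH i).1.
move=> i x y xab yab; apply: le_trans ((hH i).2 x y xab yab) _.
rewrite ler_wpM2r ?powR_ge0// (bigD1 i)//= lerDl.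
by apply: sumr_ge0 => j _; exact: (hH j).1.
Qed.

(** A hull reduced to a point would be fixed by all maps, against the disjointness of the images of
    [U]. *)
Lemma hull_lt (i j : I) : i != j -> a < b.
Proof.
move=> ij; rewrite lt_neqAle hull_le andbT; apply/eqP => abE.
have [x [Ux Xx]] := UX0.
have ax : x = a.
  by have /andP[h3 h4] := E_le (conj Xx Ux); apply/eqP; rewrite eq_le h3 abE h4.
have fx k : f k x = x.
  apply/eqP; rewrite eq_le ax; apply/andP; split; last exact: hull_stable_inf.
  by rewrite abE; exact: hull_stable_sup.
have : (f i @` U `&` f j @` U) x by split; exists x.
by rewrite (f_disj ij).
Qed.

(** If the two images overlapped, the midpoint [v] of the overlap would be attained by both maps
    inside the open hull, which lies in [U]. *)
Lemma branch_order (i j : I) : i != j -> f i b <= f j a \/ f j b <= f i a.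
Proof.
move=> ij; have [|h1] := leP (f i b) (f j a); first by left.
have [|h2] := leP (f j b) (f i a); first by right.
exfalso.
have ab := hull_lt ij.
have hi := branch_lt i (lexx a) ab (lexx b).
have hj := branch_lt j (lexx a) ab (lexx b).
pose m1 := Num.max (f i a) (f j a); pose m2 := Num.min (f i b) (f j b).
have m12 : m1 < m2 by rewrite /m1 /m2 lt_min !gt_max hi hj h1 h2.
pose v := (m1 + m2) / 2.
have v1 : m1 < v by rewrite /v; lra.
have v2 : v < m2 by rewrite /v; lra.
have hit k : f k a <= m1 -> m2 <= f k b -> (f k @` U) v.
  move=> k1 k2.
  have kv : f k a < v by exact: le_lt_trans v1.
  have vk : v < f k b by exact: lt_le_trans k2.
  have [||z] := @IVT R (f k) a b v hull_le.
  - apply: derivable_within_continuous => x; rewrite in_itv /= => xab.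
    by apply: (ifs_derivable (i := k) _).1; exact: hull_nbhd.
  - by rewrite ge_min (ltW kv) le_max (ltW vk) orbT.
  - rewrite in_itv /= => /andP[az zb] fz; exists z => //; apply: hull_open.
    rewrite !lt_neqAle az zb !andbT; apply/andP; split; apply/eqP => zE.
      by move: kv; rewrite zE fz ltxx.
    by move: vk; rewrite -zE fz ltxx.
have : (f i @` U `&` f j @` U) v.
  by split; apply: hit; rewrite /m1 /m2 ?le_max ?ge_min lexx ?orbT.
by rewrite (f_disj ij).
Qed.

Definition word_map (p : seq I) (x : R) : R := foldr f x p.

Lemma word_map_cat p q x : word_map (p ++ q) x = word_map p (word_map q x).
Proof. by rewrite /word_map foldr_cat. Qed.

Lemma ifs_compE w n x : ifs_comp Phi w n x = word_map (mkseq w n) x.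
Proof.
by elim: n x => // n IH x; rewrite mkseqS -cats1 word_map_cat -IH.
Qed.

Lemma word_map_in p x : X x -> X (word_map p x).
Proof. by move=> Xx; elim: p => //= i p IH; exact: ifs_stable. Qed.

Lemma word_map_hull p x : a <= x <= b -> a <= word_map p x <= b.
Proof. by move=> xab; elim: p => //= i p IH; exact: branch_hull. Qed.

Lemma word_map_lt p x y : a <= x -> x < y -> y <= b -> word_map p x < word_map p y.
Proof.
move=> ax xy yb.
have hx : a <= x <= b by rewrite ax ltW// (lt_le_trans xy).
have hy : a <= y <= b by rewrite yb ltW// (le_lt_trans ax).
elim: p => //= i p IH; apply: branch_lt => //.
  by have /andP[] := word_map_hull p hx.
by have /andP[] := word_map_hull p hy.
Qed.

Lemma word_map_le p x y : a <= x -> x <= y -> y <= b -> word_map p x <= word_map p y.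
Proof.
move=> ax; rewrite le_eqVlt => /orP[/eqP ->//|xy] yb.
exact/ltW/word_map_lt.
Qed.

Lemma word_map_contract (c : R) p x y : 0 <= c ->
  (forall i x y, X x -> X y -> `|f i x - f i y| <= c * `|x - y|) ->
  X x -> X y -> `|word_map p x - word_map p y| <= c ^+ size p * `|x - y|.
Proof.
move=> c0 hc Xx Xy; elim: p => [|i p IH] /=; first by rewrite mul1r.
apply: le_trans (hc i _ _ (word_map_in p Xx) (word_map_in p Xy)) _.
by rewrite exprS -mulrA ler_wpM2l.
Qed.

Definition word_lo p := word_map p a.
Definition word_hi p := word_map p b.

Lemma word_order p q : ~~ seq.prefix p q -> ~~ seq.prefix q p ->
  word_hi p <= word_lo q \/ word_hi q <= word_lo p.
Proof.
have aab : a <= a <= b by rewrite lexx hull_le.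
have bab : a <= b <= b by rewrite lexx hull_le.
elim: p q => [|i p IH] [|j q] //; rewrite ?prefix0s// !prefix_cons.
have ha r : a <= word_lo r <= b by exact: word_map_hull.
have hb r : a <= word_hi r <= b by exact: word_map_hull.
have /andP[pa1 pa2] := ha p; have /andP[pb1 pb2] := hb p.
have /andP[qa1 qa2] := ha q; have /andP[qb1 qb2] := hb q.
have [<- /= h1 h2|ij _ _] := eqVneq i j.
  by have [h|h] := IH q h1 h2; [left|right]; exact: branch_le.
rewrite /word_hi /word_lo /=.
have [h|h] := branch_order ij; [left|right].
  by apply: le_trans (le_trans h _); exact: branch_le.
by apply: le_trans (le_trans h _); exact: branch_le.
Qed.

(* The point of [w] as the supremum of the left end points of its intervals. *)
Definition hull_point (w : nat -> I) : R := sup (range (fun n => word_lo (mkseq w n))).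

Let lo_mono w n m : (n <= m)%N -> word_lo (mkseq w n) <= word_lo (mkseq w m).
Proof.
move=> /subnK <-; rewrite addnC mkseqD /word_lo word_map_cat.
have aab : a <= a <= b by rewrite lexx hull_le.
have /andP[h1 h2] := word_map_hull (mkseq (iter n (@Defs.shift I) w) (m - n)) aab.
exact: word_map_le.
Qed.

Let hi_mono w n m : (n <= m)%N -> word_hi (mkseq w m) <= word_hi (mkseq w n).
Proof.
move=> /subnK <-; rewrite addnC mkseqD /word_hi word_map_cat.
have bab : a <= b <= b by rewrite lexx hull_le.
have /andP[h1 h2] := word_map_hull (mkseq (iter n (@Defs.shift I) w) (m - n)) bab.
exact: word_map_le.
Qed.

Let lo_hi p : word_lo p <= word_hi p.
Proof. by apply: word_map_le => //; exact: hull_le. Qed.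

Lemma hull_point_in w n : word_lo (mkseq w n) <= hull_point w <= word_hi (mkseq w n).
Proof.
have ub m k : word_lo (mkseq w m) <= word_hi (mkseq w k).
  apply: le_trans (lo_mono w (leq_maxl m k)) _.
  by apply: le_trans (lo_hi _) _; exact/hi_mono/leq_maxr.
apply/andP; split.
  apply: ub_le_sup; last by exists n.
  by exists (word_hi (mkseq w 0)) => _ [m _ <-].
apply: ge_sup; first by exists (word_lo (mkseq w 0)); exists 0%N.
by move=> _ [m _ <-].
Qed.

Lemma word_len_le : exists c : R, [/\ 0 <= c, c < 1 &
  forall p, word_hi p - word_lo p <= c ^+ size p * (b - a)].
Proof.
have [c [c0 c1 hc]] := contraction_ratio; exists c; split => // p.
have := word_map_contract p c0 hc hull_sup_in hull_inf_in.
rewrite (ger0_norm (_ : 0 <= b - a)) ?subr_ge0 ?hull_le//.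
by apply: le_trans; exact: ler_norm.
Qed.

Let expn_small (c d e : R) : 0 <= c -> c < 1 -> 0 < e -> exists n, c ^+ n * d < e.
Proof.
move=> c0 c1 e0.
have /cvgr0Pnorm_lt H : c ^+ n @[n --> \oo] --> 0 by apply: cvg_expr; rewrite ger0_norm.
have d0 : 0 < `|d| + 1 by rewrite ltr_wpDl.
have [n _ h] := H _ (divr_gt0 e0 d0); exists n.
have := h n (leqnn n); rewrite ger0_norm ?exprn_ge0// ltr_pdivlMr//.
apply: le_lt_trans; rewrite ler_wpM2l ?exprn_ge0//.
by apply: le_trans (ler_norm d) _; rewrite lerDl.
Qed.

Lemma hull_point_set w : X (hull_point w).
Proof.
have [c [c0 c1 hc]] := word_len_le.
apply: ifs_set_closed => e e0; have [n hn] := expn_small (b - a) c0 c1 e0.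
exists (word_lo (mkseq w n)); first exact/word_map_in/hull_inf_in.
have /andP[h1 h2] := hull_point_in w n; have := hc (mkseq w n); rewrite size_mkseq.
by rewrite ger0_norm; lra.
Qed.

Lemma hull_point_hull w : a <= hull_point w <= b.
Proof. exact: hull_point_in w 0. Qed.

(** Both sides lie in all intervals of prefixes of [w] of length at least [n], and these shrink. *)
Lemma hull_point_shift w n :
  hull_point w = word_map (mkseq w n) (hull_point (iter n (@Defs.shift I) w)).
Proof.
set w' := iter _ _ w; set y := word_map _ _.
have [c [c0 c1 hc]] := word_len_le.
have yin m : word_lo (mkseq w (n + m)) <= y <= word_hi (mkseq w (n + m)).
  rewrite mkseqD -/w' /word_lo /word_hi !word_map_cat.
  have /andP[h1 h2] := hull_point_in w' m.
  have /andP[h3 h4] := hull_point_hull w'.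
  have aab : a <= a <= b by rewrite lexx hull_le.
  have bab : a <= b <= b by rewrite lexx hull_le.
  have /andP[h5 h6] := word_map_hull (mkseq w' m) aab.
  have /andP[h7 h8] := word_map_hull (mkseq w' m) bab.
  by rewrite !word_map_le.
apply/eqP; rewrite -subr_eq0 -normr_le0 leNgt; apply/negP => d0.
have [m hm] := expn_small (c ^+ n * (b - a)) c0 c1 d0.
have := hc (mkseq w (n + m)); rewrite size_mkseq exprD.
have /andP[h1 h2] := yin m; have /andP[h3 h4] := hull_point_in w (n + m).
have : `|hull_point w - y| <= word_hi (mkseq w (n + m)) - word_lo (mkseq w (n + m)).
  by rewrite ler_norml; apply/andP; split; lra.
by move: hm; rewrite mulrA [c ^+ m * _]mulrC; lra.
Qed.

(** [get] picks some point of the intersection of the images of X, and contraction on X leaves only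
    one. *)
Lemma codingE w : coding Phi w = hull_point w.
Proof.
have [c [c0 c1 hc]] := contraction_ratio.
have [B B0 hB] := ifs_set_bounded.
have hin : (\bigcap_(n in [set n | (1 <= n)%N]) (ifs_comp Phi w n @` X)) (hull_point w).
  move=> n _; exists (hull_point (iter n (@Defs.shift I) w)); first exact: hull_point_set.
  by rewrite ifs_compE -hull_point_shift.
have := getI hin; rewrite -/(coding Phi w) => hget.
apply/eqP; rewrite -subr_eq0 -normr_le0 leNgt; apply/negP => d0.
have [n hn] := expn_small (2 * B) c0 c1 d0.
have [y Xy yE] := hget n.+1 isT.
have [z Xz zE] := hin n.+1 isT.
move: d0 hn; rewrite -yE -zE !ifs_compE => d0.
apply/negP; rewrite -leNgt.
apply: le_trans (word_map_contract (mkseq w n.+1) c0 hc Xy Xz) _.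
rewrite size_mkseq.
have yz : `|y - z| <= 2 * B.
  by apply: le_trans (ler_normB _ _) _; have := hB _ Xy; have := hB _ Xz; lra.
apply: ler_pM => //; first exact: exprn_ge0.
by rewrite exprS ler_piMl ?exprn_ge0// ltW.
Qed.


Section Distortion.
Hypothesis ab : a < b.
Let phi := geom_potential Phi.

(** Each new first letter adds, by the mean value theorem, a log-derivative at a point within
    [c ^+ n * (b - a)] of the coded point used by the potential; the Hölder errors form a geometric
    series. Arbitrary [y] and [z] are allowed because the gaps left by the separating word must be
    measured too. *)
Lemma word_map_distortion : exists2 K : R, 0 <= K & forall w n y z,
  a <= y -> y < z -> z <= b ->
  `|ln (word_map (mkseq w n) z - word_map (mkseq w n) y) - ln (z - y)
    - birkhoff phi n w| <= K.
Proof.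
have [c [c0 c1 hc]] := word_len_le.
have [H [e [H0 e0 hH]]] := log_derivative_holder.
pose rho := c `^ e.
have rho0 : 0 <= rho by exact: powR_ge0.
have rho1 : rho < 1.
  have h1 : 1 `^ e = 1 :> R by rewrite powR1.
  by rewrite -[ltRHS]h1 gt0_ltr_powR ?nnegrE.
pose K := H * (b - a) `^ e.
have K0 : 0 <= K by rewrite mulr_ge0 ?powR_ge0.
exists (K / (1 - rho)); first by rewrite divr_ge0// subr_ge0 ltW.
move=> w n y z ay yz zb; rewrite ler_pdivlMr ?subr_gt0//.
suff h : `|ln (word_map (mkseq w n) z - word_map (mkseq w n) y) - ln (z - y)
    - birkhoff phi n w| * (1 - rho) <= K * (1 - rho ^+ n).
  apply: le_trans h _; rewrite -[leRHS]mulr1 ler_wpM2l// gerBl.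
  exact: exprn_ge0.
elim: n w => [|n IH] w.
  by rewrite birkhoff0 /= subrr subr0 normr0 mul0r expr0 subrr mulr0.
set w' := Defs.shift w; have {}IH := IH w'.
have -> : mkseq w n.+1 = w 0%N :: mkseq w' n by rewrite -add1n mkseqD.
rewrite /= birkhoffS -/w'.
set p := mkseq w' n in IH *; set y' := word_map p y in IH *; set z' := word_map p z in IH *.
have hy : a <= y <= b by rewrite ay ltW// (lt_le_trans yz).
have hz : a <= z <= b by rewrite zb ltW// (le_lt_trans ay).
have yz' : y' < z' by exact: word_map_lt.
have /andP[y1 _] := word_map_hull p hy; have /andP[_ z1] := word_map_hull p hz.
have [x [yx xz fE]] := branch_mvt (w 0%N) y1 yz' z1.
have hx : a <= x <= b by rewrite (le_trans y1 yx) (le_trans xz z1).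
have hpi := hull_point_hull w'.
have err : `|ln (df (w 0%N) x) - phi w| <= K * rho ^+ n.
  rewrite /phi /geom_potential codingE -/w'.
  apply: le_trans (hH (w 0%N) x (hull_point w') hx hpi) _.
  rewrite /K -mulrA ler_wpM2l// /rho.
  rewrite -powR_mulrn ?powR_ge0// -powRrM [e * _]mulrC powRrM powR_mulrn//.
  rewrite [leRHS]mulrC -powRM ?exprn_ge0// ?subr_ge0 ?hull_le//.
  rewrite ge0_ler_powR ?nnegrE ?(ltW e0)// ?mulr_ge0 ?exprn_ge0 ?subr_ge0 ?hull_le//.
  have /andP[h1 h2] := hull_point_in w' n; have := hc (mkseq w' n).
  rewrite size_mkseq -/p in h1 h2 * => h3.
  have h4 : word_lo p <= y' by exact: word_map_le (ltW (lt_le_trans yz zb)).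
  have h5 : z' <= word_hi p by exact: word_map_le (ltW (le_lt_trans ay yz)) _ _.
  move: (le_trans h4 yx) (le_trans xz h5) h1 h2 h3.
  move: (word_lo p) (word_hi p) (hull_point w') => u1 u2 u3 *.
  by rewrite ler_norml; apply/andP; split; lra.
rewrite fE lnM ?posrE ?subr_gt0 ?derivative_gt0//.
set L := ln (z' - y') in IH *; set S := birkhoff phi n w' in IH *.
have -> : ln (df (w 0%N) x) + L - ln (z - y) - (phi w + S) =
  (L - ln (z - y) - S) + (ln (df (w 0%N) x) - phi w) by ring.
have r0 : 0 <= 1 - rho by rewrite subr_ge0 ltW.
apply: le_trans (ler_wpM2r r0 (ler_normD _ _)) _; rewrite mulrDl.
have := ler_wpM2r r0 err; rewrite exprS; lra.
Qed.

(** The Birkhoff sums at [w] and [v] are compared with the length of the same interval, which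
    depends on the common word alone. *)
Lemma geom_distortion : exists C, bounded_distortion phi C.
Proof.
have [K K0 hK] := word_map_distortion; exists (2 * K) => n w v /agree_mkseq wv.
have := hK w n a b (lexx a) ab (lexx b); have := hK v n a b (lexx a) ab (lexx b).
rewrite (wv i0); move: (ln (word_map _ _ - _)) (ln (b - a)) => l1 l2.
move: (birkhoff _ _ _) (birkhoff _ _ _) => s1 s2.
rewrite !ler_norml => /andP[? ?] /andP[? ?].
by apply/andP; split; lra.
Qed.

Lemma geom_decay : exists K0 eta : R, 0 < eta /\
  forall n w, birkhoff phi n w <= K0 - eta * n%:R.
Proof.
have [K K_ge0 hK] := word_map_distortion.
have [c [c0 c1 hc]] := word_len_le.
have len0 p : 0 < word_hi p - word_lo p by rewrite subr_gt0 word_map_lt.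
have c_gt0 : 0 < c.
  rewrite lt_neqAle c0 andbT; apply/eqP => cE.
  have := hc [:: i0]; rewrite -cE expr1 mul0r.
  by apply/negP; rewrite -ltNge.
exists K, (- ln c); split; first by rewrite oppr_gt0 ln_lt0// c_gt0.
move=> n w; have := hK w n a b (lexx a) ab (lexx b); rewrite ler_norml => /andP[h _].
have : ln (word_hi (mkseq w n) - word_lo (mkseq w n)) <= n%:R * ln c + ln (b - a).
  have ba0 : 0 < b - a by rewrite subr_gt0.
  have cn0 : 0 < c ^+ n by rewrite exprn_gt0.
  have cb0 : 0 < c ^+ n * (b - a) by rewrite mulr_gt0.
  have l0 := len0 (mkseq w n).
  rewrite mulr_natl -lnXn// -lnM ?posrE// ler_ln ?posrE//.
  by have := hc (mkseq w n); rewrite size_mkseq.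
move: h; rewrite /word_hi /word_lo; move: (ln (word_map _ _ - _)) (ln (b - a)).
by move=> l1 l2; move: (birkhoff _ _ _) (ln c) => s1 l3; lra.
Qed.

(** If the image of the hull under [i'] lies left of that under [j'], take the word [i' j']. Its
    left end exceeds [a] because [f j' a] does, and its right end stays below [b] because the whole
    interval of [i'] lies left of that of [j']. *)
Lemma separating_word (i j : I) : i != j -> exists s, a < word_lo s /\ word_hi s < b.
Proof.
have key i' j' : f i' b <= f j' a -> exists s, a < word_lo s /\ word_hi s < b.
  move=> h; exists [:: i'; j']; rewrite /word_lo /word_hi /=.
  have h1 := branch_lt i' (lexx a) ab (lexx b).
  have h2 := branch_lt j' (lexx a) ab (lexx b).
  have h3 := hull_stable_inf i'; have h4 := hull_stable_sup j'.
  split.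
    apply: le_lt_trans h3 _; apply: branch_lt => //.
      exact: le_lt_trans (hull_stable_inf i') (lt_le_trans h1 h).
    by apply: le_trans h4; exact: ltW.
  apply: le_lt_trans (_ : f i' b < b); last exact: le_lt_trans h (lt_le_trans h2 h4).
  apply: branch_le => //.
  exact: le_trans (hull_stable_inf j') (ltW h2).
by move=> /branch_order[]; exact: key.
Qed.

End Distortion.

End Geometry.

(** * Mass of balls *)

Section GibbsMass.
Variables (R : realType) (I : finType) (i0 : I).
Variables (psi : (nat -> I) -> R) (mu : probability (borel_seq R i0) R).
Definition word_cylinder (p : seq I) : set (borel_seq R i0) :=
  [set w | mkseq w (size p) = p].

Definition word_mass (p : seq I) : R := fine (mu (word_cylinder p)).

Lemma word_mass_gibbs C : bounded_distortion psi C -> pressure psi = 0 ->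
  is_gibbs psi mu -> exists2 K : R, 0 <= K & forall p,
  expR (word_sum i0 psi p - K) <= word_mass p <= expR (word_sum i0 psi p + K).
Proof.
move=> psiC P0 [_ [c [c1 hc]]].
have c0 : 0 < c by exact: lt_le_trans ltr01 c1.
have lc : 0 <= ln c by rewrite ln_ge0.
(* The Gibbs inequality is given for [n >= 1]; the empty word has mass 1. *)
exists (ln c) => // p; have [p0|p0] := posnP (size p).
  rewrite (size0nil p0) word_sum_nil add0r add0r /word_mass.
  have -> : word_cylinder [::] = setT by apply/seteqP; split.
  by rewrite probability_setT /= -expR0 !ler_expR oppr_le0 lc.
have := hc (word_point i0 p) (size p) p0.
have -> : cylinder (Defs.prefix (word_point i0 p) (size p)) = word_cylinder p.
  have pE : val (Defs.prefix (word_point i0 p) (size p)) = p.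
    rewrite -[RHS](mkseq_word i0 p); apply: (@eq_from_nth _ i0).
      by rewrite size_tuple size_mkseq.
    move=> k; rewrite size_tuple => kp.
    by rewrite nth_mkseq// -(tnth_nth i0 _ (Ordinal kp)) tnth_mktuple.
  by rewrite (cylinderE i0) /word_cylinder pE.
rewrite P0 mulr0 subr0 -/(word_sum i0 psi p) -/(word_mass p).
rewrite ler_pdivlMr ?expR_gt0// ler_pdivrMr ?expR_gt0// => /andP[h1 h2].
by rewrite expRD expRN expRD lnK ?posrE// mulrC h1 mulrC h2.
Qed.

Variable (x_ : (nat -> I) -> R).
Hypothesis x_cont : forall w (e : R), 0 < e ->
  exists n, forall v, agree n w v -> `|x_ v - x_ w| < e.

Definition ball_mass (x r : R) : R :=
  fine (pushforward mu (x_ : borel_seq R i0 -> measurableTypeR R) (ball x r)).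

Let shift_open_measurable (A : set (nat -> I)) : shift_open R A ->
  measurable (A : set (borel_seq R i0)).
Proof. by move=> h; apply: sub_sigma_algebra. Qed.

Let agree_open (A : set (nat -> I)) :
  (forall w, A w -> exists n, forall v, agree n w v -> A v) -> shift_open R A.
Proof.
move=> h w /h[n hn]; exists (2 ^- n); first by rewrite invr_gt0 exprn_gt0.
by move=> v /shift_dist_agree; exact: hn.
Qed.

Let measurable_cylinder p : measurable (word_cylinder p).
Proof.
apply: shift_open_measurable; apply: agree_open => w wp.
exists (size p) => v /(agree_mkseq i0) wv.
by rewrite /word_cylinder /= -wv.
Qed.

Let preball x r : set (borel_seq R i0) := [set w | `|x_ w - x| < r].

Let measurable_preball x r : measurable (preball x r).
Proof.
apply: shift_open_measurable; apply: agree_open => w wr.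
have e0 : 0 < r - `|x_ w - x| by rewrite subr_gt0.
have [n hn] := x_cont w e0; exists n => v /hn vw.
rewrite /preball /=.
have -> : x_ v - x = (x_ v - x_ w) + (x_ w - x) by ring.
by apply: le_lt_trans (ler_normD _ _) _; rewrite -ltrBrDr.
Qed.

Let ball_massE x r : ball_mass x r = fine (mu (preball x r)).
Proof.
rewrite /ball_mass /pushforward; congr (fine (mu _)).
by apply/seteqP; split => w /=; rewrite /preball /= /ball /= distrC.
Qed.

Let fin (A : set (borel_seq R i0)) : measurable A -> mu A \is a fin_num.
Proof. by move=> mA; apply: fin_num_measure. Qed.

Lemma word_mass_le p x r : (forall w, mkseq w (size p) = p -> `|x_ w - x| < r) ->
  word_mass p <= ball_mass x r.
Proof.
move=> h; rewrite ball_massE /word_mass fine_le ?fin//.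
by apply: le_measure; rewrite ?inE//; exact: h.
Qed.

Lemma ball_mass_le2 p q x r : (forall w, `|x_ w - x| < r ->
    mkseq w (size p) = p \/ mkseq w (size q) = q) ->
  ball_mass x r <= word_mass p + word_mass q.
Proof.
move=> h; rewrite ball_massE /word_mass -fineD ?fin// fine_le ?fin//.
  by rewrite fin_numD !fin.
apply: le_trans (_ : (mu (word_cylinder p `|` word_cylinder q) <= _)%E).
  have mU : measurable (word_cylinder p `|` word_cylinder q) by exact: measurableU.
  by apply: le_measure; rewrite ?inE//; exact: h.
exact: measureU2.
Qed.

End GibbsMass.

Section Instances.
Variables (R : realType) (I : finType) (i0 : I) (Phi : conformal_ifs R I).
Variables (psi : (nat -> I) -> R) (mu : probability (borel_seq R i0) R).
Hypothesis psi_holder : holder psi.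
Hypothesis psi_normalized : pressure psi = 0.
Hypothesis mu_gibbs : is_gibbs psi mu.
Let phi := geom_potential Phi.
Let M := ball_mass mu (coding Phi).

Lemma coded_intervals_many (i j : I) : i != j -> open_set_condition Phi ->
  inhabited (coded_intervals i0 phi psi (coding Phi) M).
Proof.
move=> ij [U [[_ U_itv UX0 UV] [fU f_disj]]].
have ab := hull_lt UX0 fU f_disj ij.
set a := hull_inf Phi U in ab; set b := hull_sup Phi U in ab.
have [K K0 hK] := word_map_distortion U_itv UX0 UV fU.
have [Cf hCf] := geom_distortion i0 U_itv UX0 UV fU ab.
have [K' [eta [eta0 decay]]] := geom_decay i0 U_itv UX0 UV fU ab.
have [Cp hCp] := holder_distortion psi_holder.
have [c [c0 c1 hc]] := word_len_le UX0.
have [s [s1 s2]] := separating_word U_itv UX0 UV fU f_disj ab ij.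
have cE w : coding Phi w = hull_point Phi U w := codingE U_itv UX0 UV fU w.
have point w n : word_lo Phi U (mkseq w n) <= coding Phi w <= word_hi Phi U (mkseq w n).
  by rewrite cE; exact: hull_point_in.
have cont w (e : R) : 0 < e -> exists n, forall v, agree n w v ->
    `|coding Phi v - coding Phi w| < e.
  move=> e0.
  have /cvgr0Pnorm_lt H : c ^+ n @[n --> \oo] --> 0.
    by apply: cvg_expr; rewrite ger0_norm.
  have d0 : 0 < e / (b - a) by rewrite divr_gt0// subr_gt0.
  have [n _ h] := H _ d0; exists n => v /(agree_mkseq i0) wv.
  have := h n (leqnn n); rewrite ger0_norm ?exprn_ge0// ltr_pdivlMr ?subr_gt0// => h1.
  have := hc (mkseq w n); rewrite size_mkseq => h2.
  have /andP[h3 h4] := point w n; have := point v n; rewrite -wv => /andP[h5 h6].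
  have := le_lt_trans h2 h1.
  move: h3 h4 h5 h6; move: (word_lo _ _ _) (word_hi _ _ _) (coding _ _) (coding _ _).
  by move=> u1 u2 u3 u4 *; rewrite ltr_norml; apply/andP; split; lra.
have [Kg Kg0 hKg] := word_mass_gibbs hCp psi_normalized mu_gibbs.
pose CG := K + `|ln (b - a)| + Kg.
have CG1 : K + `|ln (b - a)| <= CG by rewrite /CG lerDl.
have CG2 : Kg <= CG by rewrite /CG lerDr addr_ge0.
have wlt p y z := @word_map_lt _ _ _ _ U_itv UX0 UV fU p y z.
(* The gaps that [s] leaves at the two ends of the hull, reduced by the distortion of the word
   maps. *)
pose c' := Num.min (word_lo Phi U s - a) (b - word_hi Phi U s) * expR (- K).
have c'0 : 0 < c' by rewrite mulr_gt0 ?expR_gt0// lt_min !subr_gt0 s1 s2.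
have gap p y z : a <= y -> y < z -> z <= b ->
    (z - y) * expR (- K) * expR (word_sum i0 phi p) <= word_map Phi p z - word_map Phi p y.
  move=> ay yz zb; have := hK (word_point i0 p) (size p) y z ay yz zb.
  rewrite mkseq_word -/(word_sum i0 phi p) ler_norml => /andP[h _].
  have d0 : 0 < word_map Phi p z - word_map Phi p y by rewrite subr_gt0 wlt.
  rewrite -[leRHS]lnK ?posrE// -[X in X * _ * _]lnK ?posrE ?subr_gt0//.
  by rewrite -!expRD ler_expR; lra.
suff S : coded_intervals i0 phi psi (coding Phi) M by split.
apply: (@CodedIntervals R I i0 phi psi (coding Phi) M Cf Cp CG eta K' c' s
  (word_lo Phi U) (word_hi Phi U) (word_mass mu)) => //.
- move=> p; have := hK (word_point i0 p) (size p) a b (lexx a) ab (lexx b).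
  rewrite mkseq_word -/(word_sum i0 phi p) -/(word_lo Phi U p) -/(word_hi Phi U p).
  have d0 : 0 < word_hi Phi U p - word_lo Phi U p by rewrite subr_gt0 wlt.
  have l1 := ler_norm (ln (b - a)); have l2 := ler_norm (- ln (b - a)).
  rewrite normrN in l2.
  rewrite ler_norml => /andP[h1 h2].
  rewrite -[word_hi Phi U p - _]lnK ?posrE// !ler_expR.
  by apply/andP; split; move: h1 h2 CG1 l1 l2; lra.
- by move=> p q; exact: word_order.
- move=> p w /eqP; rewrite size_cat mkseqD eqseq_cat ?size_mkseq// => /andP[/eqP wp /eqP ws].
  have pE : coding Phi w = word_map Phi p (coding Phi (iter (size p) (@Defs.shift I) w)).
    by rewrite !cE (hull_point_shift U_itv UX0 UV fU w (size p)) wp.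
  set w' := iter _ _ w in pE ws.
  have := point w' (size s); rewrite ws => /andP[h1 h2].
  have sl : word_lo Phi U s <= b by apply: le_trans h1 (le_trans h2 (ltW s2)).
  have sh : a <= word_hi Phi U s by apply: le_trans (ltW s1) (le_trans h1 h2).
  have mono y z : a <= y -> y <= z -> z <= b -> word_map Phi p y <= word_map Phi p z.
    exact: word_map_le.
  have m1 := mono _ _ (ltW s1) h1 (le_trans h2 (ltW s2)).
  have m2 := mono _ _ (le_trans (ltW s1) h1) h2 (ltW s2).
  have g1 := gap p _ _ (lexx a) s1 sl.
  have g2 := gap p _ _ sh s2 (lexx b).
  have e0 := expR_ge0 (word_sum i0 phi p).
  have k1 : c' * expR (word_sum i0 phi p) <=
     (word_lo Phi U s - a) * expR (- K) * expR (word_sum i0 phi p).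
    by rewrite !ler_wpM2r ?expR_ge0// ge_min lexx.
  have k2 : c' * expR (word_sum i0 phi p) <=
     (b - word_hi Phi U s) * expR (- K) * expR (word_sum i0 phi p).
    by rewrite !ler_wpM2r ?expR_ge0// ge_min lexx orbT.
  have q1 := le_trans k1 g1; have q2 := le_trans k2 g2.
  rewrite pE; apply/andP; split.
    by apply: le_trans m1; rewrite -lerBrDl.
  by apply: le_trans m2 _; rewrite lerBrDr -lerBrDl.
- move=> p; have /andP[h1 h2] := hKg p; apply/andP; split.
    by apply: le_trans h1; rewrite ler_expR lerB.
  by apply: le_trans h2 _; rewrite ler_expR lerD2l.
- by move=> p x r; exact: word_mass_le.
- by move=> p q x r; exact: ball_mass_le2.
Qed.

(* With a single letter the attractor is a point, and any intervals shrinking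
   to it at the required rate will do. *)
Lemma coded_intervals_one : (forall i j : I, i = j) -> (forall w, phi w < 0) ->
  inhabited (coded_intervals i0 phi psi (coding Phi) M).
Proof.
move=> I1 phi_lt0.
have w1 (w v : nat -> I) : w = v by apply/funext => k; exact: I1.
have bd (u : (nat -> I) -> R) : bounded_distortion u 0.
  by move=> n w v _; rewrite (w1 w v) subrr normr0.
have [Kg Kg0 hKg] := word_mass_gibbs (bd psi) psi_normalized mu_gibbs.
pose x0 := coding Phi (fun=> i0).
have xE w : coding Phi w = x0 by rewrite (w1 w (fun=> i0)).
pose eta := - phi (fun=> i0).
have cont w (e : R) : 0 < e -> exists n, forall v, agree n w v ->
    `|coding Phi v - coding Phi w| < e.
  by move=> e0; exists 0%N => v _; rewrite !xE subrr normr0.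
have l2 : 0 <= ln 2 :> R by rewrite ln_ge0// ler1n.
pose CG := Kg + ln 2.
have comparable (p q : seq I) : seq.prefix p q || seq.prefix q p.
  elim: p q => [|i p IH] [|j q] //; rewrite ?prefix0s ?orbT//.
  by rewrite !prefix_cons (I1 i j) eqxx /= IH.
suff S : coded_intervals i0 phi psi (coding Phi) M by split.
apply: (@CodedIntervals R I i0 phi psi (coding Phi) M 0 0 CG eta 0 2^-1 [::]
  (fun p => x0 - expR (word_sum i0 phi p)) (fun p => x0 + expR (word_sum i0 phi p))
  (word_mass mu)) => //.
- by rewrite /eta oppr_gt0.
- move=> n w; rewrite /eta sub0r mulNr opprK mulr_natr.
  rewrite -[n in leRHS]card_ord -sumr_const; apply: ler_sum => k _.
  by rewrite (w1 (iter k _ w) (fun=> i0)).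
- move=> p; rewrite [X in _ <= X <= _](_ : _ = expR (word_sum i0 phi p) * 2); last by ring.
  rewrite -[X in _ <= _ * X <= _]lnK ?posrE// -expRD !ler_expR !lerD2l.
  by rewrite /CG; apply/andP; split; lra.
- move=> w n; rewrite xE gerBl lerDl expR_ge0 //.
- by move=> p q; have := comparable p q; case: seq.prefix => //=; case: seq.prefix.
- move=> p w _; rewrite xE; have := expR_ge0 (word_sum i0 phi p) => h.
  by apply/andP; split; lra.
- move=> p; have /andP[h1 h2] := hKg p; apply/andP; split.
    by apply: le_trans h1; rewrite ler_expR lerB// /CG lerDl.
  by apply: le_trans h2 _; rewrite ler_expR lerD2l /CG lerDl.
- by move=> p x r; exact: word_mass_le.
- by move=> p q x r; exact: ball_mass_le2.
Qed.

Lemma coded_intervals_exist : open_set_condition Phi -> (forall w, phi w < 0) ->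
  inhabited (coded_intervals i0 phi psi (coding Phi) M).
Proof.
move=> osc phi_lt0; have [[i [j ij]]|h] := pselect (exists i j : I, i != j).
  exact: coded_intervals_many ij osc.
apply: coded_intervals_one => // i j; apply/eqP; apply/negPn/negP => ij.
by apply: h; exists i, j.
Qed.

End Instances.

(** * Level sets *)

Section RightLimits.
Variables (R : realType) (f : R -> R).
Local Notation F := (fun r => (f r)%:E).

(** A neighbourhood with supremum below [a + e], cut down to radii below [rho], still has supremum
    at least [a]. *)
Lemma limf_esup_cluster (a e rho : R) : limf_esup F 0^'+ = a%:E ->
  0 < e -> 0 < rho -> exists r, [/\ 0 < r, r < rho & `|f r - a| <= e].
Proof.
rewrite limf_esupE => h e0 rho0.
have : (ereal_inf [set ereal_sup (F @` V) | V in 0^'+] < (a + e)%:E)%E.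
  by rewrite h lte_fin ltrDl.
move=> /ereal_inf_lt[_ /= [V V0 <-] hV].
pose W := V `&` [set r | 0 < r /\ r < rho].
have W0 : 0^'+ W.
  apply: filterI => //; near=> r; split; near: r; [exact: nbhs_right_gt|exact: nbhs_right_lt].
have : ((a - e)%:E < ereal_sup (F @` W))%E.
  apply: (@lt_le_trans _ _ a%:E); first by rewrite lte_fin ltrBlDr ltrDl.
  by rewrite -h; apply: ereal_inf_lbound; exists W.
move=> /ereal_sup_gt[_ /= [r [Vr [r0 rrho]] <-]]; rewrite lte_fin => ar.
exists r; split=> //; rewrite ler_distl (ltW ar) /= -lee_fin.
by apply: le_trans (ltW hV); apply: ereal_sup_ubound; exists r.
Unshelve. all: by end_near. Qed.

Lemma cvg_limf_esup (a : R) : f r @[r --> 0^'+] --> a -> limf_esup F 0^'+ = a%:E.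
Proof.
move=> /cvgrPdist_le h; rewrite limf_esupE; apply/eqP; rewrite eq_le; apply/andP; split.
  apply/lee_addgt0Pr => e e0; have He := h _ e0.
  apply: ge_ereal_inf; exists (ereal_sup (F @` [set r | `|a - f r| <= e])).
    by exists [set r | `|a - f r| <= e].
  apply: ge_ereal_sup => _ [r /= hr <-]; rewrite lee_fin.
  by move: hr; rewrite ler_distl; lra.
apply: le_ereal_inf_tmp => _ [V V0 <-]; apply/lee_subgt0Pr => e e0.
have [r [Vr hr]] : exists r, V r /\ `|a - f r| <= e.
  have : 0^'+ (V `&` [set r | `|a - f r| <= e]) by apply: filterI => //; exact: h.
  by move=> /filter_ex[r [? ?]]; exists r.
apply: le_trans (_ : ((f r)%:E <= _)%E); last by apply: ereal_sup_ubound; exists r.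
by rewrite lee_fin; move: hr; rewrite ler_distl; lra.
Qed.

End RightLimits.

Section Spectrum.
Variables (R : realType) (I : finType) (i0 : I) (phi psi : (nat -> I) -> R).
Variables (x_ : (nat -> I) -> R) (nu : set R -> \bar R).
Let M (x r : R) := fine (nu (ball x r)).
Variable alpha : R.
Local Notation L := (range x_).
Local Notation LE := [set x | exists w, x = x_ w /\ limit_exponent M alpha x].
Local Notation HE := [set x | exists w, x = x_ w /\ has_exponent M alpha x].

Lemma level_liminf_limit_exponent : level_liminf L nu alpha `<=` LE.
Proof.
move=> _ [[w _ <-] h]; exists w; split=> // e rho e0 rho0.
have h' : limf_esup (fun r => (- local_exponent nu (x_ w) r)%:E) 0^'+ = (- alpha)%:E.
  by rewrite EFinN -h /limf_einf oppeK.
have [r [r0 rrho hr]] := limf_esup_cluster h' e0 rho0; exists r; split=> //.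
by rewrite -normrN opprB addrC; move: hr; rewrite opprK.
Qed.

Lemma level_limsup_limit_exponent : level_limsup L nu alpha `<=` LE.
Proof.
move=> _ [[w _ <-] h]; exists w; split=> // e rho e0 rho0.
exact: limf_esup_cluster h e0 rho0.
Qed.

Lemma level_seq_limit_exponent : level_seq L nu alpha `<=` LE.
Proof.
move=> _ [[w _ <-] [r [r0 /cvgrPdist_lt rlim /cvgrPdist_le h]]].
exists w; split=> // e rho e0 rho0.
have : \oo (fun k => r k < rho /\ `|alpha - local_exponent nu (x_ w) (r k)| <= e).
  near=> k; split; last by near: k; exact: h.
  by rewrite -[r k]gtr0_norm// -normrN -sub0r; near: k; exact: rlim.
by move=> /filter_ex[k [h1 h2]]; exists (r k); rewrite distrC.
Unshelve. all: by end_near. Qed.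

Lemma level_lim_seq : level_lim L nu alpha `<=` level_seq L nu alpha.
Proof.
move=> x [Lx h]; split=> //; exists (fun k => k.+1%:R^-1).
have r0 (k : nat) : 0 < k.+1%:R^-1 :> R by rewrite invr_gt0.
have rlim : (k.+1%:R^-1 : R) @[k --> \oo] --> 0 by exact: cvg_harmonic.
by split=> //; move/cvg_at_rightP : h; apply.
Qed.

Lemma has_exponent_level_lim : HE `<=` level_lim L nu alpha.
Proof.
move=> _ [w [-> h]]; split; first by exists w.
apply/cvgrPdist_le => e e0; have [rho rho0 hr] := h _ e0.
near=> r; rewrite distrC; apply: hr; near: r; [exact: nbhs_right_gt|exact: nbhs_right_lt].
Unshelve. all: by end_near. Qed.

Lemma level_lim_limsup : level_lim L nu alpha `<=` level_limsup L nu alpha.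
Proof. by move=> x [Lx h]; split=> //; exact: cvg_limf_esup. Qed.

Lemma level_lim_liminf : level_lim L nu alpha `<=` level_liminf L nu alpha.
Proof.
move=> x [Lx h]; split=> //; rewrite /limf_einf.
have := @cvg_limf_esup _ (fun r => - local_exponent nu x r) (- alpha).
by move=> ->; [rewrite EFinN oppeK|exact: cvgN].
Qed.

Variable S : coded_intervals i0 phi psi x_ M.
Hypothesis phi_lt0 : forall w, phi w < 0.
Let am := alpha_minus phi psi.
Let ap := alpha_plus phi psi.
Let t := temperature phi psi.
Let phiC := ci_phi_bd S.
Let psiC := ci_psi_bd S.
Let eta0 := ci_eta_gt0 S.
Let decay := ci_decay S.

Lemma limit_exponent_alpha_minus x : LE x -> (am <= alpha%:E)%E.
Proof.
move=> [w [-> h]]; rewrite leNgt; apply/negP => lt.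
(* [am] is an extended real, while the bounds for words need a real number; [alpha + 1] serves if
   [am] is infinite. *)
have [A Aam aA] : exists2 A : R, (A%:E <= am)%E & alpha < A.
  move: lt; case: am => [r| |] //; rewrite ?lte_fin => ?; first by exists r.
  by exists (alpha + 1); rewrite ?leey// ltrDl.
have := limit_exponent_ge S (fun p => word_sum_ratio_ge i0 phiC psiC phi_lt0 p Aam) h.
by rewrite leNgt aA.
Qed.

Lemma limit_exponent_alpha_plus x : LE x -> (alpha%:E <= ap)%E.
Proof.
move=> [w [-> h]]; rewrite leNgt; apply/negP => lt.
have [A Aap aA] : exists2 A : R, (ap <= A%:E)%E & A < alpha.
  move: lt; case: ap => [r| |] //; rewrite ?lte_fin => ?; first by exists r.
  by exists (alpha - 1); rewrite ?leNye// ltrBlDr ltrDl.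
have := limit_exponent_le S (fun p => word_sum_ratio_le i0 phiC psiC phi_lt0 p Aap) h.
by rewrite leNgt aA.
Qed.

Lemma pressure_sum_le (b : R) : exists Z : R, forall n,
  \sum_(p : n.-tuple I) expR (t b * word_sum i0 phi p + b * word_sum i0 psi p) <= Z.
Proof.
have P0 := temperatureP i0 phiC psiC eta0 decay b.
have potC := bounded_distortion_lin (t b) b phiC psiC.
set C := (X in bounded_distortion _ X) in potC.
exists (expR (4 * C)) => n.
have /andP[_] := zeta_pressure i0 potC n; rewrite P0 mulr0 add0r.
rewrite -ler_expR lnK ?posrE ?(zeta_gt0 i0 potC)//.
apply: le_trans; apply: ler_sum => p _.
by have /andP[+ _] := cyl_sup_word_sum i0 potC p; rewrite word_sum_lin.
Qed.

Hypotheses (am_le : (am <= alpha%:E)%E) (le_ap : (alpha%:E <= ap)%E).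

Lemma legendre_temperature : exists D : R, [/\ 0 <= D,
  (- legendre t (- alpha) = D%:E)%E,
  forall b, D <= alpha * b + t b &
  forall e, 0 < e -> exists b, alpha * b + t b < D + e].
Proof.
have tge b : 0 <= alpha * b + t b.
  exact: (temperature_ge0 i0 phiC psiC phi_lt0 eta0 decay b am_le le_ap).
have hub : (legendre t (- alpha) <= 0)%E.
  apply: ge_ereal_sup => _ [b _ <-]; rewrite lee_fin; have := tge b; lra.
have hlb b : ((- alpha * b - t b)%:E <= legendre t (- alpha))%E.
  by apply: ereal_sup_ubound; exists b.
have /fineK E : legendre t (- alpha) \is a fin_num.
  rewrite fin_numE; apply/andP; split; apply/eqP => h.
    by have := hlb 0; rewrite h.
  by move: hub; rewrite h.
set v := fine _ in E; exists (- v); split.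
- by rewrite oppr_ge0 -lee_fin E.
- by rewrite -E EFinN.
- by move=> b; have := hlb b; rewrite -E lee_fin; lra.
- move=> e e0; have : ((v - e)%:E < legendre t (- alpha))%E.
    by rewrite -E lte_fin ltrBlDr ltrDl.
  move=> /ereal_sup_gt[_ /= [b _ <-]]; rewrite lte_fin => h; exists b.
  by move: h; lra.
Qed.

Lemma limit_exponent_dim : (hausdorff_dim LE <= - legendre t (- alpha))%E.
Proof.
have [D [D0 -> Dle Dinf]] := legendre_temperature.
apply/lee_addgt0Pr => e e0; rewrite -EFinD.
have e20 : 0 < e / 2 by rewrite divr_gt0.
have [b hb] := Dinf _ e20; have [Z hZ] := pressure_sum_le b.
have th0 : 0 < e / 4 by rewrite divr_gt0.
have ge0 : 0 <= alpha * b + t b := le_trans D0 (Dle b).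
have H := limit_exponent_measure0 S th0 ge0 hZ.
apply: le_trans (hausdorff_dim_le _ H) _.
  by rewrite addr_ge0// mulr_ge0// ltW.
by rewrite lee_fin; move: hb; lra.
Qed.

Lemma has_exponent_dim_ge : (- legendre t (- alpha) <= hausdorff_dim HE)%E.
Proof.
have [D [D0 -> Dle _]] := legendre_temperature.
(* The construction of branches needs [D > 0]; for [D = 0] the bound is the nonnegativity of the
   dimension. *)
move: D0; rewrite le_eqVlt => /predU1P[<-|D0]; first exact: hausdorff_dim_ge0.
apply: (has_exponent_dim (S := S) D0) => e e0.
have C0 : 0 <= `|D| * ci_Cf S + ci_Cp S + `|alpha| * ci_Cf S.
  have Cf0 := bounded_distortion_ge0 i0 phiC; have Cp0 := bounded_distortion_ge0 i0 psiC.
  by rewrite !addr_ge0 ?mulr_ge0.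
have [L [T [h1 h2 h3 h4]]] := homogeneous_blocks phiC psiC (ltW D0) C0
  (fun b n => tilted_sum_ge i0 phiC psiC phi_lt0 eta0 decay b n Dle) (ci_sep S) e0.
by exists L, T; split.
Qed.

Lemma level_dim (A : set R) : HE `<=` A -> A `<=` LE ->
  hausdorff_dim A = (- legendre t (- alpha))%E.
Proof.
move=> h1 h2; apply/eqP; rewrite eq_le; apply/andP; split.
  exact: le_trans (hausdorff_dimS h2) limit_exponent_dim.
exact: le_trans has_exponent_dim_ge (hausdorff_dimS h1).
Qed.

End Spectrum.
Theorem theorem1p1 (R : realType) (I : finType) (i0 : I)
    (Phi : conformal_ifs R I)
    (osc : open_set_condition Phi)
    (phi_lt0 : forall w : nat -> I, geom_potential Phi w < 0)
    (psi : (nat -> I) -> R)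
    (psi_holder : holder psi)
    (psi_normalized : pressure psi = 0)
    (mu_psi : probability (borel_seq R i0) R)
    (mu_psi_gibbs : is_gibbs psi mu_psi)
    (alpha : R) :
  let phi := geom_potential Phi in
  let mu : set R -> \bar R :=
    pushforward mu_psi (coding Phi : borel_seq R i0 -> measurableTypeR R) in
  let Lambda := attractor Phi in
  let am := alpha_minus phi psi in
  let ap := alpha_plus phi psi in
  let t := temperature phi psi in
  ((am <= alpha%:E)%E /\ (alpha%:E <= ap)%E ->
    [/\ hausdorff_dim (level_liminf Lambda mu alpha)
          = (- legendre t (- alpha)%R)%E,
        hausdorff_dim (level_limsup Lambda mu alpha)
          = (- legendre t (- alpha)%R)%E,
        hausdorff_dim (level_lim Lambda mu alpha)
          = (- legendre t (- alpha)%R)%E &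
        hausdorff_dim (level_seq Lambda mu alpha)
          = (- legendre t (- alpha)%R)%E]) /\
  (~ ((am <= alpha%:E)%E /\ (alpha%:E <= ap)%E) ->
    [/\ level_liminf Lambda mu alpha = set0,
        level_limsup Lambda mu alpha = set0,
        level_lim Lambda mu alpha = set0 &
        level_seq Lambda mu alpha = set0]).
Proof.
move=> phi mu Lambda am ap t.
have [S] := coded_intervals_exist psi_holder psi_normalized mu_psi_gibbs osc phi_lt0.
pose LE := [set x | exists w, x = coding Phi w /\
  limit_exponent (fun x r => fine (mu (ball x r))) alpha x].
have lim_LE : level_lim Lambda mu alpha `<=` LE.
  by apply: subset_trans (@level_lim_seq _ _ _ _ _) (@level_seq_limit_exponent _ _ _ _ _).
have liminf_LE : level_liminf Lambda mu alpha `<=` LE by exact: level_liminf_limit_exponent.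
have limsup_LE : level_limsup Lambda mu alpha `<=` LE by exact: level_limsup_limit_exponent.
have seq_LE : level_seq Lambda mu alpha `<=` LE by exact: level_seq_limit_exponent.
split=> [[h1 h2]|h].
  have HE_lim := @has_exponent_level_lim R I (coding Phi) mu alpha.
  have dimE := level_dim S phi_lt0 h1 h2.
  split; apply: dimE => //; apply: subset_trans HE_lim _.
  - exact: level_lim_liminf.
  - exact: level_lim_limsup.
  - exact: level_lim_seq.
have LE0 : LE `<=` set0.
  move=> x LEx; apply: h; split.
    exact: (limit_exponent_alpha_minus S phi_lt0 LEx).
  exact: (limit_exponent_alpha_plus S phi_lt0 LEx).
by split; rewrite -subset0; apply: subset_trans LE0.
Qed.
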